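(* Let $n\ge 2$, let $U,V\subset\mathbb{C}$ be bounded domains, and let $\Phi:\Sigma^nU\to\Sigma^nV$ be a proper holomorphic map. Then there is a proper holomorphic map $\varphi:U\to V$ such that $\Phi=\Sigma^n\varphi$.
   Context: Let $\pi=(\pi_1,\dots,\pi_n):\mathbb{C}^n\to\mathbb{C}^n$ be the symmetrization map, where $\pi_k(z)=\sum_{J\subset\{1,\dots,n\},\,|J|=k}\prod_{j\in J}z_j$ is the $k$-th elementary symmetric polynomial in $n$ variables. For a domain $U\subset\mathbb{C}$, $\Sigma^nU=\pi(U^n)$, which is a domain in $\mathbb{C}^n$. For a map $\psi:U\to V$ of planar domains, $\Sigma^n\psi:\Sigma^nU\to\Sigma^nV$ is the unique map such that $(\Sigma^n\psi)(\pi(z_1,\dots,z_n))=\pi(\psi(z_1),\dots,\psi(z_n))$ for all $(z_1,\dots,z_n)\in U^n$. *)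

(* Defs.v *)
From HB Require Import structures.
From mathcomp Require Import all_boot all_order all_algebra.
From mathcomp Require Import all_classical all_reals.
From mathcomp Require Import topology normedtype derive.
From mathcomp Require Import complex.

Set Implicit Arguments.
Unset Strict Implicit.
Unset Printing Implicit Defensive.

Import Order.TTheory GRing.Theory Num.Theory.
Import numFieldNormedType.Exports.

Local Open Scope classical_set_scope.
Local Open Scope ring_scope.
Local Open Scope complex_scope.

(* R[i] as a one-dimensional normed module over itself, with the topology of
   the modulus; 'rV[R[i]]_n then carries the product topology. *)
HB.instance Definition _ (R : realType) := GRing.ComAlgebra.copy R[i] R[i]^o.
HB.instance Definition _ (R : realType) := Vector.copy R[i] R[i]^o.
HB.instance Definition _ (R : realType) := NormedModule.copy R[i] R[i]^o.

Definition domain (T : topologicalType) (A : set T) : Prop :=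
  [/\ open A, connected A & A !=set0].

(* A map A -> B is represented by a function on the whole space, of which only
   the values on A matter.  When A is open, differentiability over the field
   K at the points of A depends only on these values; for K = R[i] it is
   holomorphy. *)
Definition holomorphic_on (K : numFieldType) (V W : normedModType K)
    (A : set V) (f : V -> W) : Prop :=
  forall x, A x -> differentiable f x.

Definition proper_map (S T : topologicalType) (A : set S) (B : set T)
    (f : S -> T) : Prop :=
  (forall x, A x -> B (f x)) /\
  forall K : set T, K `<=` B -> compact K -> compact (A `&` f @^-1` K).

Definition proper_holomorphic (K : numFieldType) (V W : normedModType K)
    (A : set V) (B : set W) (f : V -> W) : Prop :=
  holomorphic_on A f /\ proper_map A B f.

Section Symmetrization.
Variables (C : numClosedFieldType) (n : nat).
Implicit Types (z w : 'rV[C]_n) (U : set C) (psi : C -> C).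

Definition esym (k : nat) z : C :=
  \sum_(J : {set 'I_n} | #|J| == k) \prod_(j in J) z ord0 j.

(* the coordinates 0, ..., n-1 of the row vector hold pi_1, ..., pi_n *)
Definition symmetrization z : 'rV[C]_n := \row_(k < n) esym k.+1 z.

Definition cart_power U : set 'rV[C]_n := [set z | forall i, U (z ord0 i)].

Definition sym_power U : set 'rV[C]_n := symmetrization @` cart_power U.

(* A point of sym_power U is lifted to some point of cart_power U; the result
   does not depend on the choice of the lift, see sym_mapE.  The value outside
   sym_power U is irrelevant. *)
Definition sym_map U psi w : 'rV[C]_n :=
  symmetrization
    (map_mx psi (xget 0 [set z | cart_power U z /\ symmetrization z = w])).

Let root_poly z : {poly C} := \prod_i ('X - (z ord0 i)%:P).

Lemma root_polyE z :
  root_poly z = \poly_(k < n.+1) ((-1) ^+ (n - k) * esym (n - k) z).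
Proof.
rewrite /root_poly (eq_bigr (fun i => - (z ord0 i)%:P + 'X)); last first.
  by move=> i _; rewrite addrC.
rewrite bigA_distr poly_def.
have cardJ (J : {set 'I_n}) : (#|J| < n.+1)%N.
  by rewrite ltnS -[X in (_ <= X)%N]card_ord max_card.
rewrite (partition_big (fun J : {set 'I_n} => rev_ord (Ordinal (cardJ J)))
  predT) //=.
apply: eq_bigr => k _; rewrite /esym mulr_sumr scaler_suml.
apply: eq_big => [J|J /eqP Jk].
  rewrite -val_eqE /= subSS; have := cardJ J; have := ltn_ord k.
  by rewrite !ltnS => kn Jn; apply/eqP/eqP => [<-|->]; rewrite subKn.
have kE : k = (n - #|J|)%N :> nat by rewrite -Jk /= subSS.
have nk : (n - k)%N = #|J| by rewrite kE subKn // -ltnS.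
rewrite nk (bigID (mem J)) /=; rewrite (eq_bigr (fun i => - (z ord0 i)%:P));
  last by move=> i ->.
rewrite [X in _ * X](eq_bigr (fun=> 'X)); last by move=> i /negPf ->.
rewrite prodr_const (eq_bigr (fun i => (- z ord0 i)%:P)); last first.
  by move=> i _; rewrite polyCN.
rewrite -rmorph_prod /= mul_polyC prodrN; congr (_ *: 'X^_).
by rewrite kE -[X in (X - _)%N]card_ord -[X in (X - _)%N](cardC (mem J)) addKn.
Qed.

Lemma symmetrization_eq_perm z z' :
  symmetrization z = symmetrization z' <->
  perm_eq [seq z ord0 i | i : 'I_n] [seq z' ord0 i | i : 'I_n].
Proof.
have rpE y : root_poly y =
    \prod_(x <- [seq y ord0 i | i : 'I_n]) ('X - x%:P).
  by rewrite big_image.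
split=> [zz'|]; [apply: prod_XsubC_eq; rewrite -!rpE !root_polyE|].
  apply/polyP => k; rewrite !coef_poly; case: ifP => // kn; congr (_ * _).
  case nk : (n - k)%N => [|m].
    by rewrite /esym; apply: eq_bigr => J /eqP/cards0_eq ->; rewrite !big_set0.
  have mn : (m < n)%N by rewrite -nk leq_subr.
  by have /rowP/(_ (Ordinal mn)) := zz'; rewrite !mxE.
move=> /(perm_big _)/= pE.
have /polyP e : root_poly z = root_poly z' by rewrite !rpE pE.
apply/rowP => k; rewrite !mxE; have := e (n - k.+1)%N; rewrite !root_polyE.
rewrite !coef_poly ltnS leq_subr subKn //; apply: mulfI.
by rewrite expf_neq0 // oppr_eq0 oner_eq0.
Qed.

Lemma sym_mapE U psi z : cart_power U z ->
  sym_map U psi (symmetrization z) = symmetrization (map_mx psi z).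
Proof.
move=> Uz; rewrite /sym_map.
case: xgetP => [y _ [_ /symmetrization_eq_perm yz]|/(_ z)]; last by case.
have mapE x : [seq (map_mx psi x) ord0 i | i : 'I_n] =
    map psi [seq x ord0 i | i : 'I_n].
  by rewrite -map_comp; apply: eq_map => i; rewrite /= mxE.
by apply/symmetrization_eq_perm; rewrite !mapE perm_map.
Qed.

Lemma sym_map_unique U psi (F : 'rV[C]_n -> 'rV[C]_n) :
  (forall z, cart_power U z ->
     F (symmetrization z) = symmetrization (map_mx psi z)) ->
  forall w, sym_power U w -> F w = sym_map U psi w.
Proof. by move=> FE _ [z Uz <-]; rewrite FE // sym_mapE. Qed.

End Symmetrization.

Arguments cart_power {C} n U.
Arguments sym_power {C} n U.

(* Main.v *)
Require Import Defs.
From mathcomp Require Import all_boot all_order all_algebra.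
From mathcomp Require Import all_classical all_reals.
From mathcomp Require Import topology normedtype sequences derive exp trigo.
From mathcomp Require Import measure lebesgue_measure lebesgue_integral ftc.
From mathcomp Require Import perm.
From mathcomp Require Import ring lra.
From mathcomp Require Import complex.

Import Order.TTheory GRing.Theory Num.Theory.
Import numFieldNormedType.Exports.

Set Implicit Arguments.
Unset Strict Implicit.
Unset Printing Implicit Defensive.

Local Open Scope classical_set_scope.
Local Open Scope ring_scope.
Local Open Scope complex_scope.

(** The proof works with the polynomials [P z] whose roots are the coordinates
    of a lift of [Phi (symmetrization z)], for [z] in [U^n].

    Let the coordinate [x = z_i] tend to the boundary of [U] along an
    ultrafilter, the other coordinates being fixed.  The limit polynomials
    still depend holomorphically on these coordinates, their roots lie in the
    closure of [V] and, by properness, one of them lies on the boundary of [V].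
    Where the roots are locally holomorphic functions, one of them takes its
    values in the boundary of [V], which has empty interior; hence it is
    constant, and by the identity theorem it is a common root of all the limit
    polynomials.  So the resultant of [P z] and [P w], for [z] and [w] with the
    same [i]-th coordinate [x], tends to [0] as [x] tends to the boundary, and
    it vanishes by the maximum principle.  Consequently the polynomials [P z]
    with [z_i = x] have a common root [phi x].

    Freezing [z_i] and dividing by this common factor decreases both the degree
    and the number of variables by one while preserving properness, so the
    degree is never smaller than the number of variables.  As both are equal to
    [n] at the start, [phi x] is unique, it is a simple root of some [P z], and
    [phi] is nowhere locally constant.  Thus [phi] is holomorphic, and [P z] is
    the product of the ['X - phi z_i], first when the [phi z_i] are distinct,
    then everywhere by density.

    The one-variable theory is reduced to the maximum principle: it is applied
    to iterated difference quotients, which are continuous and are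
    differentiable outside finitely many points, to obtain Lipschitz and Taylor
    bounds.  Being uniform, these pass to limits along ultrafilters. *)

(** * Goursat's theorem on a rectangle *)

Section Goursat.
Variable R : realType.

(** The roots of [P z] branch, so a lift of [Phi] cannot be chosen holomorphically. Apart from the
    leading 1, the coefficients of [P z] are up to sign the coordinates of [Phi], and every argument
    goes through them. The boundaries of [U] and [V] may be arbitrarily irregular: the boundary of
    [V] enters only as a compact set with empty interior, that of [U] only through ultrafilters on
    [U] without limit in [U], along which all bounded functions converge at once. The boundary root
    of the limit polynomials depends on the ultrafilter; the resultant eliminates it and tends to 0
    along all of them, which is what the maximum principle requires. Such a root exists because
    otherwise the roots would stay in a compact part of [V], and properness would keep [x] in a
    compact part of [U]. The inequality between degree and number of variables settles all
    degenerate cases: a second common root, a double one or a constant one would produce a proper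
    family whose degree is smaller than its number of variables. *)

Definition primitive (a : R) (f : R -> R) (x : R) : R :=
  \int[lebesgue_measure]_(t in [set` `[a, x]]) f t.

Lemma is_derive_primitive (f : R -> R) (a x : R) : continuous f -> a < x ->
  is_derive x 1 (primitive a f) (f x).
Proof.
move=> cf ax; have xu : x < x + 1 by rewrite ltrDl.
have [|dF <-] := @continuous_FTC1_closed R f a x _ xu _ ax (cf x).
  apply: continuous_compact_integrable; first exact: segment_compact.
  exact: continuous_subspaceT.
by rewrite derive1E; apply: derivableP.
Qed.

Lemma primitive_MVT (F f : R -> R) (a b : R) : a <= b ->
  (forall x, a <= x <= b -> is_derive x 1 F (f x)) ->
  exists2 c, a <= c <= b & F b - F a = f c * (b - a).
Proof.
move=> ab dF; have [||c] := @MVT_segment R F f a b ab.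
- by move=> x; rewrite in_itv /= => /andP[ax xb]; apply: dF; rewrite !ltW.
- apply: derivable_within_continuous => x; rewrite in_itv /= => xab.
  by have := dF x xab; case.
by rewrite in_itv /= => cab ->; exists c.
Qed.

Lemma primitive_le (F f : R -> R) (a b k : R) : a <= b ->
  (forall x, a <= x <= b -> is_derive x 1 F (f x)) ->
  (forall x, a <= x <= b -> f x <= k) -> F b - F a <= k * (b - a).
Proof.
move=> ab dF fk; have [c cab ->] := primitive_MVT ab dF.
by rewrite ler_wpM2r ?subr_ge0 // fk.
Qed.

Lemma primitive_bound (F f : R -> R) (a b k e : R) : a <= b ->
  (forall x, a <= x <= b -> is_derive x 1 F (f x)) ->
  (forall x, a <= x <= b -> `|f x - k| <= e) ->
  `|F b - F a - k * (b - a)| <= e * (b - a).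
Proof.
move=> ab dF fk.
have [c /fk ck ->] := primitive_MVT ab dF.
by rewrite -mulrBl normrM (ger0_norm (_ : 0 <= b - a)) ?subr_ge0 // ler_wpM2r // subr_ge0.
Qed.

Lemma half_pow_lt (K d : R) : 0 < d -> exists n, K * 2^-1 ^+ n < d.
Proof.
move=> d0; exists (Num.Def.archi_bound (K / d)).
set n := Num.Def.archi_bound _.
have [K0|K0] := leP K 0.
  by apply: le_lt_trans d0; rewrite mulr_le0_ge0 // exprn_ge0 // invr_ge0.
have Kn : K / d < n%:R by apply: archi_boundP; rewrite divr_ge0 // ltW.
rewrite exprVn ltr_pdivrMr ?exprn_gt0 // mulrC -ltr_pdivrMr //.
by apply: (lt_le_trans Kn); rewrite -natrX ler_nat ltnW // ltn_expl.
Qed.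

Variables (p q : R -> R -> R) (Y X : R -> R -> R) (a c al be : R).
Hypotheses (al0 : 0 < al) (be0 : 0 < be).

Let rect s t := (a <= s <= a + al) && (c <= t <= c + be).

Hypothesis dY : forall s t, rect s t -> is_derive t 1 (Y s) (p s t).
Hypothesis dX : forall s t, rect s t -> is_derive s 1 (X t) (q s t).
(** The common coefficient [k] says that the form p dt + q ds is closed: the [s]-derivative of [p]
    equals the [t]-derivative of [q]. As in Goursat's theorem, differentiability is asked point by
    point. *)
Hypothesis dpq : forall s t, rect s t -> exists k l m : R,
  forall e, 0 < e -> exists2 d : R, 0 < d & forall s' t', rect s' t' ->
    `|s' - s| < d -> `|t' - t| < d ->
    `|p s' t' - p s t - k * (s' - s) - l * (t' - t)| <= e * (`|s' - s| + `|t' - t|) /\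
    `|q s' t' - q s t - m * (s' - s) - k * (t' - t)| <= e * (`|s' - s| + `|t' - t|).

(* The circulation of [p dt + q ds] along the boundary of the rectangle with
   corner [(s, t)] and sides [al * h], [be * h]: bisection keeps the shape. *)
Let D s t h :=
  (Y (s + al * h) (t + be * h) - Y (s + al * h) t - (Y s (t + be * h) - Y s t)) -
  (X (t + be * h) (s + al * h) - X (t + be * h) s - (X t (s + al * h) - X t s)).

Let sub s t h := [&& a <= s, s + al * h <= a + al, c <= t, t + be * h <= c + be
  & 0 < h].

Let Ddouble s t h : D s t (2 * h) =
  D s t h + D (s + al * h) t h + D s (t + be * h) h + D (s + al * h) (t + be * h) h.
Proof.
rewrite /D.
have -> : s + al * (2 * h) = s + al * h + al * h by ring.
have -> : t + be * (2 * h) = t + be * h + be * h by ring.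
ring.
Qed.

(** Pigeonhole: if all four quarters stayed below [eta * h ^+ 2], their sum could not reach
    [eta * (2 * h) ^+ 2]. *)
Let Dstep s t h eta : sub s t (2 * h) -> eta * (2 * h) ^+ 2 <= `|D s t (2 * h)| ->
  exists s' t', [/\ sub s' t' h, eta * h ^+ 2 <= `|D s' t' h|,
    s <= s', s' + al * h <= s + al * (2 * h) &
    t <= t' /\ t' + be * h <= t + be * (2 * h)].
Proof.
move=> /and5P[as_ sa ct tc h20]; have h0 : 0 < h by lra.
have alh : 0 < al * h by rewrite mulr_gt0.
have beh : 0 < be * h by rewrite mulr_gt0.
have E1 : al * (2 * h) = al * h + al * h by ring.
have E2 : be * (2 * h) = be * h + be * h by ring.
rewrite E1 in sa *; rewrite E2 in tc *.
rewrite Ddouble => big.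
have [H|H1] := leP (eta * h ^+ 2) `|D s t h|.
  by exists s, t; rewrite /sub; split => //; first [by apply/and5P; split; lra|lra|split; lra].
have [H|H2] := leP (eta * h ^+ 2) `|D (s + al * h) t h|.
  by exists (s + al * h), t; rewrite /sub; split => //; first [by apply/and5P; split; lra|lra|split; lra].
have [H|H3] := leP (eta * h ^+ 2) `|D s (t + be * h) h|.
  by exists s, (t + be * h); rewrite /sub; split => //; first [by apply/and5P; split; lra|lra|split; lra].
have [H|H4] := leP (eta * h ^+ 2) `|D (s + al * h) (t + be * h) h|.
  by exists (s + al * h), (t + be * h); rewrite /sub; split => //; first [by apply/and5P; split; lra|lra|split; lra].
exfalso; move: big; rewrite leNgt => /negP; apply.
have -> : eta * (2 * h) ^+ 2 = eta * h ^+ 2 + eta * h ^+ 2 + eta * h ^+ 2 + eta * h ^+ 2 by ring.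
apply: le_lt_trans (ler_normD _ _) _; apply: ltrD => //.
apply: le_lt_trans (ler_normD _ _) _; apply: ltrD => //.
by apply: le_lt_trans (ler_normD _ _) _; apply: ltrD.
Qed.

(** The affine parts of [p] and [q] contribute [k * (al * h) * (be * h)] to each of the two brackets
    of [D], and these cancel. What remains is an error of order [e * (al + be) * h] integrated over
    the sides, hence quadratic in [h]. *)
Let Dsmall S T k l m e d s t h : rect S T ->
  (forall s' t', rect s' t' -> `|s' - S| < d -> `|t' - T| < d ->
    `|p s' t' - p S T - k * (s' - S) - l * (t' - T)| <= e * (`|s' - S| + `|t' - T|) /\
    `|q s' t' - q S T - m * (s' - S) - k * (t' - T)| <= e * (`|s' - S| + `|t' - T|)) ->
  0 < e -> sub s t h -> s <= S <= s + al * h -> t <= T <= t + be * h ->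
  (al + be) * h < d ->
  `|D s t h| <= 2 * e * (al + be) ^+ 2 * h ^+ 2.
Proof.
move=> rST H e0 /and5P[as_ sa ct tc h0] /andP[sS Ss] /andP[tT Tt] hd.
have alh : 0 < al * h by rewrite mulr_gt0.
have beh : 0 < be * h by rewrite mulr_gt0.
rewrite mulrDl in hd.
have near s' t' : s <= s' <= s + al * h -> t <= t' <= t + be * h ->
    [/\ rect s' t',
    `|p s' t' - p S T - k * (s' - S) - l * (t' - T)| <= e * (al * h + be * h) &
    `|q s' t' - q S T - m * (s' - S) - k * (t' - T)| <= e * (al * h + be * h)].
  move=> /andP[ss' s's] /andP[tt' t't].
  have r' : rect s' t' by rewrite /rect; apply/andP; split; apply/andP; split; lra.
  have n1 : `|s' - S| <= al * h by rewrite ler_norml; apply/andP; split; lra.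
  have n2 : `|t' - T| <= be * h by rewrite ler_norml; apply/andP; split; lra.
  have [||H1 H2] := H s' t' r'; [lra|lra|].
  have le : e * (`|s' - S| + `|t' - T|) <= e * (al * h + be * h).
    by rewrite ler_pM2l // lerD.
  by split => //; [apply: le_trans H1 _|apply: le_trans H2 _].
have B1 : `|(Y (s + al * h) (t + be * h) - Y s (t + be * h)) -
           (Y (s + al * h) t - Y s t) - k * (al * h) * (t + be * h - t)| <=
    2 * e * (al * h + be * h) * (t + be * h - t).
  apply: (@primitive_bound (fun u => Y (s + al * h) u - Y s u)
    (fun u => p (s + al * h) u - p s u)); first by lra.
    move=> u tu; have [||r1 _ _] := near (s + al * h) u => //; first by lra.
    have [||r2 _ _] := near s u => //; first by lra.
    by have := is_deriveB (dY r1) (dY r2).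
  move=> u tu; have [||_ H1 _] := near (s + al * h) u => //; first by lra.
  have [||_ H2 _] := near s u => //; first by lra.
  set A := (X in `|X| <= _) in H1; set B := (X in `|X| <= _) in H2.
  have -> : p (s + al * h) u - p s u - k * (al * h) = A - B by rewrite /A /B; ring.
  by apply: le_trans (ler_normB _ _) _; lra.
have B2 : `|(X (t + be * h) (s + al * h) - X t (s + al * h)) -
           (X (t + be * h) s - X t s) - k * (be * h) * (s + al * h - s)| <=
    2 * e * (al * h + be * h) * (s + al * h - s).
  apply: (@primitive_bound (fun u => X (t + be * h) u - X t u)
    (fun u => q u (t + be * h) - q u t)); first by lra.
    move=> u tu; have [||r1 _ _] := near u (t + be * h) => //; first by lra.
    have [||r2 _ _] := near u t => //; first by lra.
    by have := is_deriveB (dX r1) (dX r2).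
  move=> u tu; have [||_ _ H1] := near u (t + be * h) => //; first by lra.
  have [||_ _ H2] := near u t => //; first by lra.
  set A := (X in `|X| <= _) in H1; set B := (X in `|X| <= _) in H2.
  have -> : q u (t + be * h) - q u t - k * (be * h) = A - B by rewrite /A /B; ring.
  by apply: le_trans (ler_normB _ _) _; lra.
set A := (X in `|X| <= _) in B1; set B := (X in `|X| <= _) in B2.
have -> : D s t h = A - B by rewrite /D /A /B; ring.
apply: le_trans (ler_normB _ _) _; apply: le_trans (lerD B1 B2) _.
by rewrite le_eqVlt; apply/orP; left; apply/eqP; ring.
Qed.

Theorem goursat_rectangle :
  Y (a + al) (c + be) - Y (a + al) c - (Y a (c + be) - Y a c) =
  X (c + be) (a + al) - X (c + be) a - (X c (a + al) - X c a).
Proof.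
apply/eqP; rewrite -subr_eq0; apply/eqP.
suff : D a c 1 = 0 by rewrite /D !mulr1.
apply/eqP/negP => /negP D0; pose eta := `|D a c 1|.
have eta0 : 0 < eta by rewrite normr_gt0.
pose st := (nat * (R * R))%type.
pose hh n : R := 2^-1 ^+ n.
have hhS n : hh n = 2 * hh n.+1 by rewrite /hh exprS mulrA divff ?mul1r // pnatr_eq0.
have hh0 n : 0 < hh n by rewrite exprn_gt0 // invr_gt0.
pose inv (z : st) := sub z.2.1 z.2.2 (hh z.1) /\
  eta * hh z.1 ^+ 2 <= `|D z.2.1 z.2.2 (hh z.1)|.
pose T := {z : st | inv z}.
pose rel (x y : T) := let z := sval x in let z' := sval y in
  [/\ z'.1 = z.1.+1, z.2.1 <= z'.2.1, z'.2.1 + al * hh z'.1 <= z.2.1 + al * hh z.1,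
      z.2.2 <= z'.2.2 & z'.2.2 + be * hh z'.1 <= z.2.2 + be * hh z.1].
have step x : {y | rel x y}.
  apply: cid; have := svalP x; rewrite /rel; case: (sval x) => n [s t].
  rewrite /inv /= hhS => -[i1 i2].
  have [s' [t' [j1 j2 j3 j4 [j5 j6]]]] := Dstep i1 i2.
  exists (exist inv (n.+1, (s', t')) (conj j1 j2)).
  by split.
have inv0 : inv (0%N, (a, c)).
  rewrite /inv /= /hh expr0 expr1n mulr1 /sub !mulr1 !lexx ltr01 /=; split => //.
have [f [f0 fS]] := dependent_choice step (exist inv _ inv0).
pose n_ n := (sval (f n)).1; pose s_ n := (sval (f n)).2.1; pose t_ n := (sval (f n)).2.2.
have nE n : n_ n = n.
  by elim: n => [|n IH]; rewrite /n_ ?f0 //; case: (fS n) => -> *; rewrite -/(n_ n) IH.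
have sub_n n : sub (s_ n) (t_ n) (hh n) /\ eta * hh n ^+ 2 <= `|D (s_ n) (t_ n) (hh n)|.
  by have := svalP (f n); rewrite /inv -/(n_ n) nE.
have mono n k : [/\ s_ n <= s_ (n + k)%N, s_ (n + k)%N + al * hh (n + k)%N <= s_ n + al * hh n,
    t_ n <= t_ (n + k)%N & t_ (n + k)%N + be * hh (n + k)%N <= t_ n + be * hh n].
  elim: k => [|k [I1 I2 I3 I4]]; first by rewrite addn0; split.
  rewrite addnS; have := fS (n + k)%N; rewrite /rel /=.
  rewrite -/(n_ (n + k)%N) -/(n_ (n + k).+1) !nE.
  rewrite -/(s_ (n + k)%N) -/(s_ (n + k).+1) -/(t_ (n + k)%N) -/(t_ (n + k).+1).
  move=> [_ J1 J2 J3 J4].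
  by split; [apply: le_trans J1|apply: le_trans I2|apply: le_trans J3|apply: le_trans I4].
have cross m n : s_ m <= s_ n + al * hh n /\ t_ m <= t_ n + be * hh n.
  have hm k : 0 < al * hh k by rewrite mulr_gt0.
  have hb k : 0 < be * hh k by rewrite mulr_gt0.
  have [I1 I2 I3 I4] := mono n m; have [J1 J2 J3 J4] := mono m n.
  rewrite [(m + n)%N]addnC in J1 J2 J3 J4.
  by split; [have := hm (n + m)%N|have := hb (n + m)%N]; lra.
(* The lower corners stay below all the upper corners, so their suprema give a point of every
   rectangle. *)
pose S := sup (range s_); pose TT := sup (range t_).
have Sn n : s_ n <= S <= s_ n + al * hh n.
  apply/andP; split.
    by apply: ub_le_sup; [exists (s_ n + al * hh n) => _ [m _ <-]; case: (cross m n)|exists n].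
  by apply: ge_sup; [exists (s_ 0%N); exists 0%N|move=> _ [m _ <-]; case: (cross m n)].
have Tn n : t_ n <= TT <= t_ n + be * hh n.
  apply/andP; split.
    by apply: ub_le_sup; [exists (t_ n + be * hh n) => _ [m _ <-]; case: (cross m n)|exists n].
  by apply: ge_sup; [exists (t_ 0%N); exists 0%N|move=> _ [m _ <-]; case: (cross m n)].
have rST : rect S TT.
  have [/and5P[I1 I2 I3 I4 _] _] := sub_n 0%N.
  have /andP[J1 J2] := Sn 0%N; have /andP[J3 J4] := Tn 0%N.
  by rewrite /rect; apply/andP; split; apply/andP; split; lra.
have [k [l [m H]]] := dpq rST.
have K0 : 0 < 4 * (al + be) ^+ 2 by rewrite mulr_gt0 // exprn_gt0 // addr_gt0.
(* With this [e] the bound of [Dsmall] is [eta / 2 * h ^+ 2], below the lower bound preserved by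
   bisection. *)
have e0 : 0 < eta / (4 * (al + be) ^+ 2) by rewrite divr_gt0.
have [d d0 Hd] := H _ e0.
have [n nd] := half_pow_lt (al + be) d0.
have [sn bign] := sub_n n.
have := Dsmall rST Hd e0 sn (Sn n) (Tn n) nd.
apply/negP; rewrite -ltNge; apply: lt_le_trans bign.
have hn2 : 0 < hh n ^+ 2 by rewrite exprn_gt0.
rewrite ltr_pM2r //.
have -> : 2 * (eta / (4 * (al + be) ^+ 2)) * (al + be) ^+ 2 = eta / 2.
  by field; rewrite gt_eqF // addr_gt0.
lra.
Qed.

End Goursat.

(** * The modulus and the topology of the complex numbers *)

Section ComplexModulus.
Variable R : realType.
Local Notation C := R[i].
Implicit Types (z w : C) (r e : R).

(** The norm of [R[i]] takes its values in [R[i]]; a modulus with values in [R] lets estimates be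
    made in an ordered field. *)
Definition cabs (z : C) : R := ComplexField.Normc.normc z.

Lemma cabsE z : `|z| = (cabs z)%:C. Proof. by []. Qed.

Lemma cabs_ge0 z : 0 <= cabs z.
Proof. by rewrite -lecR -cabsE normr_ge0. Qed.

Lemma cabsM z w : cabs (z * w) = cabs z * cabs w.
Proof. exact: ComplexField.Normc.normcM. Qed.

Lemma cabsD z w : cabs (z + w) <= cabs z + cabs w.
Proof. exact: le_normcD. Qed.

Lemma cabsN z : cabs (- z) = cabs z. Proof. exact: normcN. Qed.

Lemma cabsC z w : cabs (z - w) = cabs (w - z).
Proof. by rewrite -cabsN opprB. Qed.

Lemma cabs0 : cabs 0 = 0. Proof. exact: ComplexField.Normc.normc0. Qed.

Lemma cabs1 : cabs 1 = 1. Proof. exact: ComplexField.Normc.normc1. Qed.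

Lemma cabsV z : cabs z^-1 = (cabs z)^-1. Proof. exact: ComplexField.Normc.normcV. Qed.

Lemma cabsX z n : cabs (z ^+ n) = cabs z ^+ n.
Proof. by elim: n => [|n IH]; rewrite ?cabs1 // !exprS cabsM IH. Qed.

Lemma cabs_eq0 z : (cabs z == 0) = (z == 0).
Proof.
by apply/eqP/eqP => [/ComplexField.Normc.eq0_normc //|->]; rewrite cabs0.
Qed.

Lemma cabs_gt0 z : (0 < cabs z) = (z != 0).
Proof. by rewrite lt_def cabs_eq0 cabs_ge0 andbT. Qed.

Lemma cabs_real r : cabs r%:C = `|r|.
Proof. by rewrite /cabs /= expr0n /= addr0 sqrtr_sqr. Qed.

Lemma cabsB z w : cabs (z - w) <= cabs z + cabs w.
Proof. by rewrite -[cabs w]cabsN cabsD. Qed.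

Lemma cabs_distl z w : cabs z - cabs w <= cabs (z - w).
Proof. by rewrite lerBlDr -{1}[z](subrK w) cabsD. Qed.

Lemma cabs_dist3 z w t : cabs (z - w) <= cabs (z - t) + cabs (t - w).
Proof. by have -> : z - w = (z - t) + (t - w); [ring|exact: cabsD]. Qed.

Lemma Re_le_cabs z : complex.Re z <= cabs z.
Proof.
by apply: le_trans (ler_norm _) _; rewrite -lecR -cabsE normc_ge_Re.
Qed.

Lemma Im_le_cabs z : complex.Im z <= cabs z.
Proof.
have := Re_le_cabs (- 'i%C * z); rewrite cabsM.
have -> : cabs (- 'i%C) = 1.
  by rewrite cabsN /cabs /= expr0n /= add0r expr1n sqrtr1.
rewrite mul1r; apply: le_trans; case: z => a b /=.
by rewrite oppr0 mul0r sub0r mulN1r opprK.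
Qed.

Lemma cabs_i : cabs 'i%C = 1 :> R.
Proof. by rewrite /cabs /= expr0n /= add0r expr1n sqrtr1. Qed.

Lemma cabs_le_ReIm (x y : R) : cabs (x +i* y) <= `|x| + `|y|.
Proof.
have -> : x +i* y = x%:C + 'i%C * y%:C by rewrite [LHS]complexE.
by apply: le_trans (cabsD _ _) _; rewrite cabsM cabs_i mul1r !cabs_real.
Qed.

Lemma cabs_sum (I : Type) (s : seq I) (P : pred I) (F : I -> C) :
  cabs (\sum_(i <- s | P i) F i) <= \sum_(i <- s | P i) cabs (F i).
Proof.
elim/big_rec2: _ => [|i x y _ H]; first by rewrite cabs0.
by apply: le_trans (cabsD _ _) _; rewrite lerD2l.
Qed.

Lemma cabs_prod (I : Type) (s : seq I) (P : pred I) (F : I -> C) :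
  cabs (\prod_(i <- s | P i) F i) = \prod_(i <- s | P i) cabs (F i).
Proof.
elim/big_rec2: _ => [|i x y _ H]; first by rewrite cabs1.
by rewrite cabsM H.
Qed.

Lemma nbhs_realP (x : R) (A : set R) :
  nbhs x A <-> exists2 d, 0 < d & forall y, `|y - x| < d -> A y.
Proof.
split=> [/nbhs_ballP[d /= d0 H]|[d d0 H]].
  by exists d => // y yx; apply: H; rewrite -ball_normE /ball_ /= distrC.
apply/nbhs_ballP; exists d => // y.
by rewrite -ball_normE /ball_ /= distrC => /H.
Qed.

Lemma continuous_realP (f : R -> R) (x : R) : {for x, continuous f} <->
  forall e, 0 < e -> exists2 d, 0 < d & forall y, `|y - x| < d -> `|f y - f x| < e.
Proof.
split=> [cf e e0|H].
  have /cf /nbhs_realP[d d0 Hd] : nbhs (f x) [set y | `|y - f x| < e].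
    by apply/nbhs_realP; exists e.
  by exists d.
move=> A /nbhs_realP[r /H[d d0 Hd] rA].
by apply/nbhs_realP; exists d => // w /Hd /rA.
Qed.

Lemma nbhs_cabsP z (A : set C) :
  nbhs z A <-> exists2 r, 0 < r & forall w, cabs (w - z) < r -> A w.
Proof.
split=> [/nbhs_ballP[e /= e0 zA]|[r r0 zA]].
  have [e'0 eE] : 0 < complex.Re e /\ (complex.Re e)%:C = e.
    by move: e0; rewrite ltcE /= => /andP[/eqP e0 e1]; case: e e0 e1 {zA} => ? ? /= ->.
  exists (complex.Re e) => // w zw; apply: zA.
  by rewrite -ball_normE /ball_ /= cabsE -eE ltcR cabsC.
apply/nbhs_ballP; exists r%:C; first by rewrite /= ltcR.
by move=> w; rewrite -ball_normE /ball_ /= cabsE ltcR cabsC => /zA.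
Qed.

Lemma cvg_cabsP (T : Type) (F : set_system T) {FF : Filter F} (f : T -> C) l :
  f @ F --> l <-> forall e, 0 < e -> F [set x | cabs (f x - l) < e].
Proof.
split=> [fl e e0|H A /nbhs_cabsP[r r0 lA]].
  by apply: (fl [set y | cabs (y - l) < e]); apply/nbhs_cabsP; exists e.
by apply: filterS (H _ r0) => x; apply: lA.
Qed.

Lemma continuous_cabsP (f : C -> C) z : {for z, continuous f} <->
  forall e, 0 < e -> exists2 d, 0 < d & forall w, cabs (w - z) < d -> cabs (f w - f z) < e.
Proof.
split=> [cf e e0|H].
  have /nbhs_cabsP[d d0 Hd] := (@cvg_cabsP _ (nbhs z) (nbhs_filter z) f (f z)).1 cf e e0.
  by exists d.
move=> A /nbhs_cabsP[r /H[d d0 Hd] rA].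
by apply/nbhs_cabsP; exists d => // w /Hd /rA.
Qed.

Definition has_cderiv (f : C -> C) z l : Prop :=
  forall e, 0 < e -> exists2 d, 0 < d & forall w, cabs (w - z) < d ->
    cabs (f w - f z - l * (w - z)) <= e * cabs (w - z).

Lemma differentiable_cderivP (f : C -> C) z :
  differentiable f z <-> exists l, has_cderiv f z l.
Proof.
rewrite -derivable1_diffP; split => [/cvg_ex[/= l /cvg_cabsP H]|[l H]].
  exists l => e e0; have /nbhs_cabsP[d d0 Hd] := H e e0.
  exists d => // w wz; have [->|wz0] := eqVneq w z.
    by rewrite !subrr mulr0 subr0 cabs0 mulr0.
  have wz1 : w - z != 0 by rewrite subr_eq0.
  have := Hd (w - z); rewrite subr0 => /(_ wz wz1) /=.
  rewrite /GRing.scale /= mulr1 subrK => /ltW; rewrite -(ler_pM2r (_ : 0 < cabs (w - z))); last first.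
    by rewrite cabs_gt0.
  rewrite -cabsM; congr (cabs _ <= _).
  by rewrite mulrBl mulrAC mulVf // mul1r.
apply/cvg_ex; exists l; apply/cvg_cabsP => e e0.
have e2 : 0 < e / 2 by rewrite divr_gt0.
have [d d0 Hd] := H _ e2; apply/nbhs_cabsP; exists d => // h; rewrite subr0 => hd h0 /=.
rewrite /GRing.scale /= mulr1.
have := Hd (h + z); rewrite addrK => /(_ hd).
rewrite [X in _ <= X]mulrC -ler_pdivrMl ?cabs_gt0 // -cabsV -cabsM mulrBr mulrCA mulVf // mulr1.
by move/le_lt_trans; apply; rewrite ltr_pdivrMr // mulr_natr mulr2n ltrDl.
Qed.

Lemma cderiv_continuous (f : C -> C) z : differentiable f z -> {for z, continuous f}.
Proof. exact: differentiable_continuous. Qed.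

Lemma closure_cabsP (A : set C) z :
  closure A z <-> forall e, 0 < e -> exists2 w, A w & cabs (w - z) < e.
Proof.
split=> [Az e e0|H B /nbhs_cabsP[r /H[w Aw wz] rB]].
  have [|w [Aw wz]] := Az [set w | cabs (w - z) < e].
    by apply/nbhs_cabsP; exists e.
  by exists w.
by exists w; split=> //; exact: rB.
Qed.

(** The disc is a closed part of the continuous image of a compact square. *)
Lemma closed_disc_compact z r : compact [set w | cabs (w - z) <= r].
Proof.
pose g (p : R * R) : C := z + (p.1 +i* p.2).
pose K := g @` (`[- r, r]%classic `*` `[- r, r]%classic).
have cK : compact K.
  apply: continuous_compact; last by apply: compact_setX; exact: segment_compact.
  apply: continuous_subspaceT => p.
  move=> A /nbhs_cabsP[e e0 eA].
  have e2 : 0 < e / 2 by rewrite divr_gt0.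
  exists (ball p.1 (e / 2), ball p.2 (e / 2)); first by split; exact: nbhsx_ballx.
  move=> [x y] /= [px py]; apply: eA; rewrite /g /= opprD addrACA subrr add0r.
  have -> : x +i* y - p.1 +i* p.2 = (x - p.1) +i* (y - p.2) by [].
  apply: le_lt_trans (cabs_le_ReIm _ _) _; rewrite [e]splitr; apply: ltrD.
    by move: px; rewrite -ball_normE /ball_ /= distrC.
  by move: py; rewrite -ball_normE /ball_ /= distrC.
apply: (@subclosed_compact _ _ K) => //.
  move=> w /closure_cabsP H /=; rewrite leNgt; apply/negP => zw.
  have e0 : 0 < cabs (w - z) - r by rewrite subr_gt0.
  have [w' /= w'z w'w] := H _ e0.
  by have := cabs_dist3 w z w'; rewrite [cabs (w - w')]cabsC; lra.
move=> w /= wz; exists (complex.Re (w - z), complex.Im (w - z)); last first.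
  by rewrite /g /=; case: w z {wz K cK} @g => [a b] [c d] /=; congr Complex; ring.
split; rewrite /= in_itv /=; apply/andP; split.
- by have := Re_le_cabs (- (w - z)); rewrite cabsN raddfN /=; lra.
- by have := Re_le_cabs (w - z); lra.
- by have := Im_le_cabs (- (w - z)); rewrite cabsN raddfN /=; lra.
- by have := Im_le_cabs (w - z); lra.
Qed.

Lemma ultra_fmap (T T' : Type) (F : set_system T) (f : T -> T') :
  UltraFilter F -> UltraFilter (f @ F).
Proof.
move=> FU; split; first exact: fmap_proper_filter.
move=> G GF FG; rewrite predeqE => A; split; last exact: FG.
move=> GA; have [//|FnA] := in_ultra_setVsetC (f @^-1` A) FU.
have GnA : G (~` A) by apply: FG.
by have /filter_ex[x []] : G (A `&` ~` A) by exact: filterI.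
Qed.

(** Compactness of the disc, in the form that replaces the extraction of convergent subsequences
    throughout. *)
Lemma bounded_ultra_cvg (T : Type) (F : set_system T) (f : T -> C) (M : R) :
  UltraFilter F -> F [set x | cabs (f x) <= M] ->
  exists2 l, f @ F --> l & cabs l <= M.
Proof.
move=> FU FM; have UF := ultra_fmap f FU.
have := @closed_disc_compact 0 M; rewrite compact_ultra => /(_ (f @ F) UF) [].
  by rewrite /nbhs /=; apply: filterS FM => x fx /=; rewrite subr0.
by move=> l [/= lM Fl]; exists l => //; rewrite subr0 in lM.
Qed.
End ComplexModulus.

(** * The mean value property *)

Section MeanValue.
Variable R : realType.
Local Notation C := R[i].
Implicit Types (a z w u : C) (s t r e : R).

Lemma real_derive_eps (f : R -> R) (x l : R) : is_derive x 1 f l -> forall e, 0 < e ->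
  exists2 d, 0 < d & forall y, `|y - x| < d ->
    `|f y - f x - l * (y - x)| <= e * `|y - x|.
Proof.
move=> [fx fl] e e0.
have /cvgrPdist_le /(_ e e0) : h^-1 *: (f (h *: (1 : R) + x) - f x) @[h --> 0^'] --> l.
  by rewrite -fl; exact: fx.
move=> /nbhs_ballP[d /= d0 H]; exists d => // y yx.
have [->|yx0] := eqVneq y x; first by rewrite !subrr mulr0 subr0 normr0 mulr0.
have h0 : y - x != 0 by rewrite subr_eq0.
have : ball (0 : R) d (y - x) by rewrite -ball_normE /ball_ /= sub0r normrN.
move=> /H /(_ h0) /=.
rewrite /GRing.scale /= mulr1 subrK distrC => {}H.
have -> : f y - f x - l * (y - x) = ((y - x)^-1 * (f y - f x) - l) * (y - x).
  by rewrite mulrBl mulrAC mulVf // mul1r.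
by rewrite normrM ler_wpM2r.
Qed.

(** The complex exponential of [s + i t]. *)
Definition cpolar (s t : R) : C := (expR s)%:C * (cos t +i* sin t).

Lemma cabs_cpolar s t : cabs (cpolar s t) = expR s.
Proof.
rewrite cabsM cabs_real (ger0_norm (expR_ge0 _)).
by rewrite /cabs /= cos2Dsin2 sqrtr1 mulr1.
Qed.

Lemma cpolarD s t s' t' : cpolar (s + s') (t + t') = cpolar s t * cpolar s' t'.
Proof.
rewrite /cpolar expRD cosD sinD rmorphM /=.
by rewrite [RHS]mulrACA; congr (_ * _); congr Complex; rewrite /=; ring.
Qed.

Lemma cpolar_near0 e : 0 < e -> exists2 d, 0 < d & forall s t, `|s| < d -> `|t| < d ->
  cabs (cpolar s t - 1 - (s +i* t)) <= e * (`|s| + `|t|).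
Proof.
move=> e0; pose e1 : R := Num.min (e / 10) 1.
have e10 : 0 < e1 by rewrite lt_min divr_gt0 // ltr01.
have e11 : e1 <= 1 by rewrite ge_min lexx orbT.
have e1e : 10 * e1 <= e by rewrite mulrC -ler_pdivlMr // ge_min lexx.
have [d1 d10 H1] := real_derive_eps (is_derive_expR 0) e10.
have [d2 d20 H2] := real_derive_eps (is_derive_cos 0) e10.
have [d3 d30 H3] := real_derive_eps (is_derive_sin 0) e10.
exists (Num.min (Num.min d1 d2) (Num.min d3 (e1 / 2))).
  by rewrite !lt_min d10 d20 d30 divr_gt0.
move=> s t; rewrite !lt_min => /andP[/andP[s1 _] /andP[_ s4]] /andP[/andP[_ t2] /andP[t3 _]].
have := H1 s; rewrite subr0 expR0 mul1r => /(_ s1) {}H1.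
have := H2 t; rewrite subr0 cos0 sin0 oppr0 mul0r subr0 => /(_ t2) {}H2.
have := H3 t; rewrite subr0 cos0 sin0 subr0 mul1r => /(_ t3) {}H3.
have s0 := normr_ge0 s; have t0 := normr_ge0 t.
have Es : `|expR s - 1| <= e1.
  have -> : expR s - 1 = (expR s - 1 - s) + s by ring.
  apply: le_trans (ler_normD _ _) _.
  have : e1 * `|s| <= 1 * `|s| by apply: ler_wpM2r.
  lra.
have E2 : `|expR s| <= 2.
  by rewrite (ger0_norm (expR_ge0 _)); move: Es; rewrite ler_norml => /andP[_]; lra.
have -> : cpolar s t - 1 - (s +i* t) =
  (expR s * (cos t - 1) + (expR s - 1 - s))%:C +
  'i%C * (expR s * (sin t - t) + (expR s - 1) * t)%:C.
  by apply/eqP; rewrite eq_complex /cpolar /=; apply/andP; split; apply/eqP; ring.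
apply: le_trans (cabsD _ _) _; rewrite cabsM !cabs_real.
rewrite cabs_i mul1r.
have A1 : `|expR s * (cos t - 1) + (expR s - 1 - s)| <= 2 * (e1 * `|t|) + e1 * `|s|.
  apply: le_trans (ler_normD _ _) _; apply: lerD => //.
  by rewrite normrM; apply: ler_pM.
have A2 : `|expR s * (sin t - t) + (expR s - 1) * t| <= 2 * (e1 * `|t|) + e1 * `|t|.
  apply: le_trans (ler_normD _ _) _; rewrite !normrM; apply: lerD.
    exact: ler_pM.
  exact: ler_wpM2r.
have : 10 * e1 * (`|s| + `|t|) <= e * (`|s| + `|t|).
  by apply: ler_wpM2r => //; apply: addr_ge0.
have := mulr_ge0 (ltW e10) s0; have := mulr_ge0 (ltW e10) t0.
by rewrite mulrDr -!mulrA; lra.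
Qed.

Lemma cpolar_diff s t e : 0 < e -> exists2 d, 0 < d & forall s' t',
  `|s' - s| < d -> `|t' - t| < d ->
  cabs (cpolar s' t' - cpolar s t - cpolar s t * ((s' - s) +i* (t' - t))) <=
    e * (`|s' - s| + `|t' - t|).
Proof.
move=> e0; have e'0 : 0 < e / expR s by rewrite divr_gt0 // expR_gt0.
have [d d0 H] := cpolar_near0 e'0; exists d => // s' t' sd td.
have -> : cpolar s' t' = cpolar s t * cpolar (s' - s) (t' - t).
  by rewrite -cpolarD; congr cpolar; ring.
rewrite -{2}[cpolar s t]mulr1 -!mulrBr cabsM cabs_cpolar.
have := H _ _ sd td; rewrite -(ler_pM2l (expR_gt0 s)) => /le_trans; apply.
by rewrite mulrA [expR s * _]mulrC divfK // gt_eqF // expR_gt0.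
Qed.

(** Chain rule for [f (a + exp (s + i t))]: the exponential is its own derivative, whence the factor
    [l * cpolar s t]. *)
Lemma has_cderiv_cpolar (f : C -> C) a s t l e :
  has_cderiv f (a + cpolar s t) l -> 0 < e ->
  exists2 d, 0 < d & forall s' t', `|s' - s| < d -> `|t' - t| < d ->
  cabs (f (a + cpolar s' t') - f (a + cpolar s t) -
     l * cpolar s t * ((s' - s) +i* (t' - t))) <= e * (`|s' - s| + `|t' - t|).
Proof.
move=> fl e0; set E := cpolar s t.
have E0 : 0 < 1 + cabs E by rewrite ltr_pwDl // cabs_ge0.
have l0 : 0 < 1 + cabs l by rewrite ltr_pwDl // cabs_ge0.
have e20 : 0 < e / (2 * (1 + cabs E)) by rewrite divr_gt0 // mulr_gt0.
have [d2 d20 H2] := fl _ e20.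
pose e1 := Num.min 1 (e / (2 * (1 + cabs l))).
have e10 : 0 < e1 by rewrite lt_min ltr01 divr_gt0 // mulr_gt0.
have [d1 d10 H1] := cpolar_diff s t e10.
pose d3 := d2 / (2 * (1 + cabs E)).
have d30 : 0 < d3 by rewrite divr_gt0 // mulr_gt0.
exists (Num.min d1 d3) => [|s' t']; first by rewrite lt_min d10.
rewrite !lt_min => /andP[sd1 sd3] /andP[td1 td3].
have {}H1 := H1 _ _ sd1 td1.
set N := `|s' - s| + `|t' - t| in H1 *.
have N0 : 0 <= N by rewrite addr_ge0.
have ND : cabs ((s' - s) +i* (t' - t)) <= N.
  exact: cabs_le_ReIm.
have WZ : cabs (cpolar s' t' - E) <= (1 + cabs E) * N.
  have -> : cpolar s' t' - E = (cpolar s' t' - E - E * ((s' - s) +i* (t' - t))) +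
     E * ((s' - s) +i* (t' - t)) by ring.
  apply: le_trans (cabsD _ _) _; rewrite mulrDl; apply: lerD.
    apply: le_trans H1 _; apply: ler_wpM2r => //.
    by rewrite ge_min lexx.
  by rewrite cabsM; apply: ler_wpM2l => //; exact: cabs_ge0.
have WZd : cabs ((a + cpolar s' t') - (a + E)) < d2.
  rewrite opprD addrACA subrr add0r; apply: le_lt_trans WZ _.
  rewrite mulrC -ltr_pdivlMr //.
  have -> : d2 / (1 + cabs E) = d3 + d3 by rewrite /d3; field; rewrite gt_eqF.
  exact: ltrD.
have {}H2 := H2 _ WZd.
have eqw : (a + cpolar s' t') - (a + E) = cpolar s' t' - E by ring.
rewrite eqw in H2.
have -> : f (a + cpolar s' t') - f (a + E) - l * E * ((s' - s) +i* (t' - t)) =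
  (f (a + cpolar s' t') - f (a + E) - l * (cpolar s' t' - E)) +
   l * (cpolar s' t' - E - E * ((s' - s) +i* (t' - t))) by ring.
apply: le_trans (cabsD _ _) _; rewrite cabsM.
have B1 : e / (2 * (1 + cabs E)) * cabs (cpolar s' t' - E) <= e / 2 * N.
  apply: le_trans (ler_wpM2l (ltW e20) WZ) _.
  rewrite le_eqVlt; apply/orP; left; apply/eqP.
  by field; rewrite gt_eqF.
have B2 : cabs l * cabs (cpolar s' t' - E - E * ((s' - s) +i* (t' - t))) <= e / 2 * N.
  apply: le_trans (ler_wpM2l (cabs_ge0 _) H1) _; rewrite mulrA; apply: ler_wpM2r => //.
  have : cabs l * e1 <= (1 + cabs l) * (e / (2 * (1 + cabs l))).
    apply: ler_pM; rewrite ?cabs_ge0 ?(ltW e10) ?lerDr //.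
    by rewrite ge_min lexx orbT.
  move/le_trans; apply; rewrite le_eqVlt; apply/orP; left; apply/eqP.
  by field; rewrite gt_eqF.
by have := lerD (le_trans H2 B1) B2; rewrite -mulrDl -splitr.
Qed.

(** Continuity spreads the strict inequality at [c] over an interval starting at [c], on which [f]
    is at most [(k + f c) / 2]. *)
Lemma primitive_lt (F f : R -> R) (a b c k : R) : a < c -> c < b ->
  (forall x, a <= x <= b -> is_derive x 1 F (f x)) -> continuous f ->
  (forall x, f x <= k) -> f c < k -> F b - F a < k * (b - a).
Proof.
move=> ac cb dF cf fk fck.
have e0 : 0 < (k - f c) / 2 by rewrite divr_gt0 // subr_gt0.
have [d d0 H] := (continuous_realP f c).1 (cf c) _ e0.
pose b' := Num.min b (c + d / 2).
have cb' : c < b' by rewrite lt_min cb ltrDl divr_gt0.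
have b'b : b' <= b by rewrite ge_min lexx.
have b'd : b' <= c + d / 2 by rewrite ge_min lexx orbT.
have I1 : F c - F a <= k * (c - a).
  by apply: (@primitive_le _ _ f) => [|x xb|//]; [exact: ltW|apply: dF; lra].
have I3 : F b - F b' <= k * (b - b').
  by apply: (@primitive_le _ _ f) => [//|x xb|//]; apply: dF; lra.
have I2 : F b' - F c <= ((k + f c) / 2) * (b' - c).
  apply: (@primitive_le _ _ f) => [|x xb|x /andP[cx xb']]; [exact: ltW|apply: dF; lra|].
  have : `|x - c| < d by rewrite ltr_norml; apply/andP; split; lra.
  move=> /H; rewrite ltr_norml => /andP[]; lra.
have : (k + f c) / 2 * (b' - c) < k * (b' - c).
  by rewrite ltr_pM2r ?subr_gt0 //; lra.
lra.
Qed.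

(* [f (a + exp (s + i t))] is holomorphic in the half-plane [s < ln rho], so its
   differential form is closed by Goursat's theorem and, by periodicity in [t],
   the mean of [f] on the circle of radius [expR s] does not depend on [s].
   The point [a], where [f] is only continuous, corresponds to [s = -oo]. *)
Lemma mean_value_max (f : C -> C) a (rho r : R) :
  {for a, continuous f} ->
  (forall z, 0 < cabs (z - a) < rho -> differentiable f z) ->
  (forall z, cabs (z - a) < rho -> cabs (f z) <= cabs (f a)) ->
  0 < r < rho -> cabs (f (a + r%:C)) = cabs (f a).
Proof.
move=> fa df fmax /andP[r0 rrho]; set m := cabs (f a).
have ar : cabs (a + r%:C - a) < rho.
  by rewrite addrAC subrr add0r cabs_real gtr0_norm.
apply/eqP; rewrite eq_le fmax //= leNgt; apply/negP => fr.
have m0 : 0 < m by apply: le_lt_trans fr; exact: cabs_ge0.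
(* A rotation making [u * f a] equal to the positive real [m]; the real part of [u * f] is at most
   [m], and its means on circles are compared with [m]. *)
pose u := m%:C / f a.
have fa0 : f a != 0 by rewrite -cabs_gt0.
have u1 : cabs u = 1 by rewrite cabsM cabsV cabs_real gtr0_norm // divff // gt_eqF.
have ufa : u * f a = m%:C by rewrite divfK.
pose s2 := ln r.
have Es2 : expR s2 = r by rewrite /s2 lnK.
pose h s t := u * f (a + cpolar s t).
have pin s t : s <= s2 -> 0 < cabs (a + cpolar s t - a) < rho.
  move=> ss; rewrite addrAC subrr add0r cabs_cpolar expR_gt0 /=.
  by apply: le_lt_trans rrho; rewrite -Es2 ler_expR.
have hdiff s t : s <= s2 -> exists D : C, forall e, 0 < e ->
    exists2 d, 0 < d & forall s' t', `|s' - s| < d -> `|t' - t| < d ->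
    cabs (h s' t' - h s t - D * ((s' - s) +i* (t' - t))) <= e * (`|s' - s| + `|t' - t|).
  move=> ss; have /df /differentiable_cderivP[l fl] := pin s t ss.
  exists (u * (l * cpolar s t)) => e /(has_cderiv_cpolar fl)[d d0 H].
  exists d => // s' t' sd td; have := H s' t' sd td.
  set W := (X in cabs X <= _); rewrite -[cabs W]mul1r -u1 -cabsM.
  by congr (cabs _ <= _); rewrite /W /h; ring.
have hcont s t e : s <= s2 -> 0 < e -> exists2 d, 0 < d & forall s' t',
    `|s' - s| < d -> `|t' - t| < d -> cabs (h s' t' - h s t) < e.
  move=> ss e0; have [D /(_ 1 ltr01)[d d0 H]] := hdiff s t ss.
  have D0 : 0 < 1 + cabs D by rewrite ltr_pwDl // cabs_ge0.
  exists (Num.min d (e / (2 * (1 + cabs D)))) => [|s' t'].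
    by rewrite lt_min d0 divr_gt0 // mulr_gt0.
  rewrite !lt_min => /andP[sd sD] /andP[td tD].
  have := H _ _ sd td; set N := `|s' - s| + `|t' - t|; rewrite mul1r => HN.
  have ND : cabs ((s' - s) +i* (t' - t)) <= N by exact: cabs_le_ReIm.
  have -> : h s' t' - h s t = (h s' t' - h s t - D * ((s' - s) +i* (t' - t)))
    + D * ((s' - s) +i* (t' - t)) by ring.
  apply: le_lt_trans (cabsD _ _) _; rewrite cabsM.
  apply: (@le_lt_trans _ _ ((1 + cabs D) * N)).
    by rewrite mulrDl mul1r; apply: lerD => //; apply: ler_wpM2l => //; exact: cabs_ge0.
  have -> : e = (1 + cabs D) * (e / (2 * (1 + cabs D)) + e / (2 * (1 + cabs D))).
    by field; rewrite gt_eqF.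
  by rewrite ltr_pM2l //; exact: ltrD.
(* Truncation at [s2] makes [p s] and [q ^~ t] continuous on the whole line, as the primitives
   require, although [f] is controlled only at radii below [rho]. *)
pose cl s := Num.min s s2.
have cl2 s : cl s <= s2 by rewrite ge_min lexx orbT.
have clE s : s <= s2 -> cl s = s by move=> ss; apply/min_idPl.
have cl_lip s s' : `|cl s' - cl s| <= `|s' - s|.
  rewrite /cl; case: (leP s s2) => ss; case: (leP s' s2) => ss' //.
  - by rewrite !ger0_norm; lra.
  - by rewrite !ler0_norm; lra.
  - by rewrite subrr normr0.
pose p s t := complex.Re (h (cl s) t); pose q s t := complex.Im (h (cl s) t).
have cp s : continuous (p s).
  move=> t; apply/continuous_realP => e e0.
  have [d d0 H] := hcont (cl s) t e (cl2 s) e0.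
  exists d => // t' tt; apply: le_lt_trans (H (cl s) t' _ tt); last by rewrite subrr normr0.
  rewrite /p -raddfB /= ler_norml; apply/andP; split; last exact: Re_le_cabs.
  by rewrite lerNl -raddfN -cabsN /=; exact: Re_le_cabs.
have cq t : continuous (q ^~ t).
  move=> s; apply/continuous_realP => e e0.
  have [d d0 H] := hcont (cl s) t e (cl2 s) e0.
  exists d => // s' ss; apply: le_lt_trans (H (cl s') t (le_lt_trans (cl_lip _ _) ss) _); last first.
    by rewrite subrr normr0.
  rewrite /q -raddfB /= ler_norml; apply/andP; split; last exact: Im_le_cabs.
  by rewrite lerNl -raddfN -cabsN /=; exact: Im_le_cabs.
(* The base point is one unit to the left of [- pi] because [is_derive_primitive] asks for [a < x];
   only differences of values of [Y s] are used. *)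
pose Y s := primitive (- pi - 1) (p s).
have dY s t : - pi <= t -> is_derive t 1 (Y s) (p s t).
  by move=> pt; apply: is_derive_primitive => //; lra.
clearbody Y; have pi0 := @pi_gt0 R.
have const s1 : s1 < s2 -> Y s2 pi - Y s2 (- pi) = Y s1 pi - Y s1 (- pi).
  move=> s12; pose X t := primitive (s1 - 1) (q ^~ t).
  have dX s t : s1 <= s -> is_derive s 1 (X t) (q s t).
    by move=> ss; apply: (@is_derive_primitive _ (q ^~ t)) => //; lra.
  have Xpi : X (- pi) = X pi.
    congr primitive; apply/funext => s.
    by rewrite /q /h /cpolar cosN sinN sinpi oppr0.
  clearbody X.
  have al0 : 0 < s2 - s1 by rewrite subr_gt0.
  have be0 : 0 < 2 * pi :> R by rewrite mulr_gt0.
  pose rect s t := (s1 <= s <= s1 + (s2 - s1)) && (- pi <= t <= - pi + 2 * pi).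
  have dYr s t : rect s t -> is_derive t 1 (Y s) (p s t).
    by move=> /andP[_ /andP[pt _]]; exact: dY.
  have dXr s t : rect s t -> is_derive s 1 (X t) (q s t).
    by move=> /andP[/andP[st _] _]; exact: dX.
  have dpq s t : rect s t -> exists k l n : R,
      forall e, 0 < e -> exists2 d : R, 0 < d & forall s' t', rect s' t' ->
      `|s' - s| < d -> `|t' - t| < d ->
      `|p s' t' - p s t - k * (s' - s) - l * (t' - t)| <= e * (`|s' - s| + `|t' - t|) /\
      `|q s' t' - q s t - n * (s' - s) - k * (t' - t)| <= e * (`|s' - s| + `|t' - t|).
    move=> /andP[/andP[_ ss2] _]; rewrite (_ : s1 + (s2 - s1) = s2) in ss2; last by ring.
    have [D HD] := hdiff (cl s) t (cl2 s).
    exists (complex.Re D), (- complex.Im D), (complex.Im D) => e /HD[d d0 {}HD].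
    exists d => // s' t' /andP[/andP[_ s's2] _] sd td; rewrite (_ : s1 + (s2 - s1) = s2) in s's2; last by ring.
    have := HD s' t'; rewrite !(clE s ss2) => /(_ sd td) {}HD.
    set W := (X in cabs X) in HD.
    have E1 : p s' t' - p s t - complex.Re D * (s' - s) - - complex.Im D * (t' - t) = complex.Re W.
      rewrite /p !clE // /W; case: (h s' t') (h s t) D {HD W} => [x1 y1] [x2 y2] [x3 y3] /=; ring.
    have E2 : q s' t' - q s t - complex.Im D * (s' - s) - complex.Re D * (t' - t) = complex.Im W.
      rewrite /q !clE // /W; case: (h s' t') (h s t) D {HD W E1} => [x1 y1] [x2 y2] [x3 y3] /=; ring.
    rewrite E1 E2; split; apply: le_trans HD; rewrite ler_norml lerNl; apply/andP; split.
    - by rewrite -raddfN -cabsN; exact: Re_le_cabs.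
    - exact: Re_le_cabs.
    - by rewrite -raddfN -cabsN; exact: Im_le_cabs.
    - exact: Im_le_cabs.
  have := goursat_rectangle al0 be0 dYr dXr dpq.
  have -> : s1 + (s2 - s1) = s2 by ring.
  have -> : - pi + 2 * pi = pi :> R by ring.
  by rewrite Xpi subrr => /eqP; rewrite subr_eq0 => /eqP.
have ps2 t : p s2 t <= m.
  rewrite /p; apply: le_trans (Re_le_cabs _) _; rewrite cabsM u1 mul1r clE //.
  by apply: fmax; have /andP[] := pin s2 t (lexx _).
have ps0 : p s2 0 < m.
  rewrite /p clE //; apply: le_lt_trans (Re_le_cabs _) _; rewrite cabsM u1 mul1r.
  suff -> : cpolar s2 0 = r%:C by [].
  by rewrite /cpolar Es2 cos0 sin0 mulr1.
have lt2 : Y s2 pi - Y s2 (- pi) < m * (pi - (- pi)).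
  apply: (@primitive_lt _ (p s2) _ _ 0) => //; rewrite ?oppr_lt0 //.
  by move=> x /andP[px _]; exact: dY.
(* On the circle of radius [r] the integral falls short of its maximal value by [gap]. On a circle
   of radius less than [d] it falls short by at most [e * (2 * pi) = gap / 2]. By [const] the two
   integrals are equal. *)
set gap := m * (pi - (- pi)) - (Y s2 pi - Y s2 (- pi)).
have gap0 : 0 < gap by rewrite subr_gt0.
pose e := gap / (4 * pi).
have e0 : 0 < e by rewrite divr_gt0 // mulr_gt0.
have [d d0 Hd] := (continuous_cabsP f a).1 fa e e0.
pose s1 := Num.min (s2 - 1) (ln (d / 2)).
have s12 : s1 < s2 by rewrite gt_min; apply/orP; left; lra.
have Es1 : expR s1 < d.
  apply: (@le_lt_trans _ _ (expR (ln (d / 2)))).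
    by rewrite ler_expR ge_min lexx orbT.
  by rewrite lnK ?posrE ?divr_gt0 //; lra.
have : `|Y s1 pi - Y s1 (- pi) - m * (pi - (- pi))| <= e * (pi - (- pi)).
  apply: (@primitive_bound _ _ (p s1)); first by lra.
    by move=> x /andP[px _]; exact: dY.
  move=> t _; rewrite /p clE; last exact: ltW.
  have -> : complex.Re (h s1 t) - m = complex.Re (u * (f (a + cpolar s1 t) - f a)).
    by rewrite mulrBr ufa raddfB.
  have H : cabs (u * (f (a + cpolar s1 t) - f a)) <= e.
    by rewrite cabsM u1 mul1r ltW // Hd // addrAC subrr add0r cabs_cpolar.
  apply: le_trans H; rewrite ler_norml lerNl; apply/andP; split; last exact: Re_le_cabs.
  by rewrite -raddfN -cabsN; exact: Re_le_cabs.
rewrite -const // ler_norml => /andP[+ _].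
have -> : e * (pi - (- pi)) = gap / 2 by rewrite /e; move: (pi) pi0 => x x0; field; rewrite gt_eqF.
rewrite /gap; lra.
Qed.

End MeanValue.

(** * The maximum principle *)

Section MaximumPrinciple.
Variable R : realType.
Local Notation C := R[i].
Implicit Types (a z w : C) (r e M : R) (f g : C -> C).

(* Differentiability may fail at [z] itself: the difference quotients below are
   of this kind. *)
Definition good f z := {for z, continuous f} /\
  exists2 d : R, 0 < d & forall w, 0 < cabs (w - z) < d -> differentiable f w.

Lemma compact_max (K : set C) (g : C -> R) : K !=set0 -> compact K ->
  (forall z, K z -> {for z, continuous g}) ->
  exists2 z, K z & forall w, K w -> g w <= g z.
Proof.
move=> K0 cK cg; have [||z Kz zmax] := @compact_EVT_max _ R g K K0.
- exact: cK.
- by apply: continuous_in_subspaceT => z /set_mem; exact: cg.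
- by exists z; [exact: set_mem|move=> w Kw; apply: zmax; exact: mem_set].
Qed.

Lemma continuous_Re z : {for z, continuous (@complex.Re R)}.
Proof.
move=> A /nbhs_realP[d d0 H]; apply/nbhs_cabsP; exists d => // w wz; apply: H.
apply: le_lt_trans wz; rewrite -raddfB /= ler_norml; apply/andP; split.
  by rewrite lerNl -raddfN -cabsN /=; exact: Re_le_cabs.
exact: Re_le_cabs.
Qed.

Lemma continuous_cabs f z : {for z, continuous f} ->
  {for z, continuous (fun w => cabs (f w))}.
Proof.
move=> /continuous_cabsP H A /nbhs_realP[d d0 HA].
have [d' d'0 H'] := H d d0; apply/nbhs_cabsP; exists d' => // w /H' wz; apply: HA.
apply: le_lt_trans wz; rewrite ler_norml cabs_distl andbT lerNl opprB.
by rewrite [cabs (f w - _)]cabsC cabs_distl.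
Qed.

Lemma compact_superlevel (K : set C) (g : C -> R) m : compact K ->
  (forall z, K z -> {for z, continuous g}) -> compact [set z | K z /\ m <= g z].
Proof.
rewrite compact_ultra => cK cg F FU FS.
have FK : F K by apply: filterS FS => z [].
have [z [Kz Fz]] := cK F FU FK; exists z; split => //=; split=> //.
rewrite leNgt; apply/negP => gm.
have : F [set w | g w < m].
  apply: Fz; apply: (cg z Kz [set y | y < m]); apply/nbhs_realP; exists (m - g z); first by rewrite subr_gt0.
  by move=> y; rewrite ltr_norml => /andP[_]; rewrite ltrD2r.
by move=> /(filterI FS) /filter_ex[w [[_ mw]]]; rewrite /= ltNge mw.
Qed.

(* The rightmost point of [S] is the centre of circles contained in [S]. *)
Lemma no_compact_max_set (S : set C) f m : compact S -> S !=set0 ->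
  (forall z, S z -> cabs (f z) = m /\ exists2 rho, 0 < rho &
     [/\ {for z, continuous f},
         forall w, 0 < cabs (w - z) < rho -> differentiable f w,
         forall w, cabs (w - z) < rho -> cabs (f w) <= m &
         forall w, cabs (w - z) < rho -> cabs (f w) = m -> S w]) -> False.
Proof.
move=> cS S0 H.
have [z Sz zmax] := @compact_max S (@complex.Re R) S0 cS (fun z _ => @continuous_Re z).
have [fz [rho rho0 [cf df fm fS]]] := H z Sz.
have r0 : 0 < rho / 2 < rho by apply/andP; split; lra.
have := mean_value_max cf df _ r0; rewrite fz => /(_ fm) fm'.
have zr : cabs (z + (rho / 2)%:C - z) < rho.
  by rewrite addrAC subrr add0r cabs_real gtr0_norm; lra.
have := zmax _ (fS _ zr fm'); rewrite raddfD /=; lra.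
Qed.

(** If the bound failed, the points of the disc where the modulus is maximal would form a compact
    set avoiding the circle, which [no_compact_max_set] excludes. *)
Lemma max_disc f a (r rho M : R) : r < rho ->
  (forall z, cabs (z - a) < rho -> good f z) ->
  (forall z, cabs (z - a) = r -> cabs (f z) <= M) ->
  forall z, cabs (z - a) <= r -> cabs (f z) <= M.
Proof.
move=> rrho fgood fM z0 z0r; rewrite leNgt; apply/negP => Mf.
pose K := [set z | cabs (z - a) <= r].
have cK : compact K by exact: closed_disc_compact.
have cf z : K z -> {for z, continuous (fun w => cabs (f w))}.
  move=> Kz; apply: continuous_cabs; have [] // := fgood z.
  exact: le_lt_trans rrho.
have [|z1 Kz1 z1max] := @compact_max K _ _ cK cf; first by exists z0.
pose m := cabs (f z1); have Mm : M < m by apply: lt_le_trans (z1max z0 z0r).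
pose S := [set z | K z /\ m <= cabs (f z)].
apply: (@no_compact_max_set S f m); first exact: compact_superlevel.
  by exists z1; split; rewrite //= /m lexx.
move=> z [Kz mz]; split; first by apply/eqP; rewrite eq_le z1max.
have zr : cabs (z - a) < r.
  rewrite lt_neqAle Kz andbT; apply/eqP => /fM; rewrite leNgt => /negP; apply.
  exact: lt_le_trans mz.
have [cfz [d d0 Hd]] := fgood z (lt_trans zr rrho).
have inK w : cabs (w - z) < r - cabs (z - a) -> K w.
  by move=> wz; rewrite /K /=; have := cabs_dist3 w a z; lra.
exists (Num.min d (r - cabs (z - a))); first by rewrite lt_min d0 subr_gt0.
split.
- exact: cfz.
- by move=> w; rewrite lt_min => /and3P[w0 wd _]; apply: Hd; rewrite w0.
- by move=> w; rewrite lt_min => /andP[_ /inK]; exact: z1max.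
- by move=> w; rewrite lt_min => /andP[_ /inK Kw] fw; split; rewrite //= fw.
Qed.

(* An ultrafilter on [U] without limit in [U] stands for a way of approaching the
   boundary of [U]. *)
Lemma boundary_vanish (U : set C) f : open U ->
  (forall z, U z -> differentiable f z) ->
  (forall F : set_system C, UltraFilter F -> F U ->
     (forall p, U p -> ~ (F --> p)) -> f @ F --> (0 : C)) ->
  forall z, U z -> f z = 0.
Proof.
move=> oU df H z0 Uz0; apply/eqP; rewrite -cabs_eq0; apply/negP => /negP f0.
pose e := cabs (f z0); have e0 : 0 < e by rewrite lt_def f0 cabs_ge0.
have cf z : U z -> {for z, continuous (fun w => cabs (f w))}.
  by move=> Uz; apply: continuous_cabs; apply: cderiv_continuous; exact: df.
pose S0 := [set z | U z /\ e <= cabs (f z)].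
have [cS0|ncS0] := pselect (compact S0); last first.
  (* Some ultrafilter on [S0] has no limit in [S0]. It has none in [U] either, since the inequality
     defining [S0] passes to limits in [U]. *)
  move: ncS0; rewrite compact_ultra => /existsNP[F /not_implyP[FU /not_implyP[FS nF]]].
  have FUU : F U by apply: filterS FS => z [].
  have esc p : U p -> ~ (F --> p).
    move=> Up Fp; apply: nF; exists p; split => //; split => //.
    rewrite leNgt; apply/negP => fpe.
    have : F [set w | cabs (f w) < e].
      apply: Fp; apply: (cf p Up [set y | y < e]); apply/nbhs_realP.
      exists (e - cabs (f p)); first by rewrite subr_gt0.
      by move=> y; rewrite ltr_norml => /andP[_]; rewrite ltrD2r.
    by move=> /(filterI FS) /filter_ex[w [[_ mw]]]; rewrite /= ltNge mw.
  have /cvg_cabsP /(_ e e0) := H F FU FUU esc.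
  by move=> /(filterI FS) /filter_ex[w [[_ mw]]]; rewrite /= subr0 ltNge mw.
have [|||z1 [Uz1 ez1] z1max] := @compact_max S0 (fun w => cabs (f w)).
- by exists z0; split; rewrite /= ?lexx.
- exact: cS0.
- by move=> z [/cf].
pose m := cabs (f z1); pose S := [set z | S0 z /\ m <= cabs (f z)].
apply: (@no_compact_max_set S f m).
- by apply: compact_superlevel => // z [/cf].
- by exists z1; split; rewrite //= /m lexx.
move=> z [[Uz ez] mz]; split; first by apply/eqP; rewrite eq_le mz z1max.
have /nbhs_cabsP[d d0 dU] : nbhs z U by apply: open_nbhs_nbhs; split.
exists d => //; split.
- by apply: cderiv_continuous; exact: df.
- by move=> w /andP[_ /dU]; exact: df.
- move=> w /dU Uw; have [ew|we] := leP e (cabs (f w)); first by apply: z1max; split.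
  by apply: ltW; apply: lt_le_trans we _.
- move=> w /dU Uw fw; have mw : m <= cabs (f w) by rewrite fw.
  by split; [split; [|exact: le_trans ez1 mw]|].
Qed.

Definition slope f a (l : C) z : C := if z == a then l else (f z - f a) / (z - a).

Lemma differentiable_near f g z : (exists2 d : R, 0 < d & forall w, cabs (w - z) < d -> f w = g w) ->
  differentiable f z -> differentiable g z.
Proof.
move=> [d d0 fg] /differentiable_cderivP[l H]; apply/differentiable_cderivP; exists l.
move=> e /H[d' d'0 H']; exists (Num.min d d') => [|w]; first by rewrite lt_min d0.
by rewrite lt_min => /andP[wd wd']; rewrite -!fg ?subrr ?cabs0 //; exact: H'.
Qed.

Lemma continuous_near f g z : (exists2 d : R, 0 < d & forall w, cabs (w - z) < d -> f w = g w) ->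
  {for z, continuous f} -> {for z, continuous g}.
Proof.
move=> [d d0 fg] /continuous_cabsP H; apply/continuous_cabsP.
move=> e /H[d' d'0 H']; exists (Num.min d d') => [|w]; first by rewrite lt_min d0.
by rewrite lt_min => /andP[wd wd']; rewrite -!fg ?subrr ?cabs0 //; exact: H'.
Qed.

Lemma slope_near f a l z : z != a ->
  exists2 d : R, 0 < d & forall w, cabs (w - z) < d ->
    ((f w - f a) * (w - a)^-1) = slope f a l w.
Proof.
move=> za; exists (cabs (z - a)) => [|w wz]; first by rewrite cabs_gt0 subr_eq0.
rewrite /slope; case: eqVneq => // wa; move: wz; rewrite wa cabsC ltxx //.
Qed.

Lemma differentiable_slope f a l z : z != a -> differentiable f z ->
  differentiable (slope f a l) z.
Proof.
move=> za df; apply: differentiable_near (slope_near f l za) _.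
apply: (@differentiableM C C (fun w => f w - f a) (fun w => (w - a)^-1)).
  exact: (@differentiableB C C C f (cst (f a)) z).
apply: (@differentiableV C C (fun w => w - a)); last by rewrite subr_eq0.
exact: (@differentiableB C C C id (cst a) z).
Qed.

Lemma continuous_slope f a l z : z != a -> {for z, continuous f} ->
  {for z, continuous (slope f a l)}.
Proof.
move=> za cf; apply: continuous_near (slope_near f l za) _.
apply: (@cvgM C C (nbhs z) _ (fun w => f w - f a) (fun w => (w - a)^-1)).
  by apply: (@cvgB C C C (nbhs z) _ f (cst (f a))); [exact: cf|exact: cvg_cst].
apply: (@cvgV C C (nbhs z) _ (fun w => w - a)); first by rewrite subr_eq0.
by apply: (@cvgB C C C (nbhs z) _ id (cst a)); [exact: cvg_id|exact: cvg_cst].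
Qed.

Lemma continuous_slope_center f a l : has_cderiv f a l ->
  {for a, continuous (slope f a l)}.
Proof.
move=> fl; apply/continuous_cabsP => e e0; have e2 : 0 < e / 2 by rewrite divr_gt0.
have [d d0 H] := fl _ e2; exists d => // w /H; rewrite /slope eqxx.
case: eqVneq => [->|wa Hw]; first by rewrite !subrr cabs0.
have wa0 : 0 < cabs (w - a) by rewrite cabs_gt0 subr_eq0.
rewrite -(ltr_pM2r wa0) -cabsM mulrBl divfK ?subr_eq0 //.
by apply: le_lt_trans Hw _; rewrite ltr_pM2r //; lra.
Qed.

Lemma good_differentiable f z d : 0 < d ->
  (forall w, cabs (w - z) < d -> differentiable f w) -> good f z.
Proof.
move=> d0 H; split; first by apply: cderiv_continuous; apply: H; rewrite subrr cabs0.
by exists d => // w /andP[_ /H].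
Qed.

(** This stability is what allows the maximum principle to be applied to iterated difference
    quotients: at the base point only continuity is asked, and the derivative of [f] provides it. *)
Lemma good_slope f a l z : (z = a -> has_cderiv f a l) -> good f z ->
  good (slope f a l) z.
Proof.
move=> fl [cf [d d0 df]]; have [za|za] := eqVneq z a.
  split; first by rewrite za; apply: continuous_slope_center; exact: fl.
  exists d; [exact: d0|move=> w wz].
  apply: differentiable_slope; last exact: df.
  by apply: contraTneq wz => ->; rewrite za subrr cabs0 ltxx.
split; first exact: continuous_slope.
have za0 : 0 < cabs (z - a) by rewrite cabs_gt0 subr_eq0.
exists (Num.min d (cabs (z - a))) => [|w]; first by rewrite lt_min d0.
rewrite lt_min => /and3P[w0 wd wa]; apply: differentiable_slope.
  by apply: contraTneq wa => ->; rewrite cabsC ltxx.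
by apply: df; rewrite w0.
Qed.

End MaximumPrinciple.

(** * Local properties of holomorphic functions *)

Section LocalTheory.
Variable R : realType.
Local Notation C := R[i].
Implicit Types (a z w v : C) (r rho e M : R) (f g : C -> C).

Lemma cvg_cabs_lt (T : Type) (F : set_system T) (f : T -> C) (l : C) :
  f @ F --> l -> forall e : R, 0 < e -> F [set x | cabs (f x - l) < e].
Proof.
move=> fl e e0; apply: (fl [set y | cabs (y - l) < e]).
by apply/nbhs_cabsP; exists e.
Qed.

Section Bounds.
Variables (f : C -> C) (a : C) (r rho M : R).
Hypotheses (r0 : 0 < r) (rrho : r < rho).
Hypothesis df : forall z, cabs (z - a) < rho -> differentiable f z.
Hypothesis fM : forall z, cabs (z - a) < rho -> cabs (f z) <= M.

Let rho0 : 0 < rho. Proof. exact: lt_trans rrho. Qed.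

Let ca : cabs (a - a) < rho. Proof. by rewrite subrr cabs0. Qed.

Let fgood z : cabs (z - a) < rho -> good f z.
Proof.
move=> zr; apply: (@good_differentiable _ _ _ (rho - cabs (z - a))).
  by rewrite subr_gt0.
by move=> w wz; apply: df; have := cabs_dist3 w a z; lra.
Qed.

Let slope_circle l z : cabs (z - a) = r -> cabs (slope f a l z) <= 2 * M / r.
Proof.
move=> zr; rewrite /slope; case: eqVneq => [za|za].
  by move: zr; rewrite za subrr cabs0 => r0'; move: r0; rewrite -r0' ltxx.
rewrite cabsM cabsV zr ler_pM2r ?invr_gt0 //.
apply: le_trans (cabsB _ _) _; have := fM ca.
by have := @fM z; rewrite zr => /(_ rrho); lra.
Qed.

(** Maximum principle for the difference quotient: on the circle its numerator is at most [2 * M]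
    and its denominator has modulus [r]. *)
Lemma slope_bound l : has_cderiv f a l ->
  forall z, cabs (z - a) <= r -> cabs (slope f a l z) <= 2 * M / r.
Proof.
move=> fl; apply: (@max_disc _ _ a r rho) rrho _ _.
  by move=> z zr; apply: good_slope; [move=> _; exact: fl|exact: fgood].
by move=> z /slope_circle.
Qed.

Lemma cauchy_lipschitz z : cabs (z - a) <= r -> cabs (f z - f a) <= 2 * M / r * cabs (z - a).
Proof.
move=> zr; have /differentiable_cderivP[l fl] := df ca.
have := slope_bound fl zr; rewrite /slope; case: eqVneq => [-> _|za].
  by rewrite !subrr cabs0 mulr0.
by rewrite cabsM cabsV ler_pdivrMr // cabs_gt0 subr_eq0.
Qed.

(* The error term is the value at [a] of the difference quotient based at [z] of
   the difference quotient of [f] based at [a]; it is bounded on the circle. *)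
Lemma cauchy_taylor l : has_cderiv f a l -> forall z, cabs (z - a) <= r / 2 ->
  cabs (f z - f a - l * (z - a)) <= 8 * M / r ^+ 2 * cabs (z - a) ^+ 2.
Proof.
move=> fl z zr; have [->|za] := eqVneq z a.
  by rewrite !subrr mulr0 subr0 cabs0 expr0n /= mulr0.
have zr' : cabs (z - a) <= r.
  have h : r / 2 <= r by have := r0; lra.
  exact: le_trans zr h.
pose g := slope f a l.
have ggood w : cabs (w - a) < rho -> good g w.
  by move=> wr; apply: good_slope; [move=> _; exact: fl|exact: fgood].
have gz : cabs (g z) <= 2 * M / r by apply: slope_bound.
have /differentiable_cderivP[l' gl'] : differentiable g z.
  by apply: differentiable_slope => //; apply: df; apply: le_lt_trans rrho.
have r20 : 0 < r / 2 by rewrite divr_gt0.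
have M0 : 0 <= 4 * M / r.
  have M0 : 0 <= M by apply: le_trans (fM ca); exact: cabs_ge0.
  by rewrite mulr_ge0 // ?invr_ge0 ?(ltW r0) // mulr_ge0.
have kc w : cabs (w - a) = r -> cabs (slope g z l' w) <= 8 * M / r ^+ 2.
  move=> wr; have wz : r / 2 <= cabs (w - z) by have := cabs_dist3 w a z; lra.
  rewrite /slope; case: eqVneq => [wzE|_].
    by move: wz; rewrite wzE subrr cabs0; lra.
  rewrite cabsM cabsV ler_pdivrMr; last exact: lt_le_trans wz.
  have gw := slope_circle l wr; rewrite -/g in gw.
  apply: (@le_trans _ _ (4 * M / r)).
    apply: le_trans (cabsB _ _) _.
    have -> : 4 * M / r = 2 * M / r + 2 * M / r by field; rewrite gt_eqF.
    exact: lerD.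
  have -> : 4 * M / r = 8 * M / r ^+ 2 * (r / 2) by field; rewrite gt_eqF.
  apply: ler_wpM2l => //.
  have -> : 8 * M / r ^+ 2 = (4 * M / r) * (2 / r) by field; rewrite gt_eqF.
  by rewrite mulr_ge0 // divr_ge0 // ltW.
have kgood w : cabs (w - a) < rho -> good (slope g z l') w.
  by move=> wr; apply: good_slope; [move=> _; exact: gl'|exact: ggood].
have := max_disc rrho kgood kc (z := a); rewrite subrr cabs0 => /(_ (ltW r0)).
rewrite /slope eq_sym (negPf za) cabsM cabsV [cabs (a - z)]cabsC.
have za0 : 0 < cabs (z - a) by rewrite cabs_gt0 subr_eq0.
rewrite ler_pdivrMr // /g /slope eqxx (negPf za).
rewrite -(ler_pM2r za0) -cabsM mulrBl divfK ?subr_eq0 //.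
by rewrite [cabs (_ - (f z - f a))]cabsC (expr2 (cabs (z - a))) mulrA.
Qed.

End Bounds.

(** The derivatives [l x] at [a] are bounded by [2 * M / r], so they converge along [F] to some [L].
    The Taylor bound has a constant independent of [x]; in the limit it says that [g] has derivative
    [L] at [a]. *)
Lemma ultralimit_differentiable (T : Type) (F : set_system T) (A : set T)
    (f : T -> C -> C) g a rho M : UltraFilter F -> F A -> 0 < rho ->
  (forall x z, A x -> cabs (z - a) < rho -> differentiable (f x) z /\ cabs (f x z) <= M) ->
  (forall z, cabs (z - a) < rho -> f x z @[x --> F] --> g z) ->
  differentiable g a.
Proof.
move=> FU FA rho0 fA fg; pose r := rho / 2.
have FF : Filter F by exact: filter_filter.
have r0 : 0 < r by rewrite divr_gt0.
have rrho : r < rho by rewrite /r; lra.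
have ca : cabs (a - a) < rho by rewrite subrr cabs0.
have [|l Hl] := @boolp.choice T C (fun x lx => A x -> has_cderiv (f x) a lx).
  move=> x; have [Ax|nAx] := pselect (A x); last by exists 0.
  by have /differentiable_cderivP[lx] := (fA x a Ax ca).1; exists lx.
have [x0 Ax0] := filter_ex FA.
have lM x : A x -> cabs (l x) <= 2 * M / r.
  move=> Ax; have := slope_bound r0 rrho (fun z zr => (fA x z Ax zr).1)
    (fun z zr => (fA x z Ax zr).2) (Hl x Ax) (z := a).
  by rewrite subrr cabs0 /slope eqxx => /(_ (ltW r0)).
have [L FL _] : exists2 L, l @ F --> L & cabs L <= 2 * M / r.
  by apply: bounded_ultra_cvg; apply: filterS FA => x /lM.
pose K := 8 * M / r ^+ 2.
have K0 : 0 <= K.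
  have M0 : 0 <= M by apply: le_trans (fA x0 a Ax0 ca).2; exact: cabs_ge0.
  by rewrite /K mulr_ge0 // ?invr_ge0 ?exprn_ge0 ?(ltW r0) // mulr_ge0.
have key z : cabs (z - a) <= r / 2 ->
    cabs (g z - g a - L * (z - a)) <= K * cabs (z - a) ^+ 2.
  move=> zr; apply/ler_addgt0Pr => e e0.
  have zrho : cabs (z - a) < rho by rewrite /r in zr; lra.
  have e3 : 0 < e / 3 by rewrite divr_gt0.
  have zz : 0 < 1 + cabs (z - a) by rewrite ltr_pwDl // cabs_ge0.
  have e4 : 0 < e / 3 / (1 + cabs (z - a)) by rewrite divr_gt0.
  have H1 := cvg_cabs_lt (fg z zrho) e3.
  have H2 := cvg_cabs_lt (fg a ca) e3.
  have H3 := cvg_cabs_lt FL e4.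
  have [x [[[/= Ax h1] h2] h3]] := filter_ex (filterI (filterI (filterI FA H1) H2) H3).
  have := cauchy_taylor r0 rrho (fun z zr => (fA x z Ax zr).1)
    (fun z zr => (fA x z Ax zr).2) (Hl x Ax) zr; rewrite -/K => h.
  have h3' : cabs ((l x - L) * (z - a)) <= e / 3.
    rewrite cabsM; apply: le_trans (ler_wpM2r (cabs_ge0 _) (ltW h3)) _.
    by rewrite mulrAC ler_pdivrMr //; apply: ler_wpM2l; [exact: ltW|rewrite lerDr].
  have -> : g z - g a - L * (z - a) = (f x z - f x a - l x * (z - a)) +
     ((f x a - g a) - (f x z - g z) + (l x - L) * (z - a)) by ring.
  apply: le_trans (cabsD _ _) _; apply: lerD => //.
  apply: le_trans (cabsD _ _) _.
  have := cabsB (f x a - g a) (f x z - g z); lra.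
apply/differentiable_cderivP; exists L => e e0.
have K1 : 0 < K + 1 by rewrite ltr_wpDl.
exists (Num.min (r / 2) (e / (K + 1))).
  by rewrite lt_min !divr_gt0.
move=> z; rewrite lt_min => /andP[zr ze]; apply: le_trans (key z (ltW zr)) _.
rewrite expr2 mulrA; apply: ler_wpM2r; first exact: cabs_ge0.
apply: (@le_trans _ _ ((K + 1) * cabs (z - a))).
  by apply: ler_wpM2r; [exact: cabs_ge0|rewrite lerDl].
by rewrite mulrC -ler_pdivlMr // ltW.
Qed.

Lemma pow_lt1_eq0 (x q M : R) : 0 <= x -> 0 <= q < 1 ->
  (forall n, x <= M * q ^+ n) -> x = 0.
Proof.
move=> x0 /andP[q0 q1] H; apply/eqP; rewrite eq_le x0 andbT leNgt; apply/negP => x1.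
have : M * q ^+ n @[n --> \oo] --> M * 0.
  by apply: cvgM; [exact: cvg_cst|apply: cvg_expr; rewrite ger0_norm].
move=> /cvgrPdist_lt /(_ x x1) [N _ /(_ N (leqnn N))].
by rewrite /= mulr0 sub0r normrN => /(le_lt_trans (ler_norm _)); rewrite ltNge H.
Qed.

(* Since [f] vanishes near [a], dividing it by [(z - a) ^+ n] keeps it
   differentiable, for every [n]. *)
Lemma vanish_disc f a rho d : 0 < d ->
  (forall z, cabs (z - a) < rho -> differentiable f z) ->
  (forall z, cabs (z - a) < d -> f z = 0) ->
  forall z, cabs (z - a) < rho -> f z = 0.
Proof.
move=> d0 df fd z zrho.
pose r := (cabs (z - a) + rho) / 2.
have zr : cabs (z - a) < r by rewrite /r; lra.
have rrho : r < rho by rewrite /r; lra.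
have r0 : 0 < r by apply: le_lt_trans zr; exact: cabs_ge0.
have cK : compact [set w : C | cabs (w - a) <= r] by exact: closed_disc_compact.
have [||z1 z1r z1max] := @compact_max _ _ (fun w => cabs (f w)) _ cK.
- by exists a; rewrite /= subrr cabs0 ltW.
- move=> w wr; apply: continuous_cabs; apply: cderiv_continuous; apply: df.
  exact: le_lt_trans rrho.
(* The claim is general in [g] and [M] because the induction replaces [g] by [slope g a 0], which is
   [g w / (w - a)] off [a], and [M] by [M / r]. *)
have key n : forall g M, (forall w, cabs (w - a) < rho -> differentiable g w) ->
   (forall w, cabs (w - a) < d -> g w = 0) ->
   (forall w, cabs (w - a) = r -> cabs (g w) <= M) ->
   cabs (g z) <= M * (cabs (z - a) / r) ^+ n.
  elim: n => [|n IH] g M dg gd gM.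
    rewrite expr0 mulr1; apply: (@max_disc _ g a r rho) => //; last exact: ltW.
    move=> w wr; apply: (@good_differentiable _ _ _ (rho - cabs (w - a))).
      by rewrite subr_gt0.
    by move=> w' wz; apply: dg; have := cabs_dist3 w' a w; lra.
  have [->|za] := eqVneq z a.
    by rewrite gd subrr cabs0 // mul0r expr0n /= mulr0.
  have ga : g a = 0 by apply: gd; rewrite subrr cabs0.
  have slope0 w : cabs (w - a) < d -> slope g a 0 w = 0.
    by move=> wd; rewrite /slope; case: eqVneq => // _; rewrite gd // ga subrr mul0r.
  have := IH (slope g a 0) (M / r) _ slope0.
  rewrite {3}/slope (negPf za) ga subr0 cabsM cabsV exprSr.
  have za0 : 0 < cabs (z - a) by rewrite cabs_gt0 subr_eq0.
  rewrite ler_pdivrMr //; set q := _ ^+ n => H.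
  have -> : M * (q * (cabs (z - a) / r)) = M / r * q * cabs (z - a) by ring.
  apply: H => w wr.
    have [->|wa] := eqVneq w a; last by apply: differentiable_slope; [exact: wa|exact: dg].
    apply: (@differentiable_near _ (fun=> 0)); last exact: differentiable_cst.
    by exists d; [exact: d0|move=> w' /slope0].
  rewrite /slope; case: eqVneq => [wa|_].
    by move: wr r0; rewrite wa subrr cabs0 => <-; rewrite ltxx.
  by rewrite ga subr0 cabsM cabsV wr ler_pM2r ?invr_gt0 // gM.
apply/eqP; rewrite -cabs_eq0; apply/eqP.
apply: (@pow_lt1_eq0 _ (cabs (z - a) / r) (cabs (f z1))); first exact: cabs_ge0.
  by rewrite divr_ge0 ?cabs_ge0 ?ltW //= ltr_pdivrMr // mul1r.
move=> n; apply: key => // w wr; apply: z1max.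
by rewrite /= wr.
Qed.

Lemma identity_theorem (U : set C) f a d : open U -> connected U -> 0 < d -> U a ->
  (forall z, U z -> differentiable f z) ->
  (forall z, U z -> cabs (z - a) < d -> f z = 0) ->
  forall z, U z -> f z = 0.
Proof.
move=> oU cU d0 Ua df fd.
pose N := [set z : C | exists2 e : R, 0 < e & forall w, U w -> cabs (w - z) < e -> f w = 0].
suff /seteqP[_ H] : U `&` N = U.
  by move=> z /[dup] Uz /H[_ [e e0]]; apply; rewrite // subrr cabs0.
apply: cU; first by exists a; split => //; exists d.
- exists N => //; rewrite openE => z [e e0 He]; apply/nbhs_cabsP.
  exists (e / 2) => [|w wz]; first by rewrite divr_gt0.
  exists (e / 2) => [|w' Uw' ww']; first by rewrite divr_gt0.
  by apply: He => //; have := cabs_dist3 w' z w; lra.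
exists (closure N); first exact: closed_closure.
apply/seteqP; split => z [Uz Nz]; split => //; first exact: subset_closure.
have /nbhs_cabsP[rho rho0 rU] : nbhs z U by apply: open_nbhs_nbhs; split.
have rho2 : 0 < rho / 2 by rewrite divr_gt0.
(* A point of [N] close to [z] is the centre of a disc in [U] containing [z], to which [vanish_disc]
   applies. *)
have [w [e e0 He] wz] := (closure_cabsP _ _).1 Nz _ rho2.
have wU w' : cabs (w' - w) < rho / 2 -> U w'.
  by move=> w'w; apply: rU; have := cabs_dist3 w' z w; lra.
have m0 : 0 < Num.min e (rho / 2) by rewrite lt_min e0.
have fw w' : cabs (w' - w) < rho / 2 -> f w' = 0.
  apply: (vanish_disc m0); first by move=> t /wU; exact: df.
  by move=> t; rewrite lt_min => /andP[te /wU Ut]; exact: He.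
exists (rho / 2 - cabs (z - w)) => [|w' Uw' w'z]; first by rewrite subr_gt0 cabsC.
by apply: fw; have := cabs_dist3 w' w z; lra.
Qed.

(* If [l != 0], apply the maximum principle to [(g - v)^-1] for a value [v] close
   to [g a] which [g] omits. *)
Lemma deriv_eq0_of_thin_image (E : set C) g a rho l : 0 < rho ->
  (forall v e, 0 < e -> exists2 v', ~ E v' & cabs (v' - v) < e) ->
  (forall z, cabs (z - a) < rho -> differentiable g z /\ E (g z)) ->
  has_cderiv g a l -> l = 0.
Proof.
move=> rho0 thin gE gl; apply/eqP; rewrite -cabs_eq0; apply/negP => /negP l0.
have {}l0 : 0 < cabs l by rewrite lt_def l0 cabs_ge0.
have l2 : 0 < cabs l / 2 by rewrite divr_gt0.
have [d d0 Hd] := gl _ l2.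
pose r := Num.min d rho / 2.
have m0 : 0 < Num.min d rho by rewrite lt_min d0.
have r0 : 0 < r by rewrite divr_gt0.
have [rd rrho] : r < d /\ r < rho.
  have h1 : Num.min d rho <= d by rewrite ge_min lexx.
  have h2 : Num.min d rho <= rho by rewrite ge_min lexx orbT.
  by rewrite /r; split; lra.
have lr0 : 0 < cabs l * r by rewrite mulr_gt0.
(* On the circle of radius [r], [g] is at distance at least [cabs l * r / 2] from [g a], hence more
   than [cabs l * r / 4] from [v]. At the centre the distance to [v] is less than [cabs l * r / 8],
   against the maximum principle. *)
have lr8 : 0 < cabs l * r / 8 by rewrite divr_gt0.
have [v Ev vg] := thin (g a) _ lr8.
have nv z : cabs (z - a) < rho -> g z - v != 0.
  by move=> /gE[_ Egz]; rewrite subr_eq0; apply: contra_notN Ev => /eqP <-.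
have dF z : cabs (z - a) < rho -> differentiable (fun z => (g z - v)^-1) z.
  move=> zr; apply: (@differentiableV C C (fun z => g z - v)); last exact: nv.
  by apply: (@differentiableB C C C g (cst v) z); [exact: (gE z zr).1|exact: differentiable_cst].
have Fgood z : cabs (z - a) < rho -> good (fun z => (g z - v)^-1) z.
  move=> zr; apply: (@good_differentiable _ _ _ (rho - cabs (z - a))).
    by rewrite subr_gt0.
  by move=> w wz; apply: dF; have := cabs_dist3 w a z; lra.
have circ z : cabs (z - a) = r -> cabs (g z - v)^-1 <= (cabs l * r / 4)^-1.
  move=> zr; rewrite cabsV lef_pV2 ?posrE ?cabs_gt0 ?nv ?zr ?divr_gt0 //.
  have := Hd z; rewrite zr => /(_ rd).
  have := cabs_distl (l * (z - a)) (l * (z - a) - (g z - v)).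
  have -> : l * (z - a) - (l * (z - a) - (g z - v)) = g z - v by ring.
  have := cabsD (- (g z - g a - l * (z - a))) (v - g a).
  have -> : - (g z - g a - l * (z - a)) + (v - g a) = l * (z - a) - (g z - v) by ring.
  rewrite cabsN cabsM zr; lra.
have := max_disc rrho Fgood circ (z := a); rewrite subrr cabs0 => /(_ (ltW r0)).
rewrite cabsV lef_pV2 ?posrE ?divr_gt0 ?cabs_gt0 ?nv ?subrr ?cabs0 //.
by rewrite cabsC; lra.
Qed.

(** As the derivative vanishes, the Taylor bound makes each increment quadratic in the step. Going
    from [a] to [b] in [2 ^ k] equal steps costs at most [K * cabs (b - a) ^+ 2 / 2 ^ k]; the offset
    [n0] makes the steps short enough for the Taylor bound. *)
Lemma deriv0_constant g a rho M : 0 < rho ->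
  (forall z, cabs (z - a) < rho -> has_cderiv g z 0 /\ cabs (g z) <= M) ->
  forall b, cabs (b - a) <= rho / 4 -> g b = g a.
Proof.
move=> rho0 H b ba.
have r0 : 0 < rho / 4 by rewrite divr_gt0.
have rr : rho / 4 < rho / 2 by lra.
have step z w : cabs (z - a) <= rho / 4 -> cabs (w - z) <= rho / 4 / 2 ->
    cabs (g w - g z) <= 8 * M / (rho / 4) ^+ 2 * cabs (w - z) ^+ 2.
  move=> za wz; have zin t : cabs (t - z) < rho / 2 -> cabs (t - a) < rho.
    by move=> tz; have := cabs_dist3 t a z; lra.
  have za' : cabs (z - a) < rho by lra.
  have := cauchy_taylor r0 rr _ _ (H z za').1 wz (M := M); rewrite mul0r subr0; apply.
    by move=> t /zin /H[Ht _]; apply/differentiable_cderivP; exists 0.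
  by move=> t /zin /H[].
set K := 8 * M / _ in step.
have e2 (n : nat) : 0 < 2 ^+ n :> R by rewrite exprn_gt0.
have [n0 n0E] := half_pow_lt (cabs (b - a)) (divr_gt0 r0 (ltr0Sn _ 1)).
apply/eqP; rewrite -subr_eq0 -cabs_eq0; apply/eqP.
apply: (@pow_lt1_eq0 _ 2^-1 (K * cabs (b - a) ^+ 2 * 2^-1 ^+ n0)); first exact: cabs_ge0.
  by rewrite invr_ge0 ler0n /= invf_lt1 // ltr1n.
move=> n; rewrite -mulrA -exprD; set k := (n0 + n)%N.
pose h : C := (2^-1 ^+ k)%:C * (b - a).
have h2 : 0 < 2^-1 ^+ k :> R by rewrite exprn_gt0 // invr_gt0.
have ch : cabs h = 2^-1 ^+ k * cabs (b - a) by rewrite cabsM cabs_real gtr0_norm.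
have hr : cabs h <= rho / 4 / 2.
  rewrite ch; apply: le_trans (ltW n0E); rewrite mulrC; apply: ler_wpM2l.
    exact: cabs_ge0.
  rewrite /k exprD ger_pMr ?exprn_gt0 ?invr_gt0 //.
  by rewrite exprn_ile1 // ?invr_ge0 // invf_le1 // ler1n.
have walk j : (j <= 2 ^ k)%N -> cabs (g (a + h *+ j) - g a) <= (K * cabs h ^+ 2) *+ j.
  elim: j => [|j IH] jk; first by rewrite !mulr0n addr0 subrr cabs0.
  rewrite [in X in _ <= X]mulrS [in X in _ <= X]addrC.
  have -> : g (a + h *+ j.+1) - g a = (g (a + h *+ j) - g a) + (g (a + h *+ j.+1) - g (a + h *+ j)) by ring.
  apply: le_trans (cabsD _ _) _; apply: lerD; first exact: IH (ltnW jk).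
  have E : a + h *+ j.+1 - (a + h *+ j) = h by rewrite mulrS; ring.
  have := step (a + h *+ j) (a + h *+ j.+1); rewrite E; apply => //.
  rewrite addrAC subrr add0r -[h *+ j]mulr_natr cabsM.
  have -> : (j%:R : C) = (j%:R : R)%:C by rewrite rmorph_nat.
  rewrite cabs_real ger0_norm // ch; apply: le_trans ba.
  have hj : 2^-1 ^+ k * j%:R <= 1 :> R.
    by rewrite exprVn mulrC ler_pdivrMr ?exprn_gt0 // mul1r -natrX ler_nat ltnW.
  by have := ler_wpM2r (cabs_ge0 (b - a)) hj; rewrite mul1r mulrAC.
have pk : 2^-1 ^+ k * 2 ^+ k = 1 :> R by rewrite exprVn mulVf // gt_eqF.
have := walk (2 ^ k)%N (leqnn _).
have -> : a + h *+ (2 ^ k)%N = b.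
  rewrite -[h *+ _]mulr_natr /h mulrAC.
  have -> : ((2 ^ k)%N%:R : C) = (2 ^+ k : R)%:C by rewrite natrX rmorphXn rmorph_nat.
  by rewrite -rmorphM pk mul1r addrC subrK.
move/le_trans; apply; rewrite -[_ *+ (2 ^ k)%N]mulr_natr ch natrX exprMn.
have -> : K * ((2^-1 ^+ k) ^+ 2 * cabs (b - a) ^+ 2) * 2 ^+ k =
  K * (cabs (b - a) ^+ 2 * (2^-1 ^+ k * (2^-1 ^+ k * 2 ^+ k))) by ring.
by rewrite pk mulr1 mulrA.
Qed.

End LocalTheory.

(** * Bounded separately holomorphic functions *)

Section SeparatelyHolomorphic.
Variables (R : realType) (n : nat).
Local Notation C := R[i].
Implicit Types (z w c : 'rV[C]_n) (i j : 'I_n) (t x : C) (d e M : R).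

Definition upd z i t : 'rV[C]_n := \row_j (if j == i then t else z ord0 j).

Lemma updE z i t j : upd z i t ord0 j = if j == i then t else z ord0 j.
Proof. by rewrite mxE. Qed.

Lemma upd_same z i t : upd z i t ord0 i = t.
Proof. by rewrite updE eqxx. Qed.

Lemma upd_id z i : upd z i (z ord0 i) = z.
Proof. by apply/rowP => j; rewrite updE; case: eqP => // ->. Qed.

Lemma upd_upd z i t x : upd (upd z i t) i x = upd z i x.
Proof. by apply/rowP => j; rewrite !updE; case: eqP. Qed.

Lemma upd_slice (T : Type) (f : 'rV[C]_n -> T) z i x :
  (fun t => f (upd (upd z i x) i t)) = (fun t => f (upd z i t)).
Proof. by apply/funext => t; rewrite upd_upd. Qed.

Lemma updC z i j t x : i != j -> upd (upd z i t) j x = upd (upd z j x) i t.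
Proof.
move=> ij; apply/rowP => k; rewrite !updE; case: (eqVneq k j) => [->|//].
by rewrite eq_sym (negPf ij).
Qed.

(** The open polydisc with all radii equal to [d]. *)
Definition cube c d w := forall i, cabs (w ord0 i - c ord0 i) < d.

Lemma cube_center c d : 0 < d -> cube c d c.
Proof. by move=> d0 i; rewrite subrr cabs0. Qed.

Lemma cube_upd c d w i t : cube c d w -> cabs (t - c ord0 i) < d -> cube c d (upd w i t).
Proof. by move=> cw tc j; rewrite updE; case: eqP => // ->. Qed.

Lemma cubeW c d e w : d <= e -> cube c d w -> cube c e w.
Proof. by move=> de cw i; apply: lt_le_trans de. Qed.

Lemma finite_pos_lb (I : finType) (h : I -> R) : (forall k, 0 < h k) ->
  exists2 e : R, 0 < e & forall k, e <= h k.
Proof.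
move=> h0; exists (\big[Num.min/1]_k h k).
  by elim/big_ind: _ => // x y x0 y0; rewrite lt_min x0.
by move=> k; exact: bigmin_le_cond.
Qed.

Lemma finite_pos_lb_ex (I : finType) (P : I -> R -> Prop) :
  (forall k d e, d <= e -> P k e -> P k d) ->
  (forall k, exists2 e : R, 0 < e & P k e) ->
  exists2 e : R, 0 < e & forall k, P k e.
Proof.
move=> Pmono H; have [|h Hh] := @boolp.choice I R (fun k e => 0 < e /\ P k e).
  by move=> i; have [e] := H i; exists e.
have [|e e0 eh] := @finite_pos_lb _ h; first by move=> i; case: (Hh i).
by exists e => // i; apply: Pmono (eh i) _; case: (Hh i).
Qed.

Lemma cube_open c d z : cube c d z -> exists2 e : R, 0 < e & forall w, cube z e w -> cube c d w.
Proof.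
move=> cz; have [|e e0 H] := @finite_pos_lb _ (fun i => d - cabs (z ord0 i - c ord0 i)).
  by move=> i; rewrite subr_gt0.
exists e => // w zw i; have := zw i; have := H i.
by have := cabs_dist3 (w ord0 i) (c ord0 i) (z ord0 i); lra.
Qed.

(** A finite form of Baire's theorem: among finitely many relatively closed sets covering a cube,
    one contains a smaller cube. If the first set is not everything, some smaller cube avoids it and
    is covered by the others. *)
Lemma closed_cover (J : eqType) (s : seq J) (P : J -> 'rV[C]_n -> Prop) c d :
  0 < d ->
  (forall k z, k \in s -> cube c d z -> ~ P k z ->
     exists2 e : R, 0 < e & forall w, cube z e w -> ~ P k w) ->
  (forall z, cube c d z -> exists2 k, k \in s & P k z) ->
  exists k c' d', [/\ k \in s, 0 < d', forall z, cube c' d' z -> cube c d z &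
    forall z, cube c' d' z -> P k z].
Proof.
elim: s c d => [|j s IH] c d d0 Pcl Pcov.
  by have [] := Pcov c (cube_center c d0).
have [all|/existsNP[z /not_implyP[cz nPz]]] := pselect (forall z, cube c d z -> P j z).
  by exists j, c, d; split => //; rewrite mem_head.
have [e1 e10 H1] := Pcl j z (mem_head _ _) cz nPz.
have [e2 e20 H2] := cube_open cz.
have e0 : 0 < Num.min e1 e2 by rewrite lt_min e10.
have sub w : cube z (Num.min e1 e2) w -> cube c d w.
  by move=> zw; apply: H2; apply: cubeW zw; rewrite ge_min lexx orbT.
have [||j' [c' [d' [j's d'0 sub' Pj']]]] := IH z _ e0.
- by move=> k w ks /sub cw; apply: Pcl; rewrite // inE ks orbT.
- move=> w zw; have [k] := Pcov w (sub w zw); rewrite inE => /predU1P[->|ks Pk].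
    by move=> Pjw; exfalso; apply: (H1 w) Pjw; apply: cubeW zw; rewrite ge_min lexx.
  by exists k.
by exists j', c', d'; split => // [|w /sub' /sub //]; rewrite inE j's orbT.
Qed.

Lemma coordinatewise_bound (f : 'rV[C]_n -> C) c d (K : R) : 0 <= K -> 0 < d ->
  (forall w i, cube c d w -> cabs (f w - f (upd w i (c ord0 i))) <= K) ->
  forall w, cube c d w -> cabs (f w - f c) <= n%:R * K.
Proof.
move=> K0 d0 H w cw.
suff key (s : seq 'I_n) : forall w, cube c d w ->
    (forall i, i \notin s -> w ord0 i = c ord0 i) ->
    cabs (f w - f c) <= (size s)%:R * K.
  have := key (enum 'I_n) w cw; rewrite size_enum_ord; apply.
  by move=> i; rewrite mem_enum.
elim: s => [|i s IH] {}w {}cw wc.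
  have -> : w = c by apply/rowP => i; exact: wc.
  by rewrite subrr cabs0 mul0r.
have cw' : cube c d (upd w i (c ord0 i)).
  by apply: cube_upd => //; rewrite subrr cabs0.
have -> : f w - f c = (f w - f (upd w i (c ord0 i))) + (f (upd w i (c ord0 i)) - f c) by ring.
apply: le_trans (cabsD _ _) _; rewrite /= -natr1 mulrDl mul1r addrC.
apply: lerD; last exact: H.
apply: IH => // j js; rewrite updE; case: eqVneq => [->//|ji].
by apply: wc; rewrite inE negb_or ji.
Qed.

Variable U : set C.
Hypothesis oU : open U.
Local Notation Un := (cart_power n U).

Lemma cart_power_upd z i t : Un z -> U t -> Un (upd z i t).
Proof. by move=> Uz Ut j; rewrite updE; case: eqP. Qed.

Lemma open_disc x : U x -> exists2 d : R, 0 < d & forall t, cabs (t - x) < d -> U t.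
Proof.
move=> Ux; have /nbhs_cabsP[d d0 dU] : nbhs x U by apply: open_nbhs_nbhs; split.
by exists d.
Qed.

Lemma open_cube z : Un z -> exists2 d : R, 0 < d & forall w, cube z d w -> Un w.
Proof.
move=> Uz; have [||d d0 H] := @finite_pos_lb_ex _
    (fun i d => forall t, cabs (t - z ord0 i) < d -> U t).
- by move=> i d e de H t td; apply: H; apply: lt_le_trans de.
- by move=> i; apply: open_disc; exact: Uz.
by exists d => // w zw i; apply: H (zw i).
Qed.

(** Boundedness is part of the notion: with it, separate holomorphy yields joint continuity by
    Cauchy estimates, without Hartogs' theorem, and limits along ultrafilters exist. *)
Definition holB (f : 'rV[C]_n -> C) : Prop :=
  (exists M : R, forall z, Un z -> cabs (f z) <= M) /\
  forall z i, Un z -> differentiable (fun t => f (upd z i t)) (z ord0 i).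

Lemma holB_slice f z i x : holB f -> Un z -> U x ->
  differentiable (fun t => f (upd z i t)) x.
Proof.
move=> [_ df] Uz Ux; have := df _ i (cart_power_upd i Uz Ux); rewrite upd_same.
by rewrite upd_slice.
Qed.

Lemma holB_cst x : holB (fun=> x).
Proof. by split; [exists (cabs x)|move=> z i Uz; exact: differentiable_cst]. Qed.

Lemma holB_add f g : holB f -> holB g -> holB (fun z => f z + g z).
Proof.
move=> [[M1 H1] df] [[M2 H2] dg]; split.
  exists (M1 + M2) => z Uz; apply: le_trans (cabsD _ _) _.
  by apply: lerD; [exact: H1|exact: H2].
move=> z i Uz; apply: (@differentiableD C C C (fun t => f (upd z i t)) (fun t => g (upd z i t))).
  exact: df.
exact: dg.
Qed.

Lemma holB_mul f g : holB f -> holB g -> holB (fun z => f z * g z).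
Proof.
move=> [[M1 H1] df] [[M2 H2] dg]; split.
  exists (M1 * M2) => z Uz; rewrite cabsM.
  by apply: ler_pM; [exact: cabs_ge0|exact: cabs_ge0|exact: H1|exact: H2].
move=> z i Uz; apply: (@differentiableM C C (fun t => f (upd z i t)) (fun t => g (upd z i t))).
  exact: df.
exact: dg.
Qed.

Lemma holB_sum (I : Type) (s : seq I) (P : pred I) (f : I -> 'rV[C]_n -> C) :
  (forall k, P k -> holB (f k)) -> holB (fun z => \sum_(k <- s | P k) f k z).
Proof.
move=> Hf; elim: s => [|i s IH].
  rewrite (_ : (fun _ => _) = (fun=> 0)); first exact: holB_cst.
  by apply/funext => z; rewrite big_nil.
rewrite (_ : (fun z => \sum_(k <- i :: s | P k) f k z) =
  (fun z => (if P i then f i z else 0) + \sum_(k <- s | P k) f k z)).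
  apply: holB_add; last exact: IH.
  case Pi: (P i); [exact: Hf|exact: holB_cst].
by apply/funext => z; rewrite big_cons; case: ifP => // _; rewrite add0r.
Qed.

Lemma holB_freeze f i x : holB f -> U x -> holB (fun z => f (upd z i x)).
Proof.
move=> hf Ux; have [[M HM] df] := hf; split.
  by exists M => z Uz; apply: HM; exact: cart_power_upd.
move=> z j Uz; have [<-|ij] := eqVneq j i.
  rewrite (_ : (fun t => _) = (fun=> f (upd z j x))); first exact: differentiable_cst.
  by apply/funext => t; rewrite upd_upd.
rewrite (_ : (fun t => _) = (fun t => f (upd (upd z i x) j t))).
  by apply: holB_slice => //; exact: cart_power_upd.
by apply/funext => t; rewrite updC.
Qed.

(** The global bound gives the same Lipschitz constant in each variable at all nearby points; the
    coordinates are changed one at a time. *)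
Lemma holB_continuous f z : holB f -> Un z -> forall e, 0 < e ->
  exists2 d : R, 0 < d & forall w, cube z d w -> cabs (f w - f z) < e.
Proof.
move=> hf Uz e e0; have [[M HM] _] := hf.
have M0 : 0 <= M by apply: le_trans (HM z Uz); exact: cabs_ge0.
have [rho rho0 zU] := open_cube Uz.
pose r := rho / 2.
have r0 : 0 < r by rewrite divr_gt0.
have rrho : r < rho by rewrite /r; lra.
pose L := 2 * M / r.
have L0 : 0 <= L by rewrite /L mulr_ge0 ?invr_ge0 ?(ltW r0) // mulr_ge0.
have nL : 0 < n%:R * L + 1 by rewrite ltr_wpDl // mulr_ge0.
pose d := Num.min r (e / (n%:R * L + 1)).
have d0 : 0 < d by rewrite lt_min r0 divr_gt0.
exists d => // w zw.
have Ld : n%:R * (L * d) < e.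
  rewrite mulrA; apply: (@lt_le_trans _ _ ((n%:R * L + 1) * d)).
    by rewrite ltr_pM2r // ltrDl.
  by rewrite mulrC -ler_pdivlMr // ge_min lexx orbT.
apply: le_lt_trans Ld; apply: (coordinatewise_bound _ d0) (zw).
  by rewrite mulr_ge0 // ltW.
move=> {zw}w i zw.
have wr : cabs (w ord0 i - z ord0 i) < r by apply: lt_le_trans (zw i) _; rewrite ge_min lexx.
have zwr : cube z rho w.
  by apply: cubeW zw; apply: le_trans (ltW rrho); rewrite ge_min lexx.
have sl t : cabs (t - z ord0 i) < rho -> Un (upd w i t).
  by move=> tz; apply: zU; exact: cube_upd.
have Uw : Un w by exact: zU.
have /= := @cauchy_lipschitz _ (fun t => f (upd w i t)) (z ord0 i) r rho M r0 rrho
  _ _ (w ord0 i) (ltW wr).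
rewrite upd_id -/L => H; apply: le_trans (H _ _) _.
- move=> t tz; apply: holB_slice => //.
  by have := sl t tz i; rewrite upd_same.
- by move=> t tz; apply: HM; exact: sl.
by apply: ler_wpM2l => //; exact: ltW (zw i).
Qed.

(** The coordinates are released one at a time: those in [s] range over [U], the others remain
    within [d] of [c]. *)
Lemma holB_identity f c d : connected U -> holB f -> Un c -> 0 < d ->
  (forall z, Un z -> cube c d z -> f z = 0) -> forall z, Un z -> f z = 0.
Proof.
move=> cU hf Uc d0 H.
suff key (s : seq 'I_n) : forall z, Un z ->
    (forall i, i \notin s -> cabs (z ord0 i - c ord0 i) < d) -> f z = 0.
  by move=> z Uz; apply: (key (enum 'I_n)) => // i; rewrite mem_enum.
elim: s => [|i s IH] z Uz zc; first by apply: H => // i; exact: zc.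
rewrite -(upd_id z i).
apply: (@identity_theorem _ U (fun t => f (upd z i t)) (c ord0 i) d oU cU d0 (Uc i)) => //.
  by move=> t Ut; exact: holB_slice.
move=> t Ut tc; apply: IH; first exact: cart_power_upd.
move=> j js; rewrite updE; case: eqVneq => [->//|ji].
by apply: zc; rewrite inE negb_or ji.
Qed.

(** Montel's theorem in ultrafilter form. *)
Lemma holB_ultralimit (T : Type) (F : set_system T) (A : set T)
    (f : T -> 'rV[C]_n -> C) M : UltraFilter F -> F A ->
  (forall (y : T) z, A y -> Un z -> cabs (f y z) <= M) ->
  (forall (y : T) z i, A y -> Un z -> differentiable (fun t => f y (upd z i t)) (z ord0 i)) ->
  exists2 g, holB g & forall z, Un z -> f y z @[y --> F] --> g z.
Proof.
move=> FU FA fM df.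
have [|g Hg] := @boolp.choice 'rV[C]_n C (fun z l => Un z ->
    f y z @[y --> F] --> l /\ cabs l <= M).
  move=> z; have [Uz|nUz] := pselect (Un z); last by exists 0.
  have [l l1 l2] : exists2 l, f y z @[y --> F] --> l & cabs l <= M.
    by apply: bounded_ultra_cvg; apply: filterS FA => x Ax; exact: fM.
  by exists l.
exists g; last by move=> z /Hg[].
split; first by exists M => z /Hg[].
move=> z i Uz; have [rho rho0 H] := open_disc (Uz i).
apply: (@ultralimit_differentiable _ _ F A (fun y t => f y (upd z i t)) _ _ rho M) => //.
  move=> x t Ax tz; have Ut := H t tz; have Uzt := cart_power_upd i Uz Ut.
  split; last exact: fM.
  have := df x _ i Ax Uzt; rewrite upd_same.
  by rewrite upd_slice.
by move=> t tz; apply: (Hg _ _).1; apply: cart_power_upd => //; exact: H.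
Qed.

End SeparatelyHolomorphic.

(** * Divided differences and simple roots of polynomials *)

Section DividedDifference.
Variable K : comNzRingType.
Implicit Types (p : {poly K}) (t u c : K).

(** The divided difference of [p] at [t] and [u]. The cutoff [N] replaces the size of [p], so that
    this is one fixed polynomial expression in the coefficients. At [k = 0] the inner sum is empty
    and [k.-1] is harmless. *)
Definition hpoly N p t u : K :=
  \sum_(k < N) p`_k * \sum_(j < k) t ^+ (k.-1 - j) * u ^+ j.

Lemma hpolyE N p t u : (size p <= N)%N -> p.[t] - p.[u] = (t - u) * hpoly N p t u.
Proof.
move=> pN; rewrite !(horner_coef_wide _ pN) -sumrB mulr_sumr.
by apply: eq_bigr => k _; rewrite -mulrBr subrXX mulrCA.
Qed.

Lemma hpoly_diag N p c : (size p <= N)%N -> hpoly N p c c = p^`().[c].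
Proof.
move=> pN; have -> : p = \sum_(k < N) p`_k *: 'X^k.
  apply/polyP => i; rewrite coef_sum; have [iN|Ni] := ltnP i N.
    rewrite (bigD1 (Ordinal iN)) //= coefZ coefXn eqxx mulr1 big1 ?addr0 //.
    move=> k /eqP ki; rewrite coefZ coefXn; case: eqP => [ik|_]; last by rewrite mulr0.
    by case: ki; apply: val_inj.
  rewrite nth_default ?(leq_trans pN) // big1 // => k _.
  by rewrite coefZ coefXn gtn_eqF ?mulr0 // (leq_trans (ltn_ord k)).
rewrite raddf_sum /= horner_sum /hpoly; apply: eq_bigr => k _.
rewrite derivZ derivXn hornerZ hornerMn hornerXn; congr (_ * _).
  rewrite coef_sum (bigD1 k) //= coefZ coefXn eqxx mulr1 big1 ?addr0 //.
  move=> j jk; rewrite coefZ coefXn; case: eqP => [E|_]; last by rewrite mulr0.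
  by move: jk; rewrite (val_inj E) eqxx.
rewrite (eq_bigr (fun=> c ^+ k.-1)); first by rewrite sumr_const card_ord.
by move=> j _; rewrite -exprD subnK // -ltnS (ltn_predK (ltn_ord j)).
Qed.

End DividedDifference.

Section RootDifferentiable.
Variable R : realType.
Local Notation C := R[i].

Lemma cvg_mulC (T : Type) (F : set_system T) (f g : T -> C) (x y : C) : Filter F ->
  f s @[s --> F] --> x -> g s @[s --> F] --> y -> f s * g s @[s --> F] --> x * y.
Proof. by move=> FF fx gy; exact: (@cvgM C T F FF f g x y fx gy). Qed.

Lemma cvg_prodC (T J : Type) (F : set_system T) (r : seq J) (f : J -> T -> C) (x : J -> C) :
  Filter F -> (forall j, f j s @[s --> F] --> x j) ->
  \prod_(j <- r) f j s @[s --> F] --> \prod_(j <- r) x j.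
Proof.
move=> FF fx; elim: r => [|j r IH].
  rewrite big_nil (_ : (fun s => _) = (fun=> 1)); first exact: cvg_cst.
  by apply/funext => s; rewrite big_nil.
rewrite big_cons (_ : (fun s => _) = (fun s => f j s * \prod_(k <- r) f k s)).
  exact: (@cvg_mulC T F (f j) (fun s => \prod_(k <- r) f k s) _ _ FF (fx j) IH).
by apply/funext => s; rewrite big_cons.
Qed.

Lemma cvg_sumC (T J : Type) (F : set_system T) (r : seq J) (f : J -> T -> C) (x : J -> C) :
  Filter F -> (forall j, f j s @[s --> F] --> x j) ->
  \sum_(j <- r) f j s @[s --> F] --> \sum_(j <- r) x j.
Proof.
move=> FF fx; elim: r => [|j r IH].
  rewrite big_nil (_ : (fun s => _) = (fun=> 0)); first exact: cvg_cst.
  by apply/funext => s; rewrite big_nil.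
rewrite big_cons (_ : (fun s => _) = (fun s => f j s + \sum_(k <- r) f k s)).
  exact: (@cvgD C C T F FF (f j) (fun s => \sum_(k <- r) f k s) _ _ (fx j) IH).
by apply/funext => s; rewrite big_cons.
Qed.

Lemma cvg_expC (T : Type) (F : set_system T) (f : T -> C) (x : C) n : Filter F ->
  f s @[s --> F] --> x -> f s ^+ n @[s --> F] --> x ^+ n.
Proof.
move=> FF fx; elim: n => [|n IH].
  rewrite expr0 (_ : (fun s => _) = (fun=> 1)); first exact: cvg_cst.
  by apply/funext => s; rewrite expr0.
rewrite exprS (_ : (fun s => _) = (fun s => f s * f s ^+ n)).
  exact: (@cvg_mulC T F f (fun s => f s ^+ n) _ _ FF fx IH).
by apply/funext => s; rewrite exprS.
Qed.

Lemma hpoly_cvg (T : Type) (F : set_system T) (N : nat) (q : T -> {poly C})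
    (p : {poly C}) (f g : T -> C) (x y : C) : Filter F ->
  (forall k, (k < N)%N -> (q s)`_k @[s --> F] --> p`_k) ->
  f @ F --> x -> g @ F --> y -> hpoly N (q s) (f s) (g s) @[s --> F] --> hpoly N p x y.
Proof.
move=> FF qp fx gy; pose S k (s : T) : C := \sum_(j < k) f s ^+ (k.-1 - j) * g s ^+ j.
pose S' k : C := \sum_(j < k) x ^+ (k.-1 - j) * y ^+ j.
have SS k : S k s @[s --> F] --> S' k.
  apply: (@cvg_sumC T _ F _ (fun (j : 'I_k) s => f s ^+ (k.-1 - j) * g s ^+ j)
    (fun j : 'I_k => x ^+ (k.-1 - j) * y ^+ j) FF) => j.
  exact: (@cvg_mulC T F (fun s => f s ^+ (k.-1 - j)) (fun s => g s ^+ j) _ _ FF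
    (@cvg_expC T F f x _ FF fx) (@cvg_expC T F g y _ FF gy)).
apply: (@cvg_sumC T _ F _ (fun (k : 'I_N) s => (q s)`_k * S k s)
    (fun k : 'I_N => p`_k * S' k) FF) => k.
exact: (@cvg_mulC T F (fun s => (q s)`_k) (S k) _ _ FF (qp k (ltn_ord k)) (SS k)).
Qed.

Lemma horner_cvg (T : Type) (F : set_system T) (N : nat) (q : T -> {poly C})
    (p : {poly C}) (f : T -> C) (x : C) : ProperFilter F ->
  (size p <= N)%N -> F [set s | (size (q s) <= N)%N] ->
  (forall k, (k < N)%N -> (q s)`_k @[s --> F] --> p`_k) ->
  f @ F --> x -> (q s).[f s] @[s --> F] --> p.[x].
Proof.
move=> FF pN qN qp fx; rewrite (horner_coef_wide _ pN).
apply: (@cvg_trans _ (\sum_(k < N) (q s)`_k * f s ^+ k @[s --> F])).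
  apply: near_eq_cvg; apply: filterS qN => s sN.
  by rewrite (horner_coef_wide _ sN).
apply: (@cvg_sumC T _ F _ (fun (k : 'I_N) s => (q s)`_k * f s ^+ k)
    (fun k : 'I_N => p`_k * x ^+ k) _) => k.
exact: (@cvg_mulC T F (fun s => (q s)`_k) (fun s => f s ^+ k) _ _ _ (qp k (ltn_ord k))
   (@cvg_expC T F f x k _ fx)).
Qed.

Lemma has_cderiv_factor (f s : C -> C) a (d : R) : 0 < d -> {for a, continuous s} ->
  (forall z, cabs (z - a) < d -> f z - f a = (z - a) * s z) -> has_cderiv f a (s a).
Proof.
move=> d0 /continuous_cabsP cs fs e /cs[d' d'0 H].
exists (Num.min d d') => [|z]; first by rewrite lt_min d0.
rewrite lt_min => /andP[zd zd']; rewrite fs // mulrC -mulrBl cabsM.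
by apply: ler_wpM2r; [exact: cabs_ge0|exact: ltW (H z zd')].
Qed.

(** Implicit differentiation with the roots compared at [c = psi a]: since [(q z).[psi z] = 0], [-
    (q z).[c]] is [psi z - c] times a divided difference. The latter is continuous and nonzero at
    [a], so dividing by it and by [z - a] gives a continuous quotient. *)
Lemma differentiable_root (N : nat) (q : C -> {poly C}) (psi : C -> C) a (d : R) :
  0 < d -> (forall z, cabs (z - a) < d -> (size (q z) <= N)%N) ->
  (forall k, (k < N)%N -> differentiable (fun z => (q z)`_k) a) ->
  {for a, continuous psi} ->
  (forall z, cabs (z - a) < d -> root (q z) (psi z)) ->
  hpoly N (q a) (psi a) (psi a) != 0 -> differentiable psi a.
Proof.
move=> d0 qN dq cpsi rt h0; set c := psi a in h0 *.
have aa : cabs (a - a) < d by rewrite subrr cabs0.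
pose k z := \sum_(j < N) (q z)`_j * c ^+ j.
have kE z : cabs (z - a) < d -> k z = (q z).[c].
  by move=> /qN zN; rewrite (horner_coef_wide _ zN).
have ka : k a = 0 by rewrite kE //; apply/eqP; exact: rt.
have /differentiable_cderivP[l kl] : differentiable k a.
  rewrite /k (_ : (fun z => _) = \sum_(j < N) (fun z => (q z)`_j * c ^+ j)).
    apply: differentiable_sum => j; apply: (@differentiableM C C (fun z => (q z)`_j) (cst (c ^+ j))).
      exact: dq.
    exact: differentiable_cst.
  by apply/funext => z; rewrite fct_sumE.
pose h z := hpoly N (q z) (psi z) c.
have ch : {for a, continuous h}.
  have qa j : (j < N)%N -> (q z)`_j @[z --> a] --> (q a)`_j.
    by move=> jN; exact: (cderiv_continuous (dq j jN)).
  exact: (@hpoly_cvg C (nbhs a) N q (q a) psi (fun=> c) c c (nbhs_filter a) qa cpsi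
    (cvg_cst c)).
pose s z := - slope k a l z * (h z)^-1.
have cs : {for a, continuous s}.
  have s1 : {for a, continuous (slope k a l)} by exact: continuous_slope_center.
  exact: (@cvg_mulC C (nbhs a) (fun z => - slope k a l z) (fun z => (h z)^-1) _ _ (nbhs_filter a)
    (@cvgN C C C (nbhs a) (nbhs_filter a) (slope k a l) _ s1)
    (@cvgV C C (nbhs a) (nbhs_filter a) h _ h0 ch)).
have c0 : 0 < cabs (h a) by rewrite cabs_gt0.
have [d' d'0 H] := (continuous_cabsP h a).1 ch _ c0.
apply/differentiable_cderivP; exists (s a).
apply: (@has_cderiv_factor _ _ _ (Num.min d d')) => [| |z]; [by rewrite lt_min d0|exact: cs|].
rewrite lt_min => /andP[zd zd'].
have hz : h z != 0.
  apply: contraTneq (H z zd') => ->; rewrite sub0r cabsN ltxx //.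
have := hpolyE (psi z) c (qN z zd); rewrite -kE // (eqP (rt z zd)) sub0r -/(h z).
rewrite /s /slope ka subr0; case: eqVneq => [-> _|za E].
  by rewrite !subrr mul0r.
have za0 : z - a != 0 by rewrite subr_eq0.
apply: (mulIf hz); rewrite mulrA mulfVK //.
by rewrite mulrN mulrCA divff // mulr1 E.
Qed.

End RootDifferentiable.

(** * Roots on the boundary *)

Section CommonBoundaryRoot.
Variables (R : realType) (n : nat) (U : set R[i]).
Local Notation C := R[i].
Hypotheses (oU : open U) (cU : connected U).
Local Notation Un := (cart_power n U).
Local Notation holB := (holB U).
Implicit Types (z w : 'rV[C]_n) (t u c : C) (d e : R).

Lemma holB_ext f g : (forall z, Un z -> f z = g z) -> holB f -> holB g.
Proof.
move=> fg [[M HM] df]; split; first by exists M => z Uz; rewrite -fg // HM.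
move=> z i Uz; have [d d0 Hd] := open_disc oU (Uz i).
apply: differentiable_near (df z i Uz); exists d; first exact: d0.
by move=> t /Hd Ut; apply: fg; exact: cart_power_upd.
Qed.

Lemma holB_horner N (Q : 'rV[C]_n -> {poly C}) c :
  (forall z, Un z -> (size (Q z) <= N)%N) -> (forall k, holB (fun z => (Q z)`_k)) ->
  holB (fun z => (Q z).[c]).
Proof.
move=> QN Qh; apply: (@holB_ext (fun z => \sum_(k < N) (Q z)`_k * c ^+ k)).
  by move=> z /QN zN; rewrite (horner_coef_wide _ zN).
by apply: holB_sum => k _; apply: holB_mul; [exact: Qh|exact: holB_cst].
Qed.

(** Neighbourhoods of [(z, c, c)]: a point of the family and the two arguments of a divided
    difference. *)
Definition cubeF z c : set_system ('rV[C]_n * C * C)%type :=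
  filter_from [set d : R | 0 < d] (fun d => [set p | [/\ cube z d p.1.1,
     cabs (p.1.2 - c) < d & cabs (p.2 - c) < d]]).

Lemma cubeF_filter z c : ProperFilter (cubeF z c).
Proof.
apply: filter_from_proper; last first.
  move=> d d0; exists (z, c, c); split; rewrite /= ?subrr ?cabs0 //.
  exact: cube_center.
apply: filter_from_filter; first by exists 1; rewrite /= ltr01.
move=> d e d0 e0; exists (Num.min d e); first by rewrite /= lt_min d0.
move=> p [p1 p2 p3]; split; split.
- by apply: cubeW p1; rewrite ge_min lexx.
- by apply: lt_le_trans p2 _; rewrite ge_min lexx.
- by apply: lt_le_trans p3 _; rewrite ge_min lexx.
- by apply: cubeW p1; rewrite ge_min lexx orbT.
- by apply: lt_le_trans p2 _; rewrite ge_min lexx orbT.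
- by apply: lt_le_trans p3 _; rewrite ge_min lexx orbT.
Qed.

Lemma cubeF_holB f z c : holB f -> Un z -> f p.1.1 @[p --> cubeF z c] --> f z.
Proof.
move=> hf Uz A /nbhs_cabsP[r r0 rA].
have [d d0 H] := holB_continuous oU hf Uz r0.
by exists d => // p [p1 _ _]; apply: rA; exact: H.
Qed.

Lemma cubeF_snd1 z c : p.1.2 @[p --> cubeF z c] --> c.
Proof.
move=> A /nbhs_cabsP[r r0 rA].
by exists r => // p [_ p2 _]; apply: rA.
Qed.

Lemma cubeF_snd2 z c : p.2 @[p --> cubeF z c] --> c.
Proof.
move=> A /nbhs_cabsP[r r0 rA].
by exists r => // p [_ _ p3]; apply: rA.
Qed.

Lemma compact_tube (K : set C) (Q : 'rV[C]_n -> C -> Prop) z : compact K ->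
  (forall t, K t -> exists2 d : R, 0 < d & forall w u, cube z d w -> cabs (u - t) < d -> ~ Q w u) ->
  exists2 d : R, 0 < d & forall w t, cube z d w -> K t -> ~ Q w t.
Proof.
move=> /compact_near_coveringP cK H.
pose F : set_system 'rV[C]_n := filter_from [set d : R | 0 < d] (fun d => [set w | cube z d w]).
have FF : Filter F.
  apply: filter_from_filter; first by exists 1; rewrite /= ltr01.
  move=> d e d0 e0; exists (Num.min d e); first by rewrite /= lt_min d0.
  by move=> p p1; split; apply: cubeW p1; rewrite ge_min lexx ?orbT.
have [d d0 Hd] : F [set w | K `<=` [set t | ~ Q w t]].
  apply: (cK _ F (fun w t => ~ Q w t) FF) => t Kt; have [d d0 Hd] := H t Kt.
  exists ([set u | cabs (u - t) < d], [set w | cube z d w]).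
    by split; [apply/nbhs_cabsP; exists d|exists d].
  by move=> [u w] [/= ut zw]; exact: Hd.
by exists d => // w t zw Kt; exact: (Hd w zw t Kt).
Qed.

Variables (m : nat) (P : 'rV[C]_n -> {poly C}).
Hypothesis Pmonic : forall z, Un z -> P z \is monic.
Hypothesis Psize : forall z, Un z -> size (P z) = m.+1.
Hypothesis Phol : forall k, holB (fun z => (P z)`_k).

Lemma derivn_hol i k : holB (fun z => (P z)^`(i)`_k).
Proof.
rewrite (_ : (fun z => _) = (fun z => (P z)`_(i + k) * ((i + k) ^_ i)%:R)).
  by apply: holB_mul; [exact: Phol|exact: holB_cst].
by apply/funext => z; rewrite coef_derivn mulr_natr.
Qed.

Lemma size_derivn i z : Un z -> (size (P z)^`(i) <= m.+1)%N.
Proof.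
move=> Uz; apply: leq_trans (_ : size (P z) <= _)%N; last by rewrite Psize.
elim: i => [|i IH]; first by rewrite derivn0.
by rewrite derivnS; apply: leq_trans IH; apply: leq_trans (size_poly _ _) (leq_pred _).
Qed.

Lemma derivn_neq0_open i z c : Un z -> (P z)^`(i).[c] != 0 ->
  exists2 d : R, 0 < d & forall w u, cube z d w -> cabs (u - c) < d -> (P w)^`(i).[u] != 0.
Proof.
move=> Uz; rewrite -cabs_gt0 => e0.
have FF := cubeF_filter z c.
have [d1 d10 zU] := open_cube oU Uz.
have sz : cubeF z c [set p | (size (P p.1.1)^`(i) <= m.+1)%N].
  by exists d1 => // p [/zU Up _ _] /=; exact: size_derivn.
have := @horner_cvg R _ (cubeF z c) m.+1 (fun p => (P p.1.1)^`(i)) (P z)^`(i)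
  (fun p => p.1.2) c FF (size_derivn i Uz) sz _ (@cubeF_snd1 z c).
move=> /(_ (fun k _ => cubeF_holB c (derivn_hol i k) Uz)) H.
have [d d0 Hd] := cvg_cabs_lt H e0.
exists d => // w u zw uc.
have := Hd (w, u, u); rewrite /= => /(_ (And3 zw uc uc)).
by apply: contraTneq => ->; rewrite sub0r cabsN ltxx.
Qed.

(** At equal arguments the divided difference is the next derivative. Its staying away from 0 means
    that near [c] the [i]-th derivative has at most one root, uniformly for [w] near [z]. *)
Lemma hpoly_away_open i z c : Un z -> (P z)^`(i.+1).[c] != 0 ->
  exists2 d : R, 0 < d & exists2 eta : R, 0 < eta & forall w t u, cube z d w ->
    cabs (t - c) < d -> cabs (u - c) < d -> eta < cabs (hpoly m.+1 (P w)^`(i) t u).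
Proof.
move=> Uz; rewrite -cabs_gt0 => e0.
have FF := cubeF_filter z c.
have := @hpoly_cvg R _ (cubeF z c) m.+1 (fun p => (P p.1.1)^`(i)) (P z)^`(i)
  (fun p => p.1.2) (fun p => p.2) c c _ _ (@cubeF_snd1 z c) (@cubeF_snd2 z c).
rewrite hpoly_diag ?size_derivn // -derivnS.
move=> /(_ _ (fun k _ => cubeF_holB c (derivn_hol i k) Uz)) H.
have e2 : 0 < cabs (P z)^`(i.+1).[c] / 2 by rewrite divr_gt0.
have [d d0 Hd] := cvg_cabs_lt H e2.
exists d => //; exists (cabs (P z)^`(i.+1).[c] / 2) => // w t u zw tc uc.
have := Hd (w, t, u); rewrite /= => /(_ (And3 zw tc uc)).
have := cabs_distl (P z)^`(i.+1).[c] ((P z)^`(i.+1).[c] - hpoly m.+1 (P w)^`(i) t u).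
rewrite subKr cabsC; lra.
Qed.

(** Multiplicity at least [mu], written with derivatives so that it is a closed condition on the
    pair [(z, c)]. *)
Definition root_order mu z c := forall i, (i < mu)%N -> (P z)^`(i).[c] = 0.

Lemma root_order_closed mu (K : set C) z : compact K -> Un z ->
  (forall t, K t -> ~ root_order mu z t) ->
  exists2 d : R, 0 < d & forall w t, cube z d w -> K t -> ~ root_order mu w t.
Proof.
move=> cK Uz H; apply: compact_tube => // t /H /existsNP[i /not_implyP[imu /eqP /(derivn_neq0_open Uz)]].
move=> [d d0 Hd]; exists d => // w u zw ut /(_ i imu) /eqP.
by apply/negP; exact: Hd.
Qed.

Lemma root_order_max z c : Un z -> ~ root_order m.+1 z c.
Proof.
move=> Uz /(_ m (ltnSn m)).
have lead1 : (P z)`_m = 1 by have := monicP (Pmonic Uz); rewrite /lead_coef Psize.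
have -> : (P z)^`(m) = (m`!%:R)%:P.
  apply/polyP => i; rewrite coef_derivn coefC; case: i => [|i].
    by rewrite addn0 ffactnn lead1.
  by rewrite nth_default ?mul0rn // Psize // addnS ltnS leq_addr.
by rewrite hornerC => /eqP; rewrite pnatr_eq0 eqn0Ngt fact_gt0.
Qed.

Variable E : set C.
Hypothesis cE : compact E.
Hypothesis thinE : forall v e, 0 < e -> exists2 v', ~ E v' & cabs (v' - v) < e.

(* [g] selects the unique root of the [mu]-th derivative near [c0]; it is
   separately holomorphic because this root is simple. *)
Lemma branch_constant c0 (d eta : R) mu (g : 'rV[C]_n -> C) z0 d0 (M : R) :
  0 < d0 -> 0 < eta ->
  (forall w, cube z0 d0 w -> Un w) ->
  (forall w, cube z0 d0 w -> [/\ E (g w), cabs (g w) <= M, cabs (g w - c0) < d & root (P w)^`(mu) (g w)]) ->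
  (forall w t u, cube z0 d0 w -> cabs (t - c0) < d -> cabs (u - c0) < d ->
     eta < cabs (hpoly m.+1 (P w)^`(mu) t u)) ->
  forall w, cube z0 (d0 / 4) w -> g w = g z0.
Proof.
move=> d00 eta0 sub Hg Heta.
have qN w : cube z0 d0 w -> (size (P w)^`(mu) <= m.+1)%N.
  by move=> /sub; exact: size_derivn.
have slice_cont w i : cube z0 d0 w ->
    {for (w ord0 i), continuous (fun t => g (upd w i t))}.
  move=> zw; apply/continuous_cabsP => e e0; rewrite upd_id.
  have [d1 d10 Hd1] := cube_open zw.
  have inc t : cabs (t - w ord0 i) < d1 -> cube z0 d0 (upd w i t).
    by move=> tw; apply: Hd1; apply: cube_upd => //; exact: cube_center.
  have ee : 0 < eta * e by rewrite mulr_gt0.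
  have FF := nbhs_filter (w ord0 i).
  (* The moving polynomial is evaluated at the old root [g w]. Since its divided differences exceed
     [eta], the root moves by at most that value divided by [eta]. *)
  have cq : (P (upd w i t))^`(mu).[g w] @[t --> w ord0 i] --> (P w)^`(mu).[g w].
    apply: (@horner_cvg R C (nbhs (w ord0 i)) m.+1 (fun t => (P (upd w i t))^`(mu)) _ (fun=> g w)).
    - exact: qN.
    - by apply/nbhs_cabsP; exists d1 => // t /inc /qN.
    - move=> k _; have /cderiv_continuous := (derivn_hol mu k).2 w i (sub w zw).
      by rewrite /prop_for /continuous_at upd_id.
    - exact: cvg_cst.
  have /nbhs_cabsP[d2 d20 Hd2] := cvg_cabs_lt cq ee.
  exists (Num.min d1 d2) => [|t]; first by rewrite lt_min d10.
  rewrite lt_min => /andP[t1 t2].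
  have zt := inc t t1.
  have [_ _ gt rt] := Hg _ zt; have [_ _ gw rw] := Hg _ zw.
  have := Hd2 t t2; rewrite /= (eqP rw) subr0 => Hq.
  have := hpolyE (g (upd w i t)) (g w) (qN _ zt); rewrite (eqP rt) sub0r => Eq.
  have : eta * cabs (g (upd w i t) - g w) <= cabs (P (upd w i t))^`(mu).[g w].
    rewrite -[X in _ <= X]cabsN Eq cabsM mulrC; apply: ler_wpM2l; first exact: cabs_ge0.
    by apply: ltW; apply: Heta.
  by move=> /le_lt_trans /(_ Hq); rewrite ltr_pM2l.
have slice_diff w i : cube z0 d0 w -> differentiable (fun t => g (upd w i t)) (w ord0 i).
  move=> zw; have [d1 d10 Hd1] := cube_open zw.
  have inc t : cabs (t - w ord0 i) < d1 -> cube z0 d0 (upd w i t).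
    by move=> tw; apply: Hd1; apply: cube_upd => //; exact: cube_center.
  apply: (@differentiable_root R m.+1 (fun t => (P (upd w i t))^`(mu)) _ _ d1).
  - exact: d10.
  - by move=> t /inc /qN.
  - by move=> k _; exact: (derivn_hol mu k).2 w i (sub w zw).
  - exact: slice_cont.
  - by move=> t /inc /Hg[].
  rewrite upd_id; have [_ _ gw _] := Hg _ zw.
  by rewrite -cabs_gt0; apply: lt_trans eta0 (Heta _ _ _ zw gw gw).
move=> w zw; apply/eqP; rewrite -subr_eq0 -cabs_eq0 eq_le cabs_ge0 andbT.
have d4 : 0 < d0 / 4 by rewrite divr_gt0.
rewrite -(mulr0 n%:R); apply: (coordinatewise_bound (lexx 0) d4) zw.
move=> {}w i zw; rewrite -{1}(upd_id w i).
have zw' : cube z0 d0 w by apply: cubeW zw; rewrite ler_pdivrMr // ler_pMr //; lra.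
have inc t : cabs (t - z0 ord0 i) < d0 -> cube z0 d0 (upd w i t).
  by move=> tz; exact: cube_upd.
rewrite (@deriv0_constant R (fun t => g (upd w i t)) (z0 ord0 i) d0 M d00 _ (w ord0 i)).
- by rewrite subrr cabs0.
- move=> t tz; have zt := inc t tz; split; last by have [] := Hg _ zt.
  have := slice_diff _ i zt; rewrite upd_slice upd_same => /[dup] /differentiable_cderivP[l Hl] dt.
  rewrite -(_ : l = 0) //.
  have tz0 : 0 < d0 - cabs (t - z0 ord0 i) by rewrite subr_gt0.
  apply: (deriv_eq0_of_thin_image tz0 thinE _ Hl) => u ut.
  have uz : cabs (u - z0 ord0 i) < d0 by have := cabs_dist3 u (z0 ord0 i) t; lra.
  have zu := inc u uz; split; last by have [] := Hg _ zu.
  by have := slice_diff _ i zu; rewrite upd_slice upd_same.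
exact: ltW (zw i).
Qed.

Lemma compact_relclosed (K B : set C) : compact K ->
  (forall p, K p -> ~ B p -> exists2 d : R, 0 < d & forall t, cabs (t - p) < d -> ~ B t) ->
  compact (K `&` B).
Proof.
rewrite compact_ultra => cK H F FU FKB.
have FK : F K by apply: filterS FKB => t [].
have [p [Kp Fp]] := cK F FU FK; exists p; split => //; split => //.
apply: contrapT => /(H p Kp)[d d0 Hd].
have : F [set t | cabs (t - p) < d] by apply: Fp; apply/nbhs_cabsP; exists d.
by move=> /(filterI FKB) /filter_ex[t [[_ Bt]]] /= /Hd.
Qed.

(* Take [mu] maximal such that, on some cube, all the polynomials have a root of
   order at least [mu] in [E].  In a smaller cube no root in [E] has order
   [mu + 1], so that the roots of order [mu] are simple roots of the derivative
   of order [mu - 1]; there are finitely many branches of these, and one of them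
   stays in [E] on a whole cube. *)
Theorem common_boundary_root z0 : Un z0 ->
  (forall z, Un z -> exists2 c, E c & root (P z) c) ->
  exists2 c, E c & forall z, Un z -> root (P z) c.
Proof.
move=> Uz0 Hroot.
pose big mu := exists z d, [/\ 0 < d, forall w, cube z d w -> Un w &
   forall w, cube z d w -> exists2 c, E c & root_order mu w c].
have big1 : big 1%N.
  have [d d0 zU] := open_cube oU Uz0; exists z0, d; split => // w /zU /Hroot[c Ec rc].
  by exists c => // -[|//] _; rewrite derivn0; apply/eqP.
have nbig : ~ big m.+1.
  move=> [z [d [d0 sub /(_ z (cube_center z d0))[c _]]]].
  by apply: root_order_max; apply: sub; exact: cube_center.
(* From here on the maximal order is [mu.+1], so the derivative having simple roots is the one of
   order [mu]. *)
have [mu [[z [d [d0 sub Hz]]] nbig']] : exists mu, big mu.+1 /\ ~ big mu.+2.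
  apply: contrapT => H; apply: nbig.
  elim: m => [//|k IH]; apply: contrapT => nk; apply: H; exists k; split => //.
have [z1 [zz1 Hz1]] : exists z1, cube z d z1 /\ forall c, E c -> ~ root_order mu.+2 z1 c.
  apply: contrapT => H; apply: nbig'; exists z, d; split => // w zw.
  apply: contrapT => nw; apply: H; exists w; split => // c Ec rc.
  by apply: nw; exists c.
have Uz1 := sub _ zz1.
have [rs rsE] := closed_field_poly_normal (P z1).
pose s := [seq c <- rs | `[< E c /\ root_order mu.+1 z1 c >]].
have sP c : c \in s <-> E c /\ root_order mu.+1 z1 c.
  rewrite mem_filter; split=> [/andP[/asboolP //]|[Ec rc]].
  apply/andP; split; first exact/asboolP.
  have := rc 0%N (ltn0Sn _); rewrite derivn0 => /eqP; rewrite -/(root _ _) rsE.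
  by rewrite (monicP (Pmonic Uz1)) scale1r root_prod_XsubC.
have [|dl Hdl] := @boolp.choice C (R * R)%type (fun c p => c \in s ->
    [/\ 0 < p.1, 0 < p.2 & forall w t u, cube z1 p.1 w -> cabs (t - c) < p.1 ->
      cabs (u - c) < p.1 -> p.2 < cabs (hpoly m.+1 (P w)^`(mu) t u)]).
  move=> c; have [/sP[Ec rc]|cs] := boolP (c \in s); last by exists (0, 0).
  have [|dc dc0 [eta eta0 Hc]] := @hpoly_away_open mu z1 c Uz1.
    apply/eqP => r0; apply: (Hz1 c Ec) => i; rewrite ltnS leq_eqVlt => /predU1P[->//|].
    exact: rc.
  by exists (dc, eta).
(* Closed discs for [near] and the complement of the open discs for [far]: both have compact
   intersection with [E], and together they cover the plane when [c] runs through [s]. *)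
pose near c t := cabs (t - c) <= (dl c).1 / 2.
pose far : set C := [set t | forall c, c \in s -> ~ cabs (t - c) < (dl c).1 / 2].
have cfar : compact (E `&` far).
  apply: compact_relclosed => // p Ep /existsNP[c /not_implyP[cs /contrapT pc]].
  exists ((dl c).1 / 2 - cabs (p - c)) => [|t tp far_t]; first by rewrite subr_gt0.
  by apply: (far_t c cs); have := cabs_dist3 t c p; lra.
have [d1 d10 Hfar] : exists2 d : R, 0 < d &
    forall w t, cube z1 d w -> (E `&` far) t -> ~ root_order mu.+1 w t.
  apply: root_order_closed => // t [Et ft] rt.
  have ts : t \in s by apply/sP.
  apply: (ft t ts); rewrite subrr cabs0 divr_gt0 //.
  by have [] := Hdl t ts.
have [d2 d20 Hd2] := cube_open zz1.
have [d3 d30 Hd3] : exists2 e : R, 0 < e & forall c, c \in s -> e <= (dl c).1.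
  have [|e e0 He] := @finite_pos_lb R (seq_sub s) (fun k => (dl (ssval k)).1).
    by move=> [c cs] /=; have [] := Hdl c cs.
  by exists e => // c cs; exact: (He (SeqSub cs)).
pose d4 := Num.min d1 (Num.min d2 d3).
have d40 : 0 < d4 by rewrite !lt_min d10 d20.
have [le1 [le2 le3]] : d4 <= d1 /\ d4 <= d2 /\ d4 <= d3.
  by split; [|split]; rewrite /d4 !ge_min lexx ?orbT.
(* A closed condition on [w], because [t] ranges over a compact set; [closed_cover] then selects one
   [c] valid on a whole cube. *)
pose Cl c w := exists t, [/\ E t, near c t & root_order mu.+1 w t].
have Clcl c w : c \in s -> cube z1 d4 w -> ~ Cl c w ->
    exists2 e : R, 0 < e & forall w', cube w e w' -> ~ Cl c w'.
  move=> cs zw nC.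
  have Uw : Un w by apply/sub/Hd2; exact: cubeW zw.
  have cEn : compact (E `&` near c).
    apply: compact_relclosed => // p Ep /negP; rewrite -ltNge => pc.
    exists (cabs (p - c) - (dl c).1 / 2) => [|t tp]; first by rewrite subr_gt0.
    apply/negP; rewrite -ltNge; have := cabs_dist3 p c t.
    by rewrite [cabs (p - t)]cabsC; lra.
  have [|e e0 He] := @root_order_closed mu.+1 _ w cEn Uw.
    by move=> t [Et nt] rt; apply: nC; exists t.
  by exists e => // w' ww' [t [Et nt rt]]; exact: (He w' t ww' (conj Et nt)).
have Clcov w : cube z1 d4 w -> exists2 c, c \in s & Cl c w.
  move=> zw; have [t Et rt] := Hz w (Hd2 _ (cubeW le2 zw)).
  have nft : ~ far t by move=> ft; exact: (Hfar w t (cubeW le1 zw) (conj Et ft)).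
  move/existsNP: nft => [c /not_implyP[cs /contrapT tc]].
  by exists c => //; exists t; split => //; exact: ltW.
have [c [z2 [d5 [cs d50 sub5 H5]]]] := closed_cover d40 Clcl Clcov.
have [dlc0 etac0 Hc] := Hdl c cs.
have [|g Hg] := @boolp.choice 'rV[C]_n C (fun w t => cube z2 d5 w ->
    [/\ E t, near c t & root_order mu.+1 w t]).
  move=> w; have [zw|nzw] := pselect (cube z2 d5 w); last by exists 0.
  by have [t Ht] := H5 w zw; exists t.
have sub2 w : cube z2 d5 w -> Un w.
  by move=> zw; apply/sub/Hd2; exact: cubeW le2 (sub5 _ zw).
have const := @branch_constant c (dl c).1 (dl c).2 mu g z2 d5 (cabs c + (dl c).1) d50 etac0 sub2.
have z2c := cube_center z2 d50.
have [Eg _ _] := Hg z2 z2c.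
exists (g z2) => // z' Uz'; apply/eqP.
have d54 : 0 < d5 / 4 by rewrite divr_gt0.
have hP : holB (fun z => (P z).[g z2]).
  by apply: (@holB_horner m.+1) => [z0' /Psize ->|k]; [|exact: Phol].
apply: (@holB_identity R n U oU (fun z => (P z).[g z2]) z2 (d5 / 4)) => //.
  exact: sub2.
move=> w Uw zw; have zw5 : cube z2 d5 w.
  by apply: cubeW zw; rewrite ler_pdivrMr // ler_pMr //; lra.
rewrite -(const _ _ w zw) ; first by have [_ _ /(_ 0%N (ltn0Sn _))] := Hg w zw5.
  move=> w' zw'; have [Ew nw rw] := Hg w' zw'.
  rewrite /near in nw; have gc : cabs (g w' - c) < (dl c).1 by lra.
  split => //; last by apply/eqP; exact: rw.
  by have := cabs_distl (g w') c; lra.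
move=> w' t u zw' tc uc; apply: Hc => //; apply: cubeW (sub5 _ zw').
exact: le_trans le3 (Hd3 c cs).
Qed.
End CommonBoundaryRoot.

(** * Resultants of monic polynomials *)

Section Sylvester.
Variable K : closedFieldType.
Implicit Types (p q : {poly K}).

(** The Sylvester matrix of two polynomials of degree [m], with the coefficients in rows. Its size
    depends on [m] alone, so its determinant is a fixed polynomial in the coefficients. *)
Definition sylvester m p q : 'M[K]_(m + m) :=
  col_mx (\matrix_(i < m, j < m + m) (p * 'X^i)`_j) (\matrix_(i < m, j < m + m) (q * 'X^i)`_j).

(** The vector of the powers of [c] is in the kernel. *)
Lemma sylvester_common_root m p q c : (0 < m)%N -> size p = m.+1 -> size q = m.+1 ->
  root p c -> root q c -> \det (sylvester m p q) = 0.
Proof.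
move=> m0 sp sq /eqP pc /eqP qc; rewrite -det_tr; apply/eqP/det0P.
exists (\row_j c ^+ j).
  apply/eqP => /rowP /(_ (Ordinal (ltn_addr m m0))); rewrite !mxE expr0.
  by move=> /eqP; rewrite oner_eq0.
have rowE (r : {poly K}) (i : 'I_m) : size r = m.+1 -> r.[c] = 0 ->
    \sum_(j < m + m) c ^+ j * (r * 'X^i)`_j = 0.
  move=> sr rc; transitivity (r * 'X^i).[c]; last by rewrite hornerM rc mul0r.
  rewrite (@horner_coef_wide _ (m + m)); first by apply: eq_bigr => j _; rewrite mulrC.
  apply: leq_trans (size_polyMleq _ _) _; rewrite sr size_polyXn addnS /= addSn.
  by rewrite -addnS leq_add2l.
rewrite /sylvester tr_col_mx mul_mx_row; apply/rowP => j; rewrite mxE [RHS]mxE.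
case: splitP => k _; rewrite mxE.
  by rewrite -[RHS](rowE p k sp pc); apply: eq_bigr => l _; rewrite !mxE.
by rewrite -[RHS](rowE q k sq qc); apply: eq_bigr => l _; rewrite !mxE.
Qed.

Lemma rVpoly_sum m (u : 'rV[K]_m) : rVpoly u = \sum_(i < m) u ord0 i *: 'X^i.
Proof. by rewrite /rVpoly poly_def; apply: eq_bigr => i _; rewrite valK. Qed.

(** A vector in the left kernel encodes [a] and [b] of degree less than [m], not both zero, with
    [a * p + b * q = 0]. If [p] and [q] were coprime, [p] would divide [b], forcing [b = 0] and then
    [a = 0]. *)
Lemma sylvester_det0 m p q : (0 < m)%N -> size p = m.+1 -> size q = m.+1 ->
  \det (sylvester m p q) = 0 -> exists c, root p c && root q c.
Proof.
move=> m0 sp sq /eqP/det0P[v v0 vS].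
pose a := rVpoly (lsubmx v); pose b := rVpoly (rsubmx v).
have ab : a * p + b * q = 0.
  apply/polyP => k; rewrite coef0; have [km|mk] := ltnP k (m + m); last first.
    rewrite nth_default // (leq_trans (size_polyD _ _)) // geq_max.
    have bound (r : {poly K}) (u : 'rV[K]_m) : size r = m.+1 -> (size (rVpoly u * r)%R <= k)%N.
      move=> sr; apply: leq_trans (size_polyMleq _ _) _; rewrite sr addnS /=.
      by apply: leq_trans mk; rewrite leq_add2r; exact: size_poly.
    by rewrite !bound.
  have /rowP /(_ (Ordinal km)) := vS.
  rewrite -[v in v *m _]hsubmxK mul_row_col !mxE => vk; apply: etrans vk.
  rewrite coefD; congr (_ + _).
    rewrite /a rVpoly_sum mulr_suml coef_sum; apply: eq_bigr => i _.
    by rewrite [X in _ = _ * X]mxE -scalerAl coefZ ['X^_ * p]mulrC.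
  rewrite /b rVpoly_sum mulr_suml coef_sum; apply: eq_bigr => i _.
  by rewrite [X in _ = _ * X]mxE -scalerAl coefZ ['X^_ * q]mulrC.
have [cpq|] := boolP (coprimep p q); last first.
  rewrite /coprimep => gcd1; have /closed_rootP[c] : size (gcdp p q) != 1%N by [].
  by rewrite root_gcd => pqc; exists c.
have p0 : p != 0 by rewrite -size_poly_eq0 sp.
have pb : p %| b.
  rewrite -(Gauss_dvdpl _ cpq); have -> : b * q = - a * p by rewrite mulNr; apply/eqP; rewrite -addr_eq0 addrC ab.
  exact: dvdp_mulIr.
have b0 : b = 0.
  apply/eqP; apply: contraLR pb => b0; rewrite gtNdvdp // sp ltnS; exact: size_poly.
have a0 : a = 0.
  by move: ab => /eqP; rewrite b0 mul0r addr0 mulf_eq0 (negPf p0) orbF => /eqP.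
case/eqP: v0; rewrite -[v]hsubmxK.
by rewrite -(rVpolyK (lsubmx v)) -(rVpolyK (rsubmx v)) -/a -/b a0 b0 !linear0 row_mx0.
Qed.

End Sylvester.

(** * Determinants depending on a parameter, and roots near small values *)

Section Determinant.
Variable R : realType.
Local Notation C := R[i].

Lemma differentiable_mulC (f g : C -> C) a : differentiable f a -> differentiable g a ->
  differentiable (fun z => f z * g z) a.
Proof. by move=> df dg; exact: (@differentiableM C C f g a df dg). Qed.

Lemma differentiable_sumC (J : Type) (r : seq J) (f : J -> C -> C) a :
  (forall j, differentiable (f j) a) -> differentiable (fun z => \sum_(j <- r) f j z) a.
Proof.
move=> df; elim: r => [|j r IH].
  rewrite (_ : (fun z => _) = (fun=> 0)); first exact: differentiable_cst.
  by apply/funext => s; rewrite big_nil.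
rewrite (_ : (fun z => _) = (fun z => f j z + \sum_(k <- r) f k z)).
  exact: (@differentiableD C C C (f j) (fun z => \sum_(k <- r) f k z) a (df j) IH).
by apply/funext => s; rewrite big_cons.
Qed.

Lemma differentiable_prodC (J : Type) (r : seq J) (f : J -> C -> C) a :
  (forall j, differentiable (f j) a) -> differentiable (fun z => \prod_(j <- r) f j z) a.
Proof.
move=> df; elim: r => [|j r IH].
  rewrite (_ : (fun z => _) = (fun=> 1)); first exact: differentiable_cst.
  by apply/funext => s; rewrite big_nil.
rewrite (_ : (fun z => _) = (fun z => f j z * \prod_(k <- r) f k z)).
  exact: (differentiable_mulC (df j) IH).
by apply/funext => s; rewrite big_cons.
Qed.

Lemma differentiable_det N (M : C -> 'M[C]_N) a :
  (forall i j, differentiable (fun z => M z i j) a) ->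
  differentiable (fun z => \det (M z)) a.
Proof.
move=> dM; rewrite /determinant.
apply: (@differentiable_sumC _ _ (fun (s : {perm 'I_N}) z => (-1) ^+ s * \prod_i M z i (s i))) => s.
apply: differentiable_mulC; first exact: differentiable_cst.
exact: (@differentiable_prodC _ _ (fun (i : 'I_N) z => M z i (s i))).
Qed.

Lemma cvg_det (T : Type) (F : set_system T) N (M : T -> 'M[C]_N) (A : 'M[C]_N) : Filter F ->
  (forall i j, M s i j @[s --> F] --> A i j) -> \det (M s) @[s --> F] --> \det A.
Proof.
move=> FF cM; rewrite /determinant.
apply: (@cvg_sumC _ T _ F _ (fun (s : {perm 'I_N}) z => (-1) ^+ s * \prod_i M z i (s i))
  (fun s => (-1) ^+ s * \prod_i A i (s i)) FF) => s.
apply: (@cvg_mulC _ T F (fun=> (-1) ^+ s) (fun z => \prod_i M z i (s i)) _ _ FF); first exact: cvg_cst.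
exact: (@cvg_prodC _ T _ F _ (fun (i : 'I_N) z => M z i (s i)) (fun i => A i (s i)) FF).
Qed.

Lemma sylvester_entry m (p q : {poly C}) (i j : 'I_(m + m)) :
  sylvester m p q i j = match fintype.split i with
    | inl k => if (j < k)%N then 0 else p`_(j - k)
    | inr k => if (j < k)%N then 0 else q`_(j - k) end.
Proof. by rewrite /sylvester mxE; case: splitP => k _; rewrite mxE coefMXn. Qed.

Lemma differentiable_sylvester m (p q : C -> {poly C}) a :
  (forall k, differentiable (fun z => (p z)`_k) a) ->
  (forall k, differentiable (fun z => (q z)`_k) a) ->
  differentiable (fun z => \det (sylvester m (p z) (q z))) a.
Proof.
move=> dp dq; apply: differentiable_det => i j.
rewrite (_ : (fun z => _) = (fun z => match fintype.split i with
    | inl k => if (j < k)%N then 0 else (p z)`_(j - k)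
    | inr k => if (j < k)%N then 0 else (q z)`_(j - k) end)).
  by case: (fintype.split i) => k; case: (j < k)%N; first [exact: differentiable_cst|exact: dp|exact: dq].
by apply/funext => z; rewrite sylvester_entry.
Qed.

Lemma cvg_sylvester (T : Type) (F : set_system T) m (p q : T -> {poly C}) (p0 q0 : {poly C}) :
  Filter F -> (forall k, (p s)`_k @[s --> F] --> p0`_k) ->
  (forall k, (q s)`_k @[s --> F] --> q0`_k) ->
  \det (sylvester m (p s) (q s)) @[s --> F] --> \det (sylvester m p0 q0).
Proof.
move=> FF cp cq; apply: cvg_det => i j.
rewrite sylvester_entry (_ : (fun s => _) = (fun s => match fintype.split i with
    | inl k => if (j < k)%N then 0 else (p s)`_(j - k)
    | inr k => if (j < k)%N then 0 else (q s)`_(j - k) end)).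
  case: (fintype.split i) => k; case: (j < k)%N.
  - exact: cvg_cst.
  - exact: cp.
  - exact: cvg_cst.
  - exact: cq.
by apply/funext => z; rewrite sylvester_entry.
Qed.

Lemma monic_prod_roots (p : {poly C}) m : p \is monic -> size p = m.+1 ->
  exists2 rs : seq C, size rs = m & p = \prod_(r <- rs) ('X - r%:P).
Proof.
move=> pm ps; have [rs] := closed_field_poly_normal p.
rewrite (monicP pm) scale1r => pE; exists rs => //.
by move: ps; rewrite pE size_prod_XsubC => -[].
Qed.

(** The modulus of the value is the product of the [m] distances from [t] to the roots. *)
Lemma small_value_near_root (p : {poly C}) m t (e : R) : p \is monic -> size p = m.+1 ->
  0 < e -> cabs p.[t] < e ^+ m -> exists2 r, root p r & cabs (t - r) < e.
Proof.
move=> pm ps e0; have [rs rsm ->] := monic_prod_roots pm ps; rewrite -{}rsm => H.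
apply: contrapT => nr; move: H; apply/negP; rewrite -leNgt horner_prod cabs_prod.
have {}nr r : r \in rs -> e <= cabs (t - r).
  by move=> rrs; rewrite leNgt; apply/negP => tr; apply: nr; exists r; rewrite // root_prod_XsubC.
elim: rs nr => [|r rs IH] nr; first by rewrite big_nil expr0.
rewrite big_cons /= exprS hornerXsubC; apply: ler_pM; rewrite ?exprn_ge0 ?(ltW e0) //.
  by apply: nr; rewrite mem_head.
by apply: IH => r' rr'; apply: nr; rewrite inE rr' orbT.
Qed.

End Determinant.

(** * Proper families of polynomials *)

Section ProperFamilies.
Variables (R : realType) (n : nat) (U V : set R[i]) (MV : R) (x0 : R[i]).
Local Notation C := R[i].
Hypotheses (oU : open U) (cU : connected U) (Ux0 : U x0).
Hypotheses (oV : open V) (bV : forall t, V t -> cabs t <= MV).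
Local Notation Un := (cart_power n U).
Local Notation holB := (holB U).
Implicit Types (A : {set 'I_n}) (P Q G : 'rV[C]_n -> {poly C}) (z w : 'rV[C]_n) (t u c x : C).

(* [A] is the set of the coordinates on which [P] really depends: freezing a
   coordinate removes it from [A], but the points keep [n] coordinates. *)
Definition proper_family A m P : Prop :=
  [/\ forall z, Un z -> P z \is monic /\ size (P z) = m.+1,
      forall k, holB (fun z => (P z)`_k),
      forall z t, Un z -> root (P z) t -> V t &
      forall K : set C, compact K -> K `<=` V -> exists2 L : set C, compact L /\ L `<=` U &
        forall z, Un z -> (forall t, root (P z) t -> K t) -> forall i, i \in A -> L (z ord0 i)].

Let bdV : set C := closure V `&` ~` V.

Lemma compact_bdV : compact bdV.
Proof.
apply: (@subclosed_compact _ _ [set w : C | cabs (w - 0) <= MV]).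
- by apply: closedI; [exact: closed_closure|exact: open_closedC].
- exact: closed_disc_compact.
move=> t [/closure_cabsP Vt _] /=; rewrite subr0; apply/ler_addgt0Pr => e e0.
have [w Vw wt] := Vt e e0; have := bV Vw; have := cabs_distl t (t - w).
by rewrite subKr cabsC; have := cabs_distl t w; rewrite [cabs (t - w)]cabsC; lra.
Qed.

Lemma thin_bdV v (e : R) : 0 < e -> exists2 v', ~ bdV v' & cabs (v' - v) < e.
Proof.
move=> e0; have [[/closure_cabsP clv _]|nv] := pselect (bdV v); last first.
  by exists v; rewrite ?subrr ?cabs0.
by have [w Vw wv] := clv e e0; exists w => // -[_].
Qed.

Lemma row_const x : U x -> Un (const_mx x).
Proof. by move=> Ux i; rewrite mxE. Qed.

Lemma coef_monic_high m (p : {poly C}) k : p \is monic -> size p = m.+1 -> (m <= k)%N ->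
  p`_k = (k == m)%:R.
Proof.
move=> pm ps; rewrite leq_eqVlt => /predU1P[<-|mk].
  by have := monicP pm; rewrite /lead_coef ps eqxx.
by rewrite nth_default ?ps // gtn_eqF.
Qed.

(** Limits of roots lie in the closure of [V]. If all roots of some [G z] were in [V], small closed
    discs around them would form a compact [K] in [V] containing the roots of [P (upd z i x)] for
    [F]-most [x]; properness would put these [x] in a compact part of [U], where [F] would
    converge. *)
Lemma boundary_limit A m P i (F : set_system C) : proper_family A m P -> i \in A ->
  UltraFilter F -> F U -> (forall p, U p -> ~ (F --> p)) ->
  exists G, [/\ forall z, Un z -> G z \is monic /\ size (G z) = m.+1,
    forall z k, Un z -> (P (upd z i x))`_k @[x --> F] --> (G z)`_k &
    exists2 c, bdV c & forall z, Un z -> root (G z) c].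
Proof.
move=> [Pms Ph PV Pp] iA FU FUU Fesc.
have FF : Filter F by exact: filter_filter.
have [|g Hg] := @boolp.choice nat ('rV[C]_n -> C) (fun k g => holB g /\
    forall z, Un z -> (P (upd z i x))`_k @[x --> F] --> g z).
  move=> k; have [[M HM] dP] := Ph k.
  have [||gk g1 g2] := @holB_ultralimit R n U oU C F U (fun x z => (P (upd z i x))`_k) M FU FUU.
  - by move=> x z Ux Uz; apply: HM; exact: cart_power_upd.
  - move=> x z j Ux Uz.
    exact: (holB_freeze i (Ph k) Ux).2 z j Uz.
  by exists gk.
(* The leading term is put in by hand, so that [G z] is monic of degree [m] for every [z], whereas
   [g k] is controlled only on [Un]. *)
pose G z : {poly C} := 'X^m + \poly_(k < m) g k z.
have sG z : (size (\poly_(k < m) g k z)%R <= m)%N by exact: size_poly.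
have Gms z : G z \is monic /\ size (G z) = m.+1.
  have sz : size (G z) = m.+1 by rewrite size_polyDl ?size_polyXn // ltnS.
  split => //; apply/monicP; rewrite lead_coefDl ?size_polyXn ?ltnS //.
  exact: lead_coefXn.
have GP z k : Un z -> (P (upd z i x))`_k @[x --> F] --> (G z)`_k.
  move=> Uz; have [km|mk] := ltnP k m.
    rewrite /G coefD coefXn coef_poly km (ltn_eqF km) add0r; exact: (Hg k).2.
  rewrite (coef_monic_high (Gms z).1 (Gms z).2 mk).
  apply: (@cvg_trans _ ((k == m)%:R @[x --> F])); last exact: cvg_cst.
  apply: near_eq_cvg; apply: filterS FUU => x Ux.
  have [pm ps] := Pms _ (cart_power_upd i Uz Ux).
  by rewrite (coef_monic_high pm ps mk).
exists G; split => //.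
have Gh k : holB (fun z => (G z)`_k).
  have [km|mk] := ltnP k m.
    rewrite (_ : (fun z => _) = g k); first exact: (Hg k).1.
    by apply/funext => z; rewrite /G coefD coefXn coef_poly km (ltn_eqF km) add0r.
  rewrite (_ : (fun z => _) = (fun=> (k == m)%:R)); first exact: holB_cst.
  by apply/funext => z; rewrite (coef_monic_high (Gms z).1 (Gms z).2 mk).
apply: (common_boundary_root oU cU (fun z _ => (Gms z).1) (fun z _ => (Gms z).2) Gh
  compact_bdV thin_bdV (row_const Ux0)) => z Uz.
have Uzx x : U x -> Un (upd z i x) by move=> Ux; exact: cart_power_upd.
have value t : (P (upd z i x)).[t] @[x --> F] --> (G z).[t].
  apply: (@horner_cvg R C F m.+1 (fun x => P (upd z i x)) (G z) (fun=> t) t _).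
  - by rewrite (Gms z).2.
  - by apply: filterS FUU => x /Uzx /Pms[_ E]; rewrite /= E.
  - by move=> k _; exact: GP.
  - exact: cvg_cst.
have cl c : root (G z) c -> closure V c.
  move=> Gc; apply/closure_cabsP => e e0.
  have em : 0 < e ^+ m by rewrite exprn_gt0.
  have [x [Ux]] := filter_ex (filterI FUU (cvg_cabs_lt (value c) em)).
  rewrite /= (eqP Gc) subr0 => Px; have [pm ps] := Pms _ (Uzx x Ux).
  have [r Pr cr] := small_value_near_root pm ps e0 Px.
  by exists r; [exact: PV (Uzx x Ux) Pr|rewrite cabsC].
apply: contrapT => nroot.
have inV c : root (G z) c -> V c.
  by move=> Gc; apply: contrapT => nVc; apply: nroot; exists c => //; split => //; exact: cl.
have [rs rsm GE] := monic_prod_roots (Gms z).1 (Gms z).2.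
have rsV r : r \in rs -> V r.
  by move=> rrs; apply: inV; rewrite GE root_prod_XsubC.
have [e e0 He] : exists2 e : R, 0 < e & forall r, r \in rs -> forall t, cabs (t - r) <= e -> V t.
  elim: (rs) rsV => [|r rs' IH] rsV; first by exists 1.
  have [|e e0 He] := IH; first by move=> r' rr'; apply: rsV; rewrite inE rr' orbT.
  have [d d0 Hd] := open_disc oV (rsV r (mem_head _ _)).
  exists (Num.min e (d / 2)) => [|r']; first by rewrite lt_min e0 divr_gt0.
  rewrite inE => /predU1P[->|rr'] t; rewrite le_min => /andP[te td].
    by apply: Hd; lra.
  exact: He te.
pose K : set C := [set t | exists2 r, r \in rs & cabs (t - r) <= e].
have cK : compact K.
  rewrite /K; elim: (rs) => [|r rs' IH].
    rewrite (_ : [set t | _] = set0); first exact: compact0.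
    by apply/seteqP; split => t // -[].
  rewrite (_ : [set t | _] = [set t | cabs (t - r) <= e] `|`
     [set t | exists2 r, r \in rs' & cabs (t - r) <= e]).
    by apply: compactU => //; exact: closed_disc_compact.
  apply/seteqP; split => t.
    by move=> [r']; rewrite inE => /predU1P[->|rr'] tr; [left|right; exists r'].
  move=> [tr|[r' rr' tr]]; first by exists r => //; exact: mem_head.
  by exists r' => //; rewrite inE rr' orbT.
have KV : K `<=` V by move=> t [r rrs tr]; exact: He tr.
have [L [cL LU] HL] := Pp K cK KV.
have em : 0 < e ^+ m by rewrite exprn_gt0.
(* At a root [t] of [P (upd z i x)] one has [cabs t <= MV]; coefficients closer than
   [e ^+ m / (S + 1)] thus make [(G z).[t]] smaller than [e ^+ m], and [t] is within [e] of a root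
   of [G z]. *)
pose S := \sum_(k < m.+1) `|MV| ^+ k.
have S0 : 0 <= S by apply: sumr_ge0 => k _; exact: exprn_ge0.
have S1 : 0 < S + 1 by rewrite ltr_wpDl.
have eta0 : 0 < e ^+ m / (S + 1) by rewrite divr_gt0.
have Fclose : F [set x | forall k : 'I_m.+1,
    cabs ((P (upd z i x))`_k - (G z)`_k) < e ^+ m / (S + 1)].
  by apply: filter_forall => k; exact: (cvg_cabs_lt (GP z k Uz) eta0).
have FL : F L.
  apply: filterS (filterI FUU Fclose) => x [Ux close].
  have := HL _ (Uzx x Ux) _ i iA; rewrite upd_same; apply => t Pt.
  have tM := bV (PV _ _ (Uzx x Ux) Pt).
  have : cabs (G z).[t] < e ^+ m.
    have [_ ps] := Pms _ (Uzx x Ux).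
    rewrite -[(G z).[t]]subr0 -(eqP Pt) cabsC.
    rewrite !(@horner_coef_wide _ m.+1) ?(Gms z).2 ?ps // -sumrB.
    apply: le_lt_trans (cabs_sum _ _ _) _.
    apply: (@le_lt_trans _ _ (\sum_(k < m.+1) e ^+ m / (S + 1) * `|MV| ^+ k)).
      apply: ler_sum => k _; rewrite -mulrBl cabsM cabsX; apply: ler_pM.
      - exact: cabs_ge0.
      - by rewrite exprn_ge0 // cabs_ge0.
      - exact: ltW (close k).
      - rewrite lerXn2r ?nnegrE ?cabs_ge0 //.
        by apply: le_trans tM _; exact: ler_norm.
    rewrite -mulr_sumr -/S mulrAC ltr_pdivrMr // ltr_pM2l //.
    by rewrite ltrDl.
  move=> /(small_value_near_root (Gms z).1 (Gms z).2 e0)[r Gr tr].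
  by exists r; [rewrite GE root_prod_XsubC in Gr|exact: ltW].
move: cL; rewrite compact_ultra => /(_ F FU FL)[p [Lp Fp]].
exact: (Fesc p (LU _ Lp) Fp).
Qed.

(* If no ultrafilter escaped from [U], [boundary_vanish] would give [1 = 0]. *)
Lemma proper_family_degree_gt0 A m P i : proper_family A m P -> i \in A -> (0 < m)%N.
Proof.
move=> fP iA; rewrite lt0n; apply/eqP => m0; subst m.
have /eqP : (1 : C) = 0.
  apply: (@boundary_vanish R U (fun=> 1) oU _ _ x0 Ux0).
    by move=> z Uz; exact: differentiable_cst.
  move=> F FU FUU Fesc.
  have [G [Gms _ [c _ Gc]]] := boundary_limit fP iA FU FUU Fesc.
  have [Gm Gs] := Gms _ (row_const Ux0).
  have [rs /size0nil -> GE] := monic_prod_roots Gm Gs.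
  by have := Gc _ (row_const Ux0); rewrite GE root_prod_XsubC.
by rewrite oner_eq0.
Qed.

(** The vanishing resultants only give pairwise common roots. Comparison with a fixed [z0] covers a
    cube by finitely many closed sets, one for each root of [P (upd z0 i x)]; one root works on a
    smaller cube, hence everywhere by the identity theorem. *)
Lemma frozen_common_root A m P i x : proper_family A m P -> i \in A -> U x ->
  exists t, forall z, Un z -> root (P (upd z i x)) t.
Proof.
move=> fP iA Ux; have m0 := proper_family_degree_gt0 fP iA.
have [Pms Ph PV Pp] := fP.
have Uzx z y : Un z -> U y -> Un (upd z i y) by move=> Uz Uy; exact: cart_power_upd.
have det0 z w : Un z -> Un w -> forall y, U y ->
    \det (sylvester m (P (upd z i y)) (P (upd w i y))) = 0.
  move=> Uz Uw; apply: boundary_vanish => //.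
    move=> y Uy; apply: differentiable_sylvester => k.
      exact: (holB_slice i (Ph k) Uz Uy).
    exact: (holB_slice i (Ph k) Uw Uy).
  move=> F FU FUU Fesc; have FF : Filter F by exact: filter_filter.
  have [G [Gms GP [c _ Gc]]] := boundary_limit fP iA FU FUU Fesc.
  rewrite -(sylvester_common_root m0 (Gms z Uz).2 (Gms w Uw).2 (Gc z Uz) (Gc w Uw)).
  by apply: cvg_sylvester => k; exact: GP.
pose z0 : 'rV[C]_n := const_mx x0; have Uz0 : Un z0 by exact: row_const.
have [pm ps] := Pms _ (Uzx z0 x Uz0 Ux).
have [rs rsm PE] := monic_prod_roots pm ps.
have [d d0 Hd] := open_cube oU Uz0.
have Hh t : holB (fun z => (P (upd z i x)).[t]).
  apply: (@holB_horner R n U oU m.+1 (fun z => P (upd z i x))) => [z Uz|k].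
    by rewrite (Pms _ (Uzx z x Uz Ux)).2.
  exact: (holB_freeze i (Ph k) Ux).
have [|z z0z|t [c [e [trs e0 sub He]]]] := @closed_cover R n C rs
    (fun t z => root (P (upd z i x)) t) z0 d d0.
- move=> t z _ /Hd Uz nr.
  have r0 : 0 < cabs (P (upd z i x)).[t] by rewrite cabs_gt0; exact/negP.
  have [e e0 He] := holB_continuous oU (Hh t) Uz r0.
  exists e => // w zw /eqP rw; have := He w zw.
  by rewrite rw sub0r cabsN ltxx.
- have Uz := Hd _ z0z.
  have [pm' ps'] := Pms _ (Uzx z x Uz Ux).
  have [c /andP[c1 c2]] := sylvester_det0 m0 ps ps' (det0 z0 z Uz0 Uz x Ux).
  by exists c => //; rewrite PE root_prod_XsubC in c1.
exists t => z Uz; apply/eqP.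
apply: (@holB_identity R n U oU (fun z => (P (upd z i x)).[t]) c e cU (Hh t)) => //.
  by apply: Hd; apply: sub; exact: cube_center.
by move=> w Uw /He /eqP.
Qed.

Lemma freeze_family A m P i x : proper_family A m P -> U x ->
  proper_family (A :\ i) m (fun z => P (upd z i x)).
Proof.
move=> [Pms Ph PV Pp] Ux; split.
- by move=> z Uz; apply: Pms; exact: cart_power_upd.
- by move=> k; exact: (holB_freeze i (Ph k) Ux).
- by move=> z t Uz; apply: PV; exact: cart_power_upd.
move=> K cK KV; have [L cL HL] := Pp K cK KV; exists L => // z Uz Hz j.
rewrite !inE => /andP[ji jA]; have := HL _ (cart_power_upd i Uz Ux) Hz j jA.
by rewrite updE (negPf ji).
Qed.

(** Division by the fixed polynomial ['X - t%:P] is linear, so the coefficients of the quotient are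
    constant combinations of those of [P]. For properness, [t] is added to the compact set. *)
Lemma divide_family A m P t : proper_family A m P -> V t ->
  (forall z, Un z -> root (P z) t) ->
  (0 < m)%N /\ proper_family A m.-1 (fun z => P z %/ ('X - t%:P)).
Proof.
move=> [Pms Ph PV Pp] Vt Pt.
have PQ z : Un z -> P z = P z %/ ('X - t%:P) * ('X - t%:P).
  by move=> Uz; rewrite divpK // dvdp_XsubCl; exact: Pt.
have m0 : (0 < m)%N.
  have Uz0 := row_const Ux0; have [pm ps] := Pms _ Uz0.
  rewrite lt0n; apply/eqP => m0; have [rs rsm PE] := monic_prod_roots pm ps.
  by have := Pt _ Uz0; rewrite PE root_prod_XsubC (size0nil (etrans rsm m0)).
split => //; split.
- move=> z Uz; have [pm ps] := Pms z Uz; split.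
    by rewrite -(monicMr _ (monicXsubC t)) -PQ.
  by rewrite size_divp ?polyXsubC_eq0 // size_XsubC ps /= subn1 prednK.
- move=> k; apply: (@holB_ext R n U oU
    (fun z => \sum_(j < m.+1) (P z)`_j * ('X^j %/ ('X - t%:P))`_k)).
    move=> z Uz; have [pm ps] := Pms z Uz.
    rewrite -{2}[P z]coefK ps poly_def.
    rewrite (big_morph (fun p => p %/ ('X - t%:P)) (divpD _) (div0p _)) coef_sum.
    by apply: eq_bigr => j _; rewrite divpZl coefZ.
  by apply: holB_sum => j _; apply: holB_mul; [exact: Ph|exact: holB_cst].
- by move=> z u Uz Qu; apply: (PV z) => //; rewrite PQ // rootM Qu.
move=> K cK KV; have [||L cL HL] := Pp (K `|` [set t]).
- by apply: compactU => //; exact: compact_set1.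
- by move=> u [/KV//|->].
exists L => // z Uz Hz; apply: HL => // u; rewrite PQ // rootM root_XsubC.
by move=> /orP[/Hz|/eqP ->]; [left|right].
Qed.

Lemma card_le_degree A m P : proper_family A m P -> (#|A| <= m)%N.
Proof.
move: {2}#|A| (erefl #|A|) => k; elim: k A m P => [|k IH] A m P Ak fP.
  by rewrite Ak.
have [i iA] : exists i, i \in A by apply/set0Pn; rewrite -card_gt0 Ak.
have [t Ht] := frozen_common_root fP iA Ux0.
have fP' := freeze_family i fP Ux0.
have Vt : V t.
  have [_ _ PV _] := fP'; exact: PV (row_const Ux0) (Ht _ (row_const Ux0)).
have [m0 fQ] := divide_family fP' Vt Ht.
have Ak' : #|A :\ i| = k by move: Ak; rewrite (cardsD1 i A) iA add1n => -[].
by have := IH _ _ _ Ak' fQ; rewrite -(ltn_predK m0) Ak' Ak ltnS.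
Qed.

Lemma frozen_root_simple P i x t u : proper_family [set: 'I_n] n P -> U x ->
  (forall z, Un z -> root (P (upd z i x)) t) ->
  ~ (forall z, Un z -> root (P (upd z i x) %/ ('X - t%:P)) u).
Proof.
move=> fP Ux Pt Qu; have fP' := freeze_family i fP Ux.
have Uz0 := row_const Ux0.
have Vt : V t by have [_ _ PV _] := fP'; exact: PV Uz0 (Pt _ Uz0).
have [n0 fQ] := divide_family fP' Vt Pt.
have Vu : V u by have [_ _ QV _] := fQ; exact: QV Uz0 (Qu _ Uz0).
have [n1 /card_le_degree] := divide_family fQ Vu Qu.
rewrite leqNgt => /negP; apply.
have := cardsD1 i [set: 'I_n]; rewrite inE cardsT card_ord add1n => /(congr1 predn) /= <-.
by rewrite prednK.
Qed.

(** Dividing by the constant root would leave degree [n - 1] with [n] live variables. *)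
Lemma no_constant_root P t : proper_family [set: 'I_n] n P ->
  ~ (forall z, Un z -> root (P z) t).
Proof.
move=> fP Pt; have Uz0 := row_const Ux0.
have Vt : V t by have [_ _ PV _] := fP; exact: PV Uz0 (Pt _ Uz0).
have [n0 /card_le_degree] := divide_family fP Vt Pt.
by rewrite cardsT card_ord leqNgt prednK // leqnn.
Qed.

Lemma frozen_root_unique P i x t u : proper_family [set: 'I_n] n P -> U x ->
  (forall z, Un z -> root (P (upd z i x)) t) ->
  (forall z, Un z -> root (P (upd z i x)) u) -> t = u.
Proof.
move=> fP Ux Pt Pu; apply/eqP/negP => /negP tu.
apply: (frozen_root_simple fP Ux Pt (u := u)) => z Uz.
have := Pu z Uz; rewrite -{1}(@divpK _ ('X - t%:P) (P (upd z i x))).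
  by rewrite rootM root_XsubC eq_sym (negPf tu) orbF.
by rewrite dvdp_XsubCl; exact: Pt.
Qed.

End ProperFamilies.

(** * Symmetrization and Vieta's formulas *)

Section SymmetricProducts.
Variables (R : realType) (n : nat).
Local Notation C := R[i].
Implicit Types (y z w : 'rV[C]_n).

(* [rev_ord k] is [n - k - 1], the index of the elementary symmetric polynomial
   of degree [n - k]. *)
Definition vieta_poly w : {poly C} :=
  'X^n + \sum_(k < n) ((-1) ^+ (n - k) * w ord0 (rev_ord k)) *: 'X^k.

Lemma vieta_poly_symmetrization y :
  vieta_poly (symmetrization y) = \prod_i ('X - (y ord0 i)%:P).
Proof.
rewrite root_polyE poly_def big_ord_recr /= subnn expr0 mul1r addrC; congr (_ + _).
  rewrite /Defs.esym (eq_bigl (pred1 finset.set0)) ?big_pred1_eq ?big_set0 ?scale1r //.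
  by move=> J; rewrite cards_eq0.
apply: eq_bigr => k _; rewrite mxE /= subnSK //.
Qed.

Lemma coef_vieta_poly w k : (vieta_poly w)`_k =
  (k == n)%:R + \sum_(j < n) ((-1) ^+ (n - j) * w ord0 (rev_ord j)) * (k == j)%:R.
Proof.
rewrite coefD coefXn coef_sum; congr (_ + _).
by apply: eq_bigr => j _; rewrite coefZ coefXn.
Qed.

Lemma prod_XsubC_image y :
  \prod_i ('X - (y ord0 i)%:P) = \prod_(x <- [seq y ord0 i | i : 'I_n]) ('X - x%:P) :> {poly C}.
Proof. by rewrite big_image. Qed.

Lemma vieta_poly_monic y : vieta_poly (symmetrization y) \is monic /\
  size (vieta_poly (symmetrization y)) = n.+1.
Proof.
rewrite vieta_poly_symmetrization prod_XsubC_image; split; first exact: monic_prod_XsubC.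
by rewrite size_prod_XsubC size_image card_ord.
Qed.

Lemma root_vieta_poly y t :
  root (vieta_poly (symmetrization y)) t -> exists i, t = y ord0 i.
Proof.
rewrite vieta_poly_symmetrization prod_XsubC_image root_prod_XsubC.
by move=> /mapP[i _ ->]; exists i.
Qed.

Lemma symmetrization_perm y (s : {perm 'I_n}) :
  symmetrization (\row_j y ord0 (s j)) = symmetrization y.
Proof.
apply/symmetrization_eq_perm.
have -> : [seq (\row_j y ord0 (s j)) ord0 i | i : 'I_n] =
    map (fun j => y ord0 j) (map s (enum 'I_n)).
  by rewrite -map_comp; apply: eq_map => j; rewrite /= mxE.
apply: perm_map.
apply: uniq_perm; rewrite ?(map_inj_uniq (@perm_inj _ s)) ?enum_uniq //.
move=> j; rewrite mem_enum; apply/mapP; exists ((s^-1)%g j); rewrite ?mem_enum //.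
by rewrite permKV.
Qed.

Lemma cvg_rV (T : Type) (F : set_system T) (f : T -> 'rV[C]_n) (l : 'rV[C]_n) : Filter F ->
  (forall j, f s ord0 j @[s --> F] --> l ord0 j) -> f @ F --> l.
Proof.
move=> FF fl A /nbhs_ballP[e /= e0 eA].
have H j : F [set s | ball (l ord0 j) e (f s ord0 j)].
  exact: (fl j (ball (l ord0 j) e) (nbhsx_ballx (l ord0 j) e e0)).
apply: filterS (@filter_forall T 'I_n (fun j => [set s | ball (l ord0 j) e (f s ord0 j)]) F FF H).
by move=> s Hs; apply: eA; split; [exact: e0|move=> i j; rewrite ord1; exact: Hs].
Qed.

Lemma cvg_coord (F : set_system 'rV[C]_n) (l : 'rV[C]_n) j : F --> l ->
  s ord0 j @[s --> F] --> l ord0 j.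
Proof.
by move=> Fl A lA; apply: Fl; exact: (@coord_continuous C 1 n ord0 j l A lA).
Qed.

Lemma cvg_symmetrization (T : Type) (F : set_system T) (f : T -> 'rV[C]_n) (l : 'rV[C]_n) :
  Filter F -> (forall j, f s ord0 j @[s --> F] --> l ord0 j) ->
  symmetrization (f s) @[s --> F] --> symmetrization l.
Proof.
move=> FF fl; apply: cvg_rV => k; rewrite mxE /Defs.esym -big_filter.
rewrite (_ : (fun s => _) = (fun s => \sum_(J <- [seq J <- index_enum _ | #|J : {set 'I_n}| == k.+1])
    \prod_(j <- [seq j <- index_enum _ | j \in J]) f s ord0 j)).
  apply: (@cvg_sumC R T _ F _ (fun (J : {set 'I_n}) s => \prod_(j <- [seq j <- index_enum _ | j \in J]) f s ord0 j)
    (fun J : {set 'I_n} => \prod_(j in J) l ord0 j) FF) => J.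
  rewrite -big_filter.
  exact: (@cvg_prodC R T _ F _ (fun (j : 'I_n) s => f s ord0 j) (fun j => l ord0 j) FF).
apply/funext => s; rewrite mxE /Defs.esym big_filter; apply: eq_bigr => J _.
by rewrite big_filter.
Qed.

Lemma differentiable_rV (f : C -> 'rV[C]_n) a :
  (forall j, differentiable (fun t => f t ord0 j) a) -> differentiable f a.
Proof.
move=> df; rewrite (_ : f = \sum_(j < n) (fun t => f t ord0 j *: 'e_j)).
  apply: differentiable_sum => j.
  exact: (@differentiableZl C C _ (fun t => f t ord0 j) 'e_j a (df j)).
by apply/funext => t; rewrite fct_sumE; exact: row_sum_delta.
Qed.

Lemma differentiable_symmetrization_slice z i a :
  differentiable (fun t => symmetrization (upd z i t)) a.
Proof.
apply: differentiable_rV => k.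
rewrite (_ : (fun s => _) = (fun t => \sum_(J <- [seq J <- index_enum _ | #|J : {set 'I_n}| == k.+1])
    \prod_(j <- [seq j <- index_enum _ | j \in J]) (upd z i t) ord0 j)).
  apply: (@differentiable_sumC R _ _ (fun (J : {set 'I_n}) t =>
    \prod_(j <- [seq j <- index_enum _ | j \in J]) (upd z i t) ord0 j)) => J.
  apply: (@differentiable_prodC R _ _ (fun (j : 'I_n) t => (upd z i t) ord0 j)) => j.
  rewrite (_ : (fun t => _) = (fun t => if j == i then t else z ord0 j)).
    by case: (j == i); [exact: ex_diff|exact: differentiable_cst].
  by apply/funext => t; rewrite updE.
apply/funext => s; rewrite mxE /Defs.esym big_filter; apply: eq_bigr => J _.
by rewrite big_filter.
Qed.

Lemma esym_bound y (M : R) k : 1 <= M -> (forall i, cabs (y ord0 i) <= M) ->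
  cabs (Defs.esym k y) <= \sum_(J : {set 'I_n}) M ^+ n.
Proof.
move=> M1 yM; rewrite /Defs.esym; apply: le_trans (cabs_sum _ _ _) _.
apply: (@le_trans _ _ (\sum_(J : {set 'I_n} | #|J| == k) M ^+ n)).
  apply: ler_sum => J _; rewrite cabs_prod.
  apply: (@le_trans _ _ (\prod_(j in J) M)).
    by apply: ler_prod => j _; rewrite cabs_ge0 yM.
  rewrite prodr_const ler_weXn2l //.
  by apply: leq_trans (max_card _) _; rewrite card_ord.
rewrite [leRHS](bigID (fun J : {set 'I_n} => #|J| == k)) /= lerDl.
by apply: sumr_ge0 => J _; rewrite exprn_ge0 // (le_trans ler01).
Qed.

Lemma bounded_set_cabs (A : set C) : bounded_set A -> exists M : R, forall t, A t -> cabs t <= M.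
Proof.
move=> [M [Mr HM]]; exists (complex.Re (M + 1)) => t At.
have M1 : M < M + 1 by rewrite ltrDl ltr01.
have : `|t| <= M + 1 := HM (M + 1) M1 t At.
by rewrite cabsE lecE => /andP[_].
Qed.

End SymmetricProducts.

(** * The root function *)

Section MainArgument.
Variables (R : realType) (n : nat) (U V : set R[i]) (MU MV : R) (x0 : R[i]) (i0 : 'I_n).
Local Notation C := R[i].
Hypotheses (oU : open U) (cU : connected U) (Ux0 : U x0).
Hypotheses (bU : forall t, U t -> cabs t <= MU).
Hypotheses (oV : open V) (bV : forall t, V t -> cabs t <= MV).
Local Notation Un := (cart_power n U).
Local Notation holB := (holB U).
Variable Phi : 'rV[C]_n -> 'rV[C]_n.
Hypothesis dPhi : holomorphic_on (sym_power n U) Phi.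
Hypothesis pPhi : proper_map (sym_power n U) (sym_power n V) Phi.
Implicit Types (z w y : 'rV[C]_n) (t u c x : C).

Let P z := vieta_poly (Phi (symmetrization z)).

Lemma Phi_lift z : Un z -> exists2 y, cart_power n V y & Phi (symmetrization z) = symmetrization y.
Proof.
move=> Uz; have [|y Vy yE] := pPhi.1 (symmetrization z); first by exists z.
by exists y.
Qed.

Lemma Phi_coord_holB j : holB (fun z => Phi (symmetrization z) ord0 j).
Proof.
split.
  pose M := `|MV| + 1; have M1 : 1 <= M by rewrite lerDr.
  exists (\sum_(J : {set 'I_n}) M ^+ n) => z /Phi_lift[y Vy ->].
  rewrite mxE; apply: esym_bound => // i.
  by apply: le_trans (bV (Vy i)) _; apply: le_trans (ler_norm _) _; rewrite lerDl.
move=> z i Uz.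
have d1 : differentiable (fun t => symmetrization (upd z i t)) (z ord0 i).
  exact: differentiable_symmetrization_slice.
have d2 : differentiable Phi (symmetrization (upd z i (z ord0 i))).
  by apply: dPhi; exists z; rewrite ?upd_id.
have d3 := differentiable_comp d1 d2.
exact: (differentiable_comp d3 (differentiable_coord _ ord0 j)).
Qed.

(** Properness of the symmetrization in terms of coordinates: the set consists of all coordinates of
    the lifts of points of [W]. It is compact because a limit of roots is a root of the limit
    polynomial. *)
Lemma compact_roots (W : set 'rV[C]_n) : compact W -> W `<=` sym_power n U ->
  compact [set t | exists2 w, W w & root (vieta_poly w) t].
Proof.
move=> cW WU; rewrite compact_ultra => F FU FL.
have [|om Hom] := @boolp.choice C 'rV[C]_n (fun t w =>
    (exists2 w, W w & root (vieta_poly w) t) -> W w /\ root (vieta_poly w) t).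
  move=> t; have [[w Ww wt]|nw] := pselect (exists2 w, W w & root (vieta_poly w) t).
    by exists w.
  by exists 0.
have FF : ProperFilter F by exact: ultra_proper.
have [t Ft _] : exists2 t, id @ F --> t & cabs t <= MU.
  apply: bounded_ultra_cvg; apply: filterS FL => t [w /WU[z Uz <-]] /root_vieta_poly[i ->].
  exact: bU.
have omU := ultra_fmap om FU.
have omW : F (om @^-1` W) by apply: filterS FL => s /Hom[Ws _].
move: cW; rewrite compact_ultra => /(_ _ omU omW)[w [Ww Fw]].
exists t; split; last exact: Ft.
exists w => //; have [z Uz wE] := WU w Ww.
have sz s : W s -> (size (vieta_poly s) <= n.+1)%N.
  by move=> /WU[z' _ <-]; rewrite (vieta_poly_monic z').2.
have coefs k : (vieta_poly (om s))`_k @[s --> F] --> (vieta_poly w)`_k.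
  rewrite coef_vieta_poly.
  rewrite (_ : (fun s => _) = (fun s => (k == n)%:R +
     \sum_(j < n) ((-1) ^+ (n - j) * om s ord0 (rev_ord j)) * (k == j)%:R)); last first.
    by apply/funext => s; rewrite coef_vieta_poly.
  have omj j : om s ord0 j @[s --> F] --> w ord0 j.
    exact: (@cvg_coord R n (om @ F) w j Fw).
  have HS : \sum_(j < n) ((-1) ^+ (n - j) * om s ord0 (rev_ord j)) * (k == j)%:R @[s --> F] -->
      \sum_(j < n) ((-1) ^+ (n - j) * w ord0 (rev_ord j)) * (k == j)%:R.
    apply: (@cvg_sumC R C _ F _ (fun (j : 'I_n) s => ((-1) ^+ (n - j) * om s ord0 (rev_ord j)) * (k == j)%:R)
      (fun j : 'I_n => ((-1) ^+ (n - j) * w ord0 (rev_ord j)) * (k == j)%:R)) => j.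
    apply: (@cvg_mulC R C F (fun s => (-1) ^+ (n - j) * om s ord0 (rev_ord j)) (fun=> (k == j)%:R)).
      apply: (@cvg_mulC R C F (fun=> (-1) ^+ (n - j)) (fun s => om s ord0 (rev_ord j))).
        exact: cvg_cst.
      exact: omj.
    exact: cvg_cst.
  exact: (@cvgD C C C F _ (fun=> (k == n)%:R) _ _ _ (cvg_cst _) HS).
have szF : F [set s | (size (vieta_poly (om s)) <= n.+1)%N].
  by apply: filterS FL => s /Hom[Ws _]; exact: sz.
have H := @horner_cvg R C F n.+1 (fun s => vieta_poly (om s)) (vieta_poly w) id t FF
  (sz w Ww) szF (fun k _ => coefs k) Ft.
apply/eqP/eqP; rewrite -cabs_eq0 eq_le cabs_ge0 andbT leNgt; apply/negP => e0.
have := filter_ex (filterI FL (cvg_cabs_lt H e0)).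
by move=> [s [/Hom[_ /eqP rs]]] /=; rewrite rs sub0r cabsN ltxx.
Qed.

(** For properness, the symmetrized power of [K] is compact in [sym_power n V], hence so is its
    preimage under [Phi]; the compact set sought collects the coordinates of the lifts of this
    preimage. *)
Lemma Phi_family : proper_family U V [set: 'I_n] n P.
Proof.
split.
- by move=> z /Phi_lift[y _ yE]; rewrite /P yE; exact: vieta_poly_monic.
- move=> k; rewrite (_ : (fun z => _) = (fun z => (k == n)%:R +
     \sum_(j < n) ((-1) ^+ (n - j) * Phi (symmetrization z) ord0 (rev_ord j)) * (k == j)%:R)).
    apply: holB_add; first exact: holB_cst.
    apply: holB_sum => j _; apply: holB_mul; last exact: holB_cst.
    by apply: holB_mul; [exact: holB_cst|exact: Phi_coord_holB].
  by apply/funext => z; rewrite coef_vieta_poly.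
- by move=> z t /Phi_lift[y Vy yE]; rewrite /P yE => /root_vieta_poly[i ->].
move=> K cK KV; pose SK := @symmetrization C n @` cart_power n K.
have cSK : compact SK.
  apply: continuous_compact; last exact: (@rV_compact C n (fun=> K)).
  apply: continuous_subspaceT => z.
  apply: (@cvg_symmetrization R n _ (nbhs z) id z) => j.
  exact: (@coord_continuous C 1 n ord0 j z).
have SKV : SK `<=` sym_power n V by move=> _ [y Ky <-]; exists y => // i; exact: KV.
have cW := pPhi.2 SK SKV cSK.
exists [set t | exists2 w, (sym_power n U `&` Phi @^-1` SK) w & root (vieta_poly w) t].
  split; first by apply: compact_roots cW _ => w [].
  by move=> t [_ [[z Uz <-] _] /root_vieta_poly[i ->]].
move=> z Uz Hz i _; exists (symmetrization z).
  split; first by exists z.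
  have [y Vy yE] := Phi_lift Uz; rewrite /preimage /= yE; exists y => // j.
  apply: Hz; rewrite /P yE vieta_poly_symmetrization prod_XsubC_image root_prod_XsubC.
  exact: map_f (mem_enum _ _).
rewrite vieta_poly_symmetrization prod_XsubC_image root_prod_XsubC.
by apply: map_f; rewrite mem_enum.
Qed.

(** [P] is invariant under permutations of the coordinates, so the root found for the index [i0]
    serves all indices. *)
Lemma frozen_symmetric z i x t : U x ->
  (forall z, Un z -> root (P (upd z i0 x)) t) -> Un z -> root (P (upd z i x)) t.
Proof.
move=> Ux H Uz; pose s := tperm i i0.
have -> : P (upd z i x) = P (upd (\row_j z ord0 (s j)) i0 x).
  rewrite /P -(symmetrization_perm (upd z i x) s); congr (vieta_poly (Phi (symmetrization _))).
  apply/rowP => j; rewrite !mxE; congr (if _ then _ else _).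
  by rewrite -{1}(tpermR i i0) (inj_eq perm_inj).
by apply: H => j; rewrite mxE.
Qed.

Lemma exists_root_function : exists phi : C -> C, forall x, U x ->
  V (phi x) /\ forall i z, Un z -> root (P (upd z i x)) (phi x).
Proof.
have [|phi Hphi] := @boolp.choice C C (fun x t => U x -> V t /\
    forall i z, Un z -> root (P (upd z i x)) t); last by exists phi.
move=> x; have [Ux|nUx] := pselect (U x); last by exists 0.
have [t Ht] := frozen_common_root oU cU Ux0 oV bV Phi_family (finset.in_setT i0) Ux.
exists t => _; split; last by move=> i z Uz; exact: frozen_symmetric.
have [_ _ PV _] := Phi_family.
apply: PV (cart_power_upd i0 (row_const Ux0) Ux) (Ht _ (row_const Ux0)).
Qed.

Variable phi : C -> C.
Hypothesis phiV : forall x, U x -> V (phi x).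
Hypothesis phi_root : forall x i z, U x -> Un z -> root (P (upd z i x)) (phi x).

Let P_size z : Un z -> (size (P z) <= n.+1)%N.
Proof. by have [Pms _ _ _] := Phi_family => /Pms[_ ->]. Qed.

Let P_hol k : holB (fun z => (P z)`_k).
Proof. by have [_ Ph _ _] := Phi_family; exact: Ph. Qed.

Let P_root z i : Un z -> root (P z) (phi (z ord0 i)).
Proof. by move=> Uz; rewrite -{1}(upd_id z i); apply: phi_root. Qed.

(** Any limit value of [phi] at [x] is a root of all the polynomials frozen at [x]; by uniqueness it
    is [phi x]. *)
Lemma root_function_continuous x : U x -> {for x, continuous phi}.
Proof.
move=> Ux; apply/continuous_cabsP => e e0; apply: contrapT => H.
have {}H d : 0 < d -> exists2 t, U t /\ e <= cabs (phi t - phi x) & cabs (t - x) < d.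
  move=> d0; have [r r0 Hr] := open_disc oU Ux.
  apply: contrapT => nt; apply: H; exists (Num.min d r) => [|w]; first by rewrite lt_min d0.
  rewrite lt_min => /andP[wd wr]; rewrite ltNge; apply/negP => ew.
  by apply: nt; exists w => //; split => //; exact: Hr.
pose D := [set t | U t /\ e <= cabs (phi t - phi x)].
pose F0 : set_system C := filter_from [set d : R | 0 < d] (fun d => [set t | D t /\ cabs (t - x) < d]).
have F0F : ProperFilter F0.
  apply: filter_from_proper; last by move=> d /H[t Dt tx]; exists t.
  apply: filter_from_filter; first by exists 1; rewrite /= ltr01.
  move=> d d' d0 d'0; exists (Num.min d d'); first by rewrite /= lt_min d0.
  by move=> t [Dt]; rewrite lt_min => /andP[td td']; split.
have [F [FU F0sub]] := ultraFilterLemma F0F.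
have FD : F D by apply: F0sub; exists 1; [rewrite /= ltr01|move=> t []].
have Fx : id @ F --> x.
  move=> A /nbhs_cabsP[r r0 rA]; apply: F0sub; exists r => // t [_ tx]; exact: rA.
have FF : ProperFilter F by exact: ultra_proper.
have [l Fl _] : exists2 l, phi @ F --> l & cabs l <= MV.
  by apply: bounded_ultra_cvg; apply: filterS FD => t [Ut _]; apply: bV; exact: phiV.
have lE : l = phi x.
  apply: (frozen_root_unique oU cU Ux0 oV bV Phi_family Ux (i := i0)); last by move=> z; exact: phi_root.
  move=> z Uz; have coefs k : (P (upd z i0 t))`_k @[t --> F] --> (P (upd z i0 x))`_k.
    have cx := cderiv_continuous (holB_slice i0 (P_hol k) Uz Ux).
    exact: (cvg_comp _ _ Fx cx).
  have szF : F [set t | (size (P (upd z i0 t)) <= n.+1)%N].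
    by apply: filterS FD => t [Ut _]; apply: P_size; exact: cart_power_upd.
  have Hc := @horner_cvg R C F n.+1 (fun t => P (upd z i0 t)) _ phi l FF
    (P_size (cart_power_upd i0 Uz Ux)) szF (fun k _ => coefs k) Fl.
  apply/eqP; apply/eqP; rewrite -cabs_eq0 eq_le cabs_ge0 andbT leNgt; apply/negP => c0.
  have := filter_ex (filterI FD (cvg_cabs_lt Hc c0)).
  move=> [t [[Ut _]]] /=; have /eqP -> := phi_root i0 Ut Uz.
  by rewrite sub0r cabsN ltxx.
have := filter_ex (filterI FD (cvg_cabs_lt Fl e0)).
by move=> [t [[_ et]]] /=; rewrite lE ltNge et.
Qed.

(** By [frozen_root_simple] some [z] makes [phi x] a simple root of [P (upd z i0 x)], and
    [differentiable_root] applies along this slice. *)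
Lemma root_function_differentiable x : U x -> differentiable phi x.
Proof.
move=> Ux; have Uz0 := row_const Ux0.
have [z [Uz Qz]] : exists z, Un z /\ ~ root (P (upd z i0 x) %/ ('X - (phi x)%:P)) (phi x).
  apply: contrapT => H.
  apply: (frozen_root_simple oU cU Ux0 oV bV Phi_family Ux (i := i0) (t := phi x) (u := phi x)).
    by move=> z; exact: phi_root.
  by move=> z Uz; apply: contrapT => nr; apply: H; exists z.
have [d d0 Hd] := open_disc oU Ux.
apply: (@differentiable_root R n.+1 (fun t => P (upd z i0 t)) phi x d d0).
- by move=> t /Hd Ut; apply: P_size; exact: cart_power_upd.
- by move=> k _; exact: (holB_slice i0 (P_hol k) Uz Ux).
- exact: root_function_continuous.
- by move=> t /Hd Ut; exact: phi_root.
rewrite hpoly_diag; last by apply: P_size; exact: cart_power_upd.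
apply/eqP => dP; apply: Qz; apply/eqP; rewrite -dP.
have /divpK PE : 'X - (phi x)%:P %| P (upd z i0 x) by rewrite dvdp_XsubCl; exact: phi_root.
rewrite -{2}PE derivM derivXsubC mulr1 hornerD hornerM hornerXsubC subrr mulr0 add0r //.
Qed.

(** Otherwise [c] would be a root of [P w] for all [w] near the diagonal point of coordinates [x],
    hence for all [w], and [P] would have a constant root. *)
Lemma root_function_not_locally_constant x c (d : R) : U x -> 0 < d ->
  ~ (forall t, U t -> cabs (t - x) < d -> phi t = c).
Proof.
move=> Ux d0 H; apply: (no_constant_root oU cU Ux0 oV bV Phi_family (t := c)) => z Uz.
apply/eqP; apply: (@holB_identity R n U oU (fun z => (P z).[c]) (const_mx x) d cU) => //.
- by apply: (@holB_horner R n U oU n.+1 P) => [w|k]; [exact: P_size|exact: P_hol].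
- exact: row_const.
move=> w Uw xw; apply/eqP; rewrite -(H (w ord0 i0)) //; first exact: P_root.
by have := xw i0; rewrite mxE.
Qed.

Lemma distinct_factorization z : Un z -> (forall i j, phi (z ord0 i) = phi (z ord0 j) -> i = j) ->
  P z = \prod_i ('X - (phi (z ord0 i))%:P).
Proof.
move=> Uz inj; have [Pms _ _ _] := Phi_family; have [pm ps] := Pms z Uz.
have -> : \prod_i ('X - (phi (z ord0 i))%:P) =
    \prod_(x <- [seq phi (z ord0 i) | i : 'I_n]) ('X - x%:P) by rewrite big_image.
rewrite -[RHS]scale1r -(monicP pm); apply: all_roots_prod_XsubC.
- by rewrite size_image card_ord ps.
- by apply/allP => _ /mapP[i _ ->]; exact: P_root.
- by rewrite uniq_rootsE map_inj_uniq ?enum_uniq.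
Qed.

(** If the two sides differed at [z], they would differ on a cube, at each point of which two of the
    values of [phi] coincide. By [closed_cover] one pair of indices would serve on a smaller cube;
    moving only one of these two coordinates would make [phi] locally constant. *)
Lemma factorization z : Un z -> P z = \prod_i ('X - (phi (z ord0 i))%:P).
Proof.
move=> Uz; have hP t : holB (fun z => (P z).[t]).
  by apply: (@holB_horner R n U oU n.+1 P) => [w|k]; [exact: P_size|exact: P_hol].
suff eqv t : (P z).[t] = (\prod_i ('X - (phi (z ord0 i))%:P)).[t].
  apply/eqP; rewrite -subr_eq0; apply/eqP.
  apply: (@roots_geq_poly_eq0 _ _ [seq (k%:R : C) | k <- iota 0 (size (P z - \prod_i ('X - (phi (z ord0 i))%:P)))]).
  - by apply/allP => t _; rewrite /root hornerD hornerN eqv subrr.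
  - by rewrite map_inj_uniq ?iota_uniq // => k l /eqP; rewrite eqr_nat => /eqP.
  - by rewrite size_map size_iota.
apply/eqP; rewrite -subr_eq0 -cabs_eq0; apply/negP => /negP c0.
have FF := cubeF_filter z (0 : C).
have cphi (i : 'I_n) : phi ((p.1.1 : 'rV[C]_n) ord0 i) @[p --> cubeF z 0] --> phi (z ord0 i).
  move=> A /(root_function_continuous (Uz i)) /nbhs_cabsP[r r0 rA].
  by exists r => // p [zp _ _]; apply: rA; exact: zp.
have cprod : \prod_i (t - phi ((p.1.1 : 'rV[C]_n) ord0 i)) @[p --> cubeF z 0] --> \prod_i (t - phi (z ord0 i)).
  apply: (@cvg_prodC R _ _ (cubeF z 0) _ (fun (i : 'I_n) (p : 'rV[C]_n * C * C) => t - phi (p.1.1 ord0 i))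
    (fun i => t - phi (z ord0 i))) => i.
  exact: (@cvgB C C _ (cubeF z 0) _ (fun=> t) _ _ _ (cvg_cst t) (cphi i)).
have FF' : Filter (cubeF z 0) by exact: filter_filter.
have cdiff := @cvgB C C _ (cubeF z 0) FF' _ _ _ _ (cubeF_holB oU 0 (hP t) Uz) cprod.
have {}c0 : 0 < cabs ((P z).[t] - \prod_i (t - phi (z ord0 i))).
  rewrite lt_def cabs_ge0 andbT; move: c0; rewrite horner_prod.
  by under eq_bigr do rewrite hornerXsubC.
have [d1 d10 Hd1] := cvg_cabs_lt cdiff c0.
have [d2 d20 Hd2] := open_cube oU Uz.
pose d := Num.min d1 d2; have d0 : 0 < d by rewrite lt_min d10.
have in1 w : cube z d w -> cube z d1 w by apply: cubeW; rewrite ge_min lexx.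
have in2 w : cube z d w -> Un w by move=> zw; apply: Hd2; apply: cubeW zw; rewrite ge_min lexx orbT.
have [||[i j] [c' [d' [ij d'0 sub Hc]]]] := @closed_cover R n _
    [seq p <- enum {: 'I_n * 'I_n} | p.1 != p.2]
    (fun p w => phi (w ord0 p.1) = phi (w ord0 p.2)) z d d0.
- move=> [i j] w /= _ /in2 Uw /eqP; rewrite -subr_eq0 -cabs_gt0 => e0.
  have e2 : 0 < cabs (phi (w ord0 i) - phi (w ord0 j)) / 2 by rewrite divr_gt0.
  have [r1 r10 H1] := (continuous_cabsP _ _).1 (root_function_continuous (Uw i)) _ e2.
  have [r2 r20 H2] := (continuous_cabsP _ _).1 (root_function_continuous (Uw j)) _ e2.
  exists (Num.min r1 r2) => [|w' ww' E]; first by rewrite lt_min r10.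
  have h1 : cabs (phi (w' ord0 i) - phi (w ord0 i)) < cabs (phi (w ord0 i) - phi (w ord0 j)) / 2.
    by apply: H1; apply: lt_le_trans (ww' i) _; rewrite ge_min lexx.
  have h2 : cabs (phi (w' ord0 j) - phi (w ord0 j)) < cabs (phi (w ord0 i) - phi (w ord0 j)) / 2.
    by apply: H2; apply: lt_le_trans (ww' j) _; rewrite ge_min lexx orbT.
  rewrite /= in E; rewrite -E in h2.
  have := cabs_dist3 (phi (w ord0 i)) (phi (w ord0 j)) (phi (w' ord0 i)).
  by rewrite [cabs (phi (w ord0 i) - phi (w' ord0 i))]cabsC; lra.
- move=> w zw; apply: contrapT => nex.
  have inj i j : phi (w ord0 i) = phi (w ord0 j) -> i = j.
    move=> E; apply/eqP; apply: contrapT => /negP ij; apply: nex; exists (i, j) => //.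
    by rewrite mem_filter ij mem_enum.
  have c00 : cabs (0 - 0 : C) < d1 by rewrite subrr cabs0.
  have := Hd1 (w, 0, 0) (And3 (in1 w zw) c00 c00); rewrite /= !fctE /=.
  rewrite (distinct_factorization (in2 w zw) inj) horner_prod.
  under [X in cabs (X - _ - _)]eq_bigr do rewrite hornerXsubC.
  by rewrite subrr sub0r cabsN ltxx.
move: ij; rewrite mem_filter /= => /andP[ij _].
have c'c := cube_center c' d'0; have Uc' := in2 _ (sub _ c'c).
apply: (root_function_not_locally_constant (Uc' i) d'0 (c := phi (c' ord0 j))) => t' Ut' tc'.
have := Hc (upd c' i t') (cube_upd c'c tc'); rewrite /= upd_same updE.
by rewrite eq_sym (negPf ij).
Qed.

Lemma Phi_eq z : Un z -> Phi (symmetrization z) = symmetrization (map_mx phi z).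
Proof.
move=> Uz; have [y Vy yE] := Phi_lift Uz; rewrite yE.
apply/symmetrization_eq_perm/prod_XsubC_eq; rewrite -!prod_XsubC_image.
rewrite -vieta_poly_symmetrization -yE -/(P z) factorization //.
by apply: eq_bigr => i _; rewrite mxE.
Qed.

(** At the diagonal point of coordinates [x], the only root of [P] is [phi x]; properness of the
    family there confines [x] to a compact part of [U] when [phi x] is in [K]. Continuity of [phi]
    does the rest. *)
Lemma root_function_proper : proper_map U V phi.
Proof.
split=> // K KV cK.
have [_ _ _ /(_ K cK KV)[L [cL LU] HL]] := Phi_family.
rewrite compact_ultra => F FU FUK.
have FL : F L.
  apply: filterS FUK => x [Ux Kx].
  have := HL (const_mx x) (row_const Ux) _ i0; rewrite mxE; apply; last by rewrite finset.in_setT.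
  move=> t; rewrite factorization; last exact: row_const.
  rewrite /root horner_prod prodf_seq_eq0 => /hasP[i _ /=].
  by rewrite mxE hornerXsubC subr_eq0 => /eqP ->.
move: cL; rewrite compact_ultra => /(_ F FU FL)[p [/LU Up Fp]].
exists p; split => //; split => //.
have cphi : phi @ F --> phi p by apply: cvg_trans (root_function_continuous Up); exact: cvg_app.
have FKU := ultra_fmap phi FU.
have FK : (phi @ F) K.
  by move: FUK; rewrite /nbhs /=; apply: filterS => x [].
have cK' := cK; move: cK'; rewrite compact_ultra => /(_ _ FKU FK)[q [Kq Fq]].
suff E : phi p = q by rewrite /preimage /= E.
apply/eqP; rewrite -subr_eq0 -cabs_eq0; apply/negP => /negP c0.
have {}c0 : 0 < cabs (phi p - q) / 2 by rewrite divr_gt0 // lt_def c0 cabs_ge0.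
have FF : ProperFilter F by exact: ultra_proper.
have := filter_ex (filterI (cvg_cabs_lt cphi c0) (cvg_cabs_lt Fq c0)).
move=> [t [/= h1 h2]]; have := cabs_dist3 (phi p) q (phi t).
by rewrite [cabs (phi p - phi t)]cabsC; lra.
Qed.

End MainArgument.

Set Strict Implicit.
Unset Implicit Arguments.

Theorem corollary1p3 (R : realType) (n : nat) (hn : (2 <= n)%N)
    (U V : set R[i])
    (domU : domain U) (bndU : bounded_set U)
    (domV : domain V) (bndV : bounded_set V)
    (Phi : 'rV[R[i]]_n -> 'rV[R[i]]_n)
    (hPhi : proper_holomorphic (sym_power n U) (sym_power n V) Phi) :
  exists phi : R[i] -> R[i],
    proper_holomorphic U V phi /\
    forall w, sym_power n U w -> Phi w = sym_map U phi w.
Proof.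
have [oU cU [x0 Ux0]] := domU; have [oV _ _] := domV.
have [MU bU] := bounded_set_cabs bndU; have [MV bV] := bounded_set_cabs bndV.
have [dPhi pPhi] := hPhi.
have i0 : 'I_n by exact: Ordinal (ltnW hn).
have [phi Hphi] := exists_root_function i0 oU cU Ux0 bU oV bV dPhi pPhi.
have phiV x : U x -> V (phi x) by move=> /Hphi[].
have phi_root x i z (Ux : U x) := (Hphi x Ux).2 i z.
exists phi; split; first split.
- exact: (root_function_differentiable i0 oU cU Ux0 bU oV bV dPhi pPhi phiV phi_root).
- exact: (root_function_proper i0 oU cU Ux0 bU oV bV dPhi pPhi phiV phi_root).
apply: sym_map_unique.
exact: (Phi_eq i0 oU cU Ux0 bU oV bV dPhi pPhi phiV phi_root).
Qed.
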